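(* Let $d\ge2$ and let $C,C_1,C_2,\ldots$ be $d$-dimensional Archimedean copulas with generators $\psi,\psi_1,\psi_2,\ldots$ and pseudoinverses $\varphi,\varphi_1,\varphi_2,\ldots$, respectively. Then any of the following assertions (i)-(vi), which are equivalent to each other, is equivalent to any of the assertions (vii)-(ix): (i) $(C_n)_{n\in\mathbb{N}}$ converges uniformly to $C$; (ii) $(C_n^{ij})_{n\in\mathbb{N}}$ converges uniformly to $C^{ij}$ for any $1\le i<j\le d$; (iii) $(\varphi_n)_{n\in\mathbb{N}}$ converges pointwise to $\varphi$ on $(0,1]$; (iv) $(\psi_n)_{n\in\mathbb{N}}$ converges uniformly to $\psi$ on $[0,\infty)$; (v) $(\psi_n^{(m)})_{n\in\mathbb{N}}$ converges pointwise to $\psi^{(m)}$ on $(0,\infty)$ for $m\in\{1,\ldots,d-2\}$ and $(D^-\psi_n^{(d-2)})_{n\in\mathbb{N}}$ converges pointwise to $D^-\psi^{(d-2)}$ on the set $\mathrm{Cont}(D^-\psi^{(d-2)})$ of continuity points of $D^-\psi^{(d-2)}$; (vi) $(c_n^{1:m})_{n\in\mathbb{N}}$ converges to $c^{1:m}$ almost everywhere in $\mathbb{I}^m$, $m\in\{2,\ldots,d-1\}$; (vii) $(C_n)_{n\in\mathbb{N}}$ converges to $C$ with respect to $D_i$, $i=1,2$; (viii) $(C_n)_{n\in\mathbb{N}}$ converges to $C$ with respect to $D_\infty$; (ix) $(C_n)_{n\in\mathbb{N}}$ converges $1$-weakly conditional to $C$.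
   Context: Notation: $\mathbb{I}=[0,1]$; $\lambda_m$ is Lebesgue measure on $\mathbb{I}^m$; $[\mathbf{0},\mathbf{y}]=[0,y_1]\times\cdots\times[0,y_{d-1}]$ for $\mathbf{y}\in\mathbb{I}^{d-1}$; $\mathcal{B}(\cdot)$ denotes the Borel $\sigma$-field. Archimedean copulas: a generator is a continuous, non-increasing function $\psi:[0,\infty)\to\mathbb{I}$ with $\psi(0)=1$, $\lim_{z\to\infty}\psi(z)=0$, strictly decreasing on $[0,\inf\{z\in[0,\infty]:\psi(z)=0\}]$ (with $\psi(\infty):=0$). $\varphi:(0,1]\to[0,\infty)$ denotes the pseudoinverse of $\psi$, and $\varphi(0):=\inf\{z\in[0,\infty]:\psi(z)=0\}$. A $d$-dimensional copula $C$ is Archimedean with generator $\psi$ if $C(\mathbf{x})=\psi(\varphi(x_1)+\cdots+\varphi(x_d))$ for all $\mathbf{x}\in\mathbb{I}^d$. The right-hand side is a $d$-dimensional copula if and only if $\psi$ is $d$-monotone: $\psi$ is continuous on $[0,\infty)$, has derivatives $\psi^{(m)}$ up to order $d-2$ on $(0,\infty)$ with $(-1)^m\psi^{(m)}\ge0$ for $m=0,\ldots,d-2$, and $(-1)^{d-2}\psi^{(d-2)}$ is non-increasing and convex on $(0,\infty)$. All generators are normalized so that $\psi(1)=\frac12$, equivalently $\varphi(\frac12)=1$. $D^-$ denotes the left-hand derivative. Marginals: $C^{ij}$ is the bivariate marginal copula of coordinates $i,j$ (all other arguments set to $1$); $C^{1:m}(\mathbf{x})=C(\mathbf{x},1,\ldots,1)$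 for $\mathbf{x}\in\mathbb{I}^m$, and $c^{1:m}$ is the density of the measure $\mu_{C^{1:m}}$ induced by $C^{1:m}$ (for Archimedean copulas all lower-dimensional marginals are absolutely continuous); $c_n^{1:m}$ is the analogous density for $C_n$. $1$-Markov kernels: $K_C:\mathbb{I}\times\mathcal{B}(\mathbb{I}^{d-1})\to\mathbb{I}$ is (a version of) the regular conditional distribution of $(X_2,\ldots,X_d)$ given $X_1$, where $(X_1,\ldots,X_d)\sim C$. Metrics: for $d$-dimensional copulas $A,B$, $D_1(A,B)=\int_{\mathbb{I}^d}|K_A(x,[\mathbf{0},\mathbf{y}])-K_B(x,[\mathbf{0},\mathbf{y}])|\,\mathrm{d}\lambda_d(x,\mathbf{y})$, $D_2^2(A,B)=\int_{\mathbb{I}^d}(K_A(x,[\mathbf{0},\mathbf{y}])-K_B(x,[\mathbf{0},\mathbf{y}]))^2\,\mathrm{d}\lambda_d(x,\mathbf{y})$, $D_\infty(A,B)=\sup_{\mathbf{y}\in\mathbb{I}^{d-1}}\int_{\mathbb{I}}|K_A(x,[\mathbf{0},\mathbf{y}])-K_B(x,[\mathbf{0},\mathbf{y}])|\,\mathrm{d}\lambda_1(x)$. Uniform convergence of copulas is convergence with respect to $d_\infty(A,B)=\max_{\mathbf{x}\in\mathbb{I}^d}|A(\mathbf{x})-B(\mathbf{x})|$ (with the analogous metric for bivariate marginals). $(C_n)$ converges $1$-weakly conditional to $C$ if there is a set $\Lambda\in\mathcal{B}(\mathbb{I})$ with $\lambda_1(\Lambda)=1$ such that for every $x\in\Lambda$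 the probability measures $K_{C_n}(x,\cdot)$ on $\mathcal{B}(\mathbb{I}^{d-1})$ converge weakly to $K_C(x,\cdot)$.
   Formalization: Assertion (vi) is included in the equivalence only for d ≥ 3: for d = 2 the range m ∈ {2,…,d−1} is empty, so (vi) holds vacuously and cannot be equivalent to (i); all other assertions are covered for every d ≥ 2. *)

(* Defs.v *)
From HB Require Import structures.
From mathcomp Require Import all_boot all_order all_algebra.
From mathcomp Require Import all_classical all_reals all_analysis.

Set Implicit Arguments.
Unset Strict Implicit.
Unset Printing Implicit Defensive.
Import Order.TTheory GRing.Theory Num.Theory.
Import numFieldNormedType.Exports.

Local Open Scope classical_set_scope.
Local Open Scope ring_scope.

(* Points of R^n are n.-tuples, whose measurable structure is the product
   (= Borel) sigma-algebra.  The unit interval and the cube I^n are the sets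
   `[0, 1] and [cube n]; functions and measures attached to I^n are total
   objects on R^n that are only used on the cube. *)

Section cube.
Context {R : realType}.

Definition cube n : set (n.-tuple R) :=
  [set t | forall i, 0 <= tnth t i <= 1].

Definition box n (y : n.-tuple R) : set (n.-tuple R) :=
  [set t | forall i, 0 <= tnth t i <= tnth y i].

Lemma measurable_box n (y : n.-tuple R) : measurable (box y).
Proof.
rewrite (_ : box y = \bigcap_(i in [set: 'I_n])
    ((fun t : n.-tuple R => tnth t i) @^-1` `[0, tnth y i])); last first.
  apply/seteqP; split=> [t ty i _ /=|t ty i]; first by rewrite in_itv/= ty.
  by have := ty i I; rewrite /= in_itv.
apply: fin_bigcap_measurable => [|i _]; first exact: finite_finset.
rewrite -[X in measurable X]setTI.
exact: (measurable_tnth i).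
Qed.

End cube.
Arguments cube {R} n.

Section lebesgue_cube.
Context {R : realType}.

(* Lebesgue measure on I, viewed as a measure on the line. *)
Definition lambda1 : set (measurableTypeR R) -> \bar R :=
  mrestr (@lebesgue_measure R) (measurable_itv `[0, 1]).

HB.instance Definition _ := Measure.on lambda1.

Let lambda1_setT : lambda1 setT = 1%E.
Proof.
by rewrite /lambda1 /mrestr setTI lebesgue_measure_itv/= lte_fin ltr01 sube0.
Qed.

HB.instance Definition _ :=
  Measure_isProbability.Build _ _ _ lambda1 lambda1_setT.

Definition cons_pair n (p : measurableTypeR R * n.-tuple R) : n.+1.-tuple R :=
  [tuple of p.1 :: p.2].

Let measurable_cons_pair n : measurable_fun setT (@cons_pair n).
Proof. exact: measurable_cons. Qed.

HB.instance Definition _ n :=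
  isMeasurableFun.Build _ _ _ _ (@cons_pair n) (@measurable_cons_pair n).

(* Lebesgue measure on I^n, as the n-fold product of [lambda1]. *)
Fixpoint lambda n : probability (n.-tuple R) R :=
  match n return probability (n.-tuple R) R with
  | 0 => \d_([tuple] : 0.-tuple R)
  | k.+1 => distribution (lambda1 \x lambda k)%E (@cons_pair k)
  end.

End lebesgue_cube.

Section copula.
Context {R : realType}.

(* A d-dimensional copula: the restriction to I^d of the distribution function
   of a random vector whose coordinates are uniform on I.  [cop_measure C] is
   the measure mu_C induced by C; it is determined by the values of C on the
   cube, and the values of [cop_fun] outside the cube are irrelevant. *)
Record copula (d : nat) := Copula {
  cop_fun :> d.-tuple R -> R ;
  cop_measure : probability (d.-tuple R) R ;
  cop_uniform : forall (i : 'I_d) (A : set R), measurable A ->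
    cop_measure [set t | A (tnth t i)] = lambda1 A ;
  cop_df : forall x, cube d x -> cop_measure (box x) = (cop_fun x)%:E }.

(* C^{ij} *)
Definition marginal2 d (C : d.-tuple R -> R) (i j : 'I_d) : 2.-tuple R -> R :=
  fun x => C [tuple if k == i then tnth x ord0
                    else if k == j then tnth x ord_max else 1 | k < d].

(* x_1, ..., x_m completed by 1, ..., 1 *)
Definition pad1 d m (x : m.-tuple R) : d.-tuple R := [tuple nth 1 x k | k < d].

Definition first_coords d m (md : (m <= d)%N) (t : d.-tuple R) : m.-tuple R :=
  [tuple tnth t (widen_ord md k) | k < m].

Let measurable_first_coords d m (md : (m <= d)%N) :
  measurable_fun setT (first_coords md).
Proof.
apply/measurable_fun_tnthP => i.
rewrite (_ : _ \o _ = fun t : d.-tuple R => tnth t (widen_ord md i)).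
  exact: measurable_tnth.
by apply/funext => t /=; rewrite tnth_mktuple.
Qed.

HB.instance Definition _ d m (md : (m <= d)%N) :=
  isMeasurableFun.Build _ _ _ _ (first_coords md) (@measurable_first_coords d m md).

Lemma cop_cube d (C : copula d) : (cop_measure C).-negligible (~` cube d).
Proof.
pose N (i : 'I_d) := (fun t : d.-tuple R => tnth t i) @^-1` (~` `[0, 1]).
have mN i : measurable (N i).
  rewrite -[N i]setTI; apply: (measurable_tnth i) => //.
  exact: measurableC.
have N0 i : cop_measure C (N i) = 0%E.
  rewrite (cop_uniform C i (A := ~` `[0, 1])); last exact: measurableC.
  by rewrite /lambda1 /mrestr setICl measure0.
pose F k := if (insub k : option 'I_d) is Some i then N i else set0.
have negF k : (cop_measure C).-negligible (F k).
  rewrite /F; case: insub => [i|]; last exact: negligible_set0.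
  by apply/negligibleP; [exact: mN|exact: N0].
apply: (negligibleS _ (negligible_bigcup negF)) => t /existsNP[i ti].
by exists (val i) => //; rewrite /F valK /N /= in_itv.
Qed.

(* C^{1:m}, for m <= d *)
Section marginal.
Context {d m : nat} (C : copula d) (md : (m <= d)%N).

Definition marginal_measure : probability (m.-tuple R) R :=
  distribution (cop_measure C) (first_coords md).

Let marginal_uniform (i : 'I_m) (A : set R) : measurable A ->
  marginal_measure [set t | A (tnth t i)] = lambda1 A.
Proof.
move=> mA; rewrite -(cop_uniform C (widen_ord md i) mA).
rewrite /marginal_measure /distribution /= /pushforward.
by congr (cop_measure C _); apply/seteqP; split=> t; rewrite /= tnth_mktuple.
Qed.

Let marginal_df x : cube m x ->
  marginal_measure (box x) = (C (pad1 d x))%:E.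
Proof.
move=> cx.
have tnth_pad1 (k : 'I_d) : tnth (pad1 d x) k = nth 1 x k.
  by rewrite tnth_mktuple.
have cpx : cube d (pad1 d x).
  move=> k; rewrite tnth_pad1; case: (ltnP k m) => km.
    by have := cx (Ordinal km); rewrite (tnth_nth 1).
  by rewrite nth_default ?size_tuple// ler01 lexx.
have [N [mN N0 cN]] := cop_cube C.
rewrite -(cop_df C cpx).
pose B := first_coords md @^-1` box x.
rewrite [LHS](_ : _ = cop_measure C B)//.
have mB : measurable B.
  rewrite -[B]setTI; apply: (measurable_funPT (first_coords md)) => //.
  exact: measurable_box.
rewrite -(measureU0 mB mN N0) -[RHS](measureU0 (measurable_box _) mN N0).
congr (cop_measure C _); apply/seteqP; split=> t [|Nt]; try by right.
- move=> Bt; case: (pselect (cube d t)) => [ct|/cN]; last by right.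
  left=> k; rewrite tnth_pad1; case: (ltnP k m) => km.
    have := Bt (Ordinal km); rewrite tnth_mktuple (tnth_nth 1 x)/=.
    by rewrite (_ : widen_ord _ _ = k)//; exact/val_inj.
  by rewrite nth_default ?size_tuple//; exact: ct.
- move=> Bt; left=> i; rewrite tnth_mktuple.
  by have := Bt (widen_ord md i); rewrite tnth_pad1 (tnth_nth 1 x).
Qed.

Definition marginal1m : copula m :=
  @Copula m (fun x => C (pad1 d x)) marginal_measure
    marginal_uniform marginal_df.

End marginal.

Local Open Scope charge_scope.

(* The density of mu_C with respect to Lebesgue measure on the cube; it is the
   constant -oo if mu_C is not absolutely continuous. *)
Definition copula_density d (C : copula d) : d.-tuple R -> \bar R :=
  'd (charge_of_finite_measure (cop_measure C)) '/d (lambda d).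

(* A version of the 1-Markov kernel of C, i.e. of the regular conditional
   distribution of (X_2, ..., X_d) given X_1 (recall that X_1 has law
   [lambda1]); for x outside I the kernel is arbitrary. *)
Definition is_markov_kernel d (C : copula d)
    (K : R.-pker (measurableTypeR R) ~> d.-1.-tuple R) : Prop :=
  (forall x, 0 <= x <= 1 -> K x (cube d.-1) = 1%E) /\
  (forall (E : set (measurableTypeR R)) (F : set (d.-1.-tuple R)),
    measurable E -> measurable F ->
    cop_measure C [set t : d.-tuple R | E (head 0 t) /\ F [tuple of behead t]] =
    (\int[lambda1]_(x in E) K x F)%E).

End copula.

Section archimedean.
Context {R : realType}.
Implicit Type psi : R -> R.

(* psi extended by psi(+oo) = 0 *)
Definition ext psi (z : \bar R) : R := if z is r%:E then psi r else 0.

(* For x in (0, 1] the set is the singleton made of the preimage of x; for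
   x = 0 its infimum may be +oo. *)
Definition pseudoinverse psi (x : R) : \bar R :=
  ereal_inf [set z | (0 <= z)%E /\ ext psi z = x].

Record is_generator psi : Prop := IsGenerator {
  gen_continuous : {within `[0, +oo[, continuous psi} ;
  gen_nonincreasing : forall x y, 0 <= x -> x <= y -> psi y <= psi x ;
  gen_unit : forall z, 0 <= z -> 0 <= psi z <= 1 ;
  gen_at0 : psi 0 = 1 ;
  gen_pinfty : psi z @[z --> +oo] --> 0 ;
  gen_decreasing : forall x y, 0 <= x -> x < y ->
    (y%:E <= pseudoinverse psi 0)%E -> psi y < psi x ;
  gen_normalized : psi 1 = 2^-1 }.

Definition archimedean d (C : copula d) psi : Prop :=
  forall x, cube d x -> C x = ext psi (\sum_(i < d) pseudoinverse psi (tnth x i))%E.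

(* D^- f *)
Definition left_derivative (f : R -> R) (z : R) : R :=
  lim ((f (z + h) - f z) / h @[h --> 0^'-]).

End archimedean.

Section metrics.
Context {R : realType}.

Definition d_infty n (A B : n.-tuple R -> R) : R :=
  sup [set `|A x - B x| | x in cube n].

Context {n : nat}.
Implicit Types K L : R.-pker (measurableTypeR R) ~> n.-tuple R.

Definition kernel_diff K L (x : R) (y : n.-tuple R) : R :=
  fine (K x (box y)) - fine (L x (box y)).

(* lambda_d is seen on pairs (x, y) with x in I and y in I^(d-1). *)
Definition D1 K L : R :=
  \int[(lambda1 \x lambda n)%E]_p `|kernel_diff K L p.1 p.2|.

Definition D2 K L : R :=
  Num.sqrt (\int[(lambda1 \x lambda n)%E]_p (kernel_diff K L p.1 p.2) ^+ 2).

Definition D_infty K L : R :=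
  sup [set \int[lambda1]_x `|kernel_diff K L x y| | y in cube n].

(* Weak convergence of probability measures on I^n: test functions are the
   continuous functions on the compact cube, for the topology of R^n carried
   by row vectors. *)
Definition weak_cvg (mu_ : nat -> {measure set (n.-tuple R) -> \bar R})
    (mu : {measure set (n.-tuple R) -> \bar R}) : Prop :=
  forall f : 'rV[R]_n -> R,
    {within [set v : 'rV[R]_n | forall i, 0 <= v 0 i <= 1], continuous f} ->
    \int[mu_ k]_(y in cube n) f (\row_i tnth y i) @[k --> \oo]
      --> \int[mu]_(y in cube n) f (\row_i tnth y i).

Definition cvg_weakly_conditional
    (K_ : nat -> R.-pker (measurableTypeR R) ~> n.-tuple R) K : Prop :=
  exists Lambda : set (measurableTypeR R),
    [/\ measurable Lambda, Lambda `<=` `[0, 1], lambda1 Lambda = 1%E &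
        forall x, Lambda x -> weak_cvg (fun k => K_ k x) (K x)].

End metrics.

(* Main.v *)
Require Import Defs.
From HB Require Import structures.
From mathcomp Require Import all_boot all_order all_algebra.
From mathcomp Require Import all_classical all_reals all_analysis.
From mathcomp Require Import measurable_realfun random_variable real_interval ring lra.

Set Implicit Arguments.
Unset Strict Implicit.
Unset Printing Implicit Defensive.
Import Order.TTheory GRing.Theory Num.Theory.
Import numFieldNormedType.Exports.

Local Open Scope classical_set_scope.
Local Open Scope ring_scope.

(** An Archimedean copula is governed by one function of one variable, and each
    of the modes of convergence is translated into convergence of the real
    pseudoinverses [phir (psi_ n)] on (0, 1], the notion that sits in the middle
    of the proof.

    Generators.  The mass of a box with sides ]psi (u i + h i), psi (u i)] is an
    alternating difference of psi, so that a generator of a d-dimensional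
    copula is d-monotone ([archimedean_kmono]); in particular its iterated left
    derivatives [mder m psi] are convex and monotone.  A bivariate marginal is
    psi (u + v) in the coordinates psi u and psi v.  Since all generators take
    the value 1/2 at 1, its convergence propagates convergence of psi_n from 1
    to 1/2, 1/4, and so on, and from there to sums: psi_n converges on a dense
    set ([bivariate_dense]), hence phi_n converges ([dense_phir]), hence psi_n
    converges uniformly ([phir_cvg_uniform]) and C_n pointwise.  Copulas are
    Lipschitz, which upgrades pointwise to uniform convergence.  Derivatives
    of convex functions converge, even along moving arguments, at continuity
    points of the limit ([cvg_ld], [cvg_mder]); conversely psi_n is recovered
    from its left derivative by integration from 1 ([cvg_of_ld]).

    Densities.  One identity replaces differentiability of psi at the top order:
    with q = - phi', the function t |-> - g' (s + phi t) q t has integral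
    g (s + phi x) over ]0, x[ ([kernel_integral]).  Iterated, it identifies the
    density of the m-dimensional marginal as the m-th derivative of psi at the
    sum of the phi (t i), times the product of the q (t i) ([dens_box],
    [copula_density_ae]).  The densities converge where that sum is a continuity
    point, which is almost everywhere ([densities_of_phir]); conversely, by
    Scheffe, convergence of the densities gives convergence of the bivariate
    marginal ([bivariate_of_densities]).

    Kernels.  The same identity computes K (x, [0, y]) for almost all x as the
    ratio psi' (phi x + sum phi (y i)) / psi' (phi x) ([markov_kernel_ae]), which
    gives convergence of the kernels at almost every x for each y
    ([kernel_box_cvg_ae]).  The function [kdist], the mean over x of the distance
    between two kernels at [0, y], is Lipschitz in y because a strip
    a < y i <= b has mean mass at most b - a; therefore its convergence to 0 is
    the same pointwise, uniformly (D_infty) and in mean (D_1), while D_1 and D_2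
    are equivalent for functions bounded by 1.  For weak conditional convergence
    the boxes with corners on countably many grids suffice, because indicators
    of grid cells are combinations of indicators of boxes
    ([weak_cvg_of_grid_boxes]); conversely the indicator of a box is squeezed
    between continuous ramps ([ramp]) and integrated in x
    ([copula_of_weakly_conditional]). *)

(** * Finite differences and convexity *)

Section monotone_differences.
Context {R : realType}.
Implicit Types (f g : R -> R) (hs : seq R) (z u v w : R).

Fixpoint alt_diff hs f z : R :=
  if hs is h :: hs' then alt_diff hs' f z - alt_diff hs' f (z + h) else f z.

(** Monotonicity of order k is expressed by finite differences with arbitrary
    nonnegative steps, since this is what the positivity of a measure on boxes
    provides; the differentiability that is usually part of the notion is
    derived from it. *)
Definition kmono k f := forall hs z, (size hs <= k)%N ->
  all (fun h => 0 <= h) hs -> 0 < z -> 0 <= alt_diff hs f z.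

Lemma kmonoW k l f : (l <= k)%N -> kmono k f -> kmono l f.
Proof. by move=> lk kf hs z hl; apply: kf; exact: leq_trans lk. Qed.

Lemma kmono_ge0 k f z : kmono k f -> 0 < z -> 0 <= f z.
Proof. by move=> kf; exact: (kf [::]). Qed.

Lemma kmono_nincr k f u v : (0 < k)%N -> kmono k f -> 0 < u -> u <= v -> f v <= f u.
Proof.
move=> k0 kf u0 uv; have := kf [:: v - u] u.
by rewrite /= andbT !subr_ge0 (addrC u) subrK; apply.
Qed.

(** Convexity on the open half-line, as an inequality between slopes with the
    denominators cleared. *)
Definition cvx f := forall u v w, 0 < u -> u < v -> v < w ->
  (f v - f w) * (v - u) <= (f u - f v) * (w - v).

(** Second differences with equal steps compare f only at points that divide
    the interval rationally; monotonicity bridges the gaps. With G the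
    decrease of f on [v, v + h], the decrease on a left interval made of p
    steps is at least p G and the one on a right interval made of r steps at
    most r G; p and r are chosen so that p h and r h are within h of the
    lengths of the two intervals, and h tends to 0. *)
Lemma kmono_cvx k f : (1 < k)%N -> kmono k f -> cvx f.
Proof.
move=> k1 kf u v w u0 uv vw.
have fn a b : 0 < a -> a <= b -> f b <= f a.
  by apply: (kmono_nincr _ kf); exact: ltnW.
have v0 : 0 < v by exact: lt_trans uv.
have fd h a b : 0 <= h -> 0 < a -> a <= b -> f b - f (b + h) <= f a - f (a + h).
  move=> h0 a0 ab; have := kf [:: b - a; h] a k1.
  by rewrite /= h0 subr_ge0 ab => /(_ isT a0); rewrite (addrC a (b - a)) subrK subr_ge0.
have down p h : 0 <= h -> 0 < v - p%:R * h ->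
    f v + p%:R * (f v - f (v + h)) <= f (v - p%:R * h).
  move=> h0; elim: p => [|p IH]; first by rewrite !mul0r addr0 subr0.
  rewrite -natr1 mulrDl mul1r opprD addrA => p0.
  have q0 : 0 < v - p%:R * h by apply: lt_le_trans p0 _; rewrite gerBl.
  have := fd h (v - p%:R * h - h) v h0 p0.
  rewrite subrK => /(_ _)/wrap[|H]; last by have := IH q0; lra.
  by rewrite -addrA gerDl -opprD oppr_le0 addr_ge0// mulr_ge0.
have up r h : 0 <= h ->
    f v - r%:R * (f v - f (v + h)) <= f (v + r%:R * h).
  move=> h0; elim: r => [|r IH]; first by rewrite !mul0r addr0 subr0.
  rewrite -natr1 !mulrDl !mul1r (addrA v).
  have := fd h v (v + r%:R * h) h0 v0.
  by rewrite lerDl mulr_ge0// => /(_ isT); lra.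
have H h : 0 < h -> (f v - f w) * ((v - u) - h) <= (f u - f v) * ((w - v) + h).
  move=> h0; pose p := Num.truncn ((v - u) / h).
  pose r := (Num.truncn ((w - v) / h)).+1.
  have /andP[p1 p2] : (p%:R <= (v - u) / h < p.+1%:R).
    by apply: truncn_itv; rewrite divr_ge0 ?subr_ge0// ltW.
  have /andP[r1 r2] : (r.-1%:R <= (w - v) / h < r%:R).
    by apply: truncn_itv; rewrite divr_ge0 ?subr_ge0// ltW.
  move: p1 p2 r1 r2; rewrite ler_pdivlMr// ltr_pdivrMr// ler_pdivlMr// ltr_pdivrMr//.
  move=> p1 p2 r1 r2.
  have E1 := down p h (ltW h0) ltac:(lra).
  have E2 := up r h (ltW h0).
  have E3 := fn u (v - p%:R * h) u0 ltac:(lra).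
  have E4 := fn w (v + r%:R * h) ltac:(lra) ltac:(lra).
  have E5 := fn v (v + h) v0 ltac:(lra).
  have E6 := fn v w v0 (ltW vw).
  have E7 := fn u v u0 (ltW uv).
  have rS : r%:R = r.-1%:R + 1 :> R by rewrite /r -natr1.
  have pS : p.+1%:R = p%:R + 1 :> R by rewrite -natr1.
  set G := f v - f (v + h) in E1 E2.
  have G0 : 0 <= G by rewrite subr_ge0.
  have A1 : p%:R * G <= f u - f v by lra.
  have A2 : f v - f w <= r%:R * G by lra.
  have B1 : (v - u - h) <= p%:R * h by move: p2; rewrite pS mulrDl mul1r; lra.
  have B2 : r%:R * h <= w - v + h by rewrite rS mulrDl mul1r; lra.
  have p0 : 0 <= p%:R :> R by [].
  have r0 : 0 <= r%:R :> R by [].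
  have C1 : (f v - f w) * (v - u - h) <= (f v - f w) * (p%:R * h).
    by rewrite ler_wpM2l// subr_ge0.
  have C2 : (f v - f w) * (p%:R * h) <= (r%:R * G) * (p%:R * h).
    by rewrite ler_wpM2r// mulr_ge0// ltW.
  have C3 : (p%:R * G) * (r%:R * h) <= (f u - f v) * (r%:R * h).
    by rewrite ler_wpM2r// mulr_ge0// ltW.
  have C4 : (f u - f v) * (r%:R * h) <= (f u - f v) * (w - v + h).
    by rewrite ler_wpM2l// subr_ge0.
  apply: le_trans C1 _; apply: le_trans C2 _; apply: le_trans C4.
  by apply: le_trans C3; rewrite le_eqVlt; apply/orP; left; apply/eqP; ring.
have D0 : 0 <= f u - f w by rewrite subr_ge0; apply: fn => //; apply: ltW; exact: lt_trans vw.
apply/ler_addgt0Pr => e e0.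
have D1 : 0 < f u - f w + 1 by lra.
have := H _ (divr_gt0 e0 D1).
set h := e / _; have h0 : 0 < h by exact: divr_gt0.
have : (f u - f w) * h <= e.
  rewrite /h mulrA ler_pdivrMr// (mulrC e); apply: ler_wpM2r; [exact: ltW|lra].
by nra.
Qed.

End monotone_differences.

(** * Left derivatives of convex functions *)

Section left_derivative.
Context {R : realType}.
Implicit Types (f g : R -> R) (hs : seq R) (z u v w : R).

Local Notation ld := left_derivative.

Let sl f z h := (f (z + h) - f z) / h.

Let sl_nd f z h (k : R) : cvx f -> 0 < z + h -> h < k -> k < 0 -> sl f z h <= sl f z k.
Proof.
move=> cf zh hk k0; have := @cf (z + h) (z + k) z zh.
rewrite ltrD2l hk => /(_ isT); rewrite -ltrBrDl subrr k0 => /(_ isT).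
move=> H; rewrite /sl ler_ndivrMr//; last by lra.
rewrite mulrAC ler_ndivrMr//; lra.
Qed.

Let sl_le f z h w : cvx f -> 0 < z + h -> h < 0 -> z < w ->
  sl f z h <= (f w - f z) / (w - z).
Proof.
move=> cf zh h0 zw; have := @cf (z + h) z w zh _ zw.
rewrite gtrDl => /(_ h0) H.
rewrite /sl ler_ndivrMr// mulrAC ler_pdivrMr ?subr_gt0//; lra.
Qed.

(** The slopes from z to z + h increase with h < 0 and are bounded by a slope
    to the right of z, so the limit defining the left derivative exists. *)
Lemma cvx_ld_cvg f z : cvx f -> 0 < z -> sl f z h @[h --> 0^'-] --> ld f z.
Proof.
move=> cf z0; apply: nondecreasing_at_left_is_cvgr.
- near=> x => a b; rewrite !in_itv/= => /andP[xa a0] /andP[xb b0].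
  rewrite le_eqVlt => /predU1P[->//|ab]; apply: sl_nd => //.
  rewrite -ltrBlDl sub0r (lt_trans _ xa)//; near: x.
  by apply: nbhs_left_gt; rewrite ltrNl oppr0.
- near=> x; exists ((f (z + 1) - f z) / (z + 1 - z)) => _ /= [a + <-].
  rewrite in_itv/= => /andP[xa a0]; apply: sl_le => //; last by rewrite ltrDl.
  rewrite -ltrBlDl sub0r (lt_trans _ xa)//; near: x.
  by apply: nbhs_left_gt; rewrite ltrNl oppr0.
Unshelve. all: by end_near. Qed.

Lemma cvx_ld_le f u v : cvx f -> 0 < u -> u < v -> ld f u * (v - u) <= f v - f u.
Proof.
move=> cf u0 uv; rewrite -ler_pdivlMr ?subr_gt0//.
apply: limr_le; first by apply/cvg_ex; exists (ld f u); exact: cvx_ld_cvg.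
near=> h; apply: sl_le => //.
rewrite -ltrBlDl sub0r; near: h.
by apply: nbhs_left_gt; rewrite ltrNl oppr0.
Unshelve. all: by end_near. Qed.

Lemma cvx_ld_ge f u v : cvx f -> 0 < u -> u < v -> f v - f u <= ld f v * (v - u).
Proof.
move=> cf u0 uv; rewrite -ler_pdivrMr ?subr_gt0//.
apply: limr_ge; first by apply/cvg_ex; exists (ld f v); apply: cvx_ld_cvg => //; exact: lt_trans uv.
have -> : (f v - f u) / (v - u) = sl f v (u - v).
  by rewrite /sl addrCA subrr addr0 -(opprB v u) invrN mulrN -mulNr opprB.
near=> h; apply: sl_nd => //.
- by rewrite addrCA subrr addr0.
- by near: h; apply: nbhs_left_gt; rewrite subr_lt0.
Unshelve. all: by end_near. Qed.

Lemma cvx_ld_nd f u v : cvx f -> 0 < u -> u <= v -> ld f u <= ld f v.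
Proof.
move=> cf u0; rewrite le_eqVlt => /predU1P[->//|uv].
have H := le_trans (cvx_ld_le cf u0 uv) (cvx_ld_ge cf u0 uv).
by move: H; rewrite ler_pM2r// subr_gt0.
Qed.

Lemma cvx_continuous f z : cvx f -> 0 < z -> {for z, continuous f}.
Proof.
move=> cf z0; apply/cvgrPdist_le => e e0.
pose M := `|ld f (z / 2)| + `|ld f (z + 1)| + 1.
have M0 : 0 < M by rewrite ltr_wpDl// addr_ge0.
have ML : `|ld f (z / 2)| <= M by rewrite /M -addrA lerDl addr_ge0.
have MR : `|ld f (z + 1)| <= M by rewrite /M addrAC lerDr addr_ge0.
have key u v : z / 2 <= u -> u < v -> v <= z + 1 -> `|f v - f u| <= M * (v - u).
  move=> zu uv vz; have u0 : 0 < u by apply: lt_le_trans zu; rewrite divr_gt0.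
  have v0 := lt_trans u0 uv.
  have uv0 : 0 <= v - u by rewrite subr_ge0 ltW.
  rewrite ler_norml; apply/andP; split.
    rewrite lerNl; apply: (@le_trans _ _ (- ld f u * (v - u))).
      by rewrite mulNr lerN2; exact: cvx_ld_le.
    apply: ler_wpM2r => //.
    apply: le_trans ML; apply: le_trans (_ : - ld f (z / 2) <= _).
      by rewrite lerN2; apply: cvx_ld_nd => //; rewrite divr_gt0.
    by rewrite -normrN ler_norm.
  apply: le_trans (cvx_ld_ge cf u0 uv) _; apply: ler_wpM2r => //.
  apply: le_trans MR; apply: le_trans (ler_norm _).
  exact: cvx_ld_nd.
near=> t.
have tz : `|z - t| <= e / M by near: t; apply: cvgr_dist_le => //; exact: divr_gt0.
have t1 : z / 2 < t by near: t; apply: lt_nbhsr; rewrite ltr_pdivrMr// ltr_pMr// ltr1n.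
have t2 : t < z + 1 by near: t; apply: lt_nbhsl; rewrite ltrDl.
apply: le_trans (_ : M * `|z - t| <= _); last by rewrite mulrC -ler_pdivlMr.
have [tz'|zt|->] := ltgtP t z; last by rewrite !subrr !normr0 mulr0.
  rewrite (gtr0_norm (x := z - t)) ?subr_gt0//; apply: key => //; first exact: ltW.
  by rewrite lerDl.
rewrite distrC (ltr0_norm (x := z - t)) ?subr_lt0// opprB; apply: key => //; last exact: ltW.
by rewrite ler_pdivrMr// ler_pMr// ler1n.
Unshelve. all: by end_near. Qed.

(** The secant slopes at z are trapped between left derivatives at the two end
    points of the secant. *)
Lemma cvx_derive f z : cvx f -> 0 < z -> {for z, continuous (ld f)} ->
  is_derive z 1 f (ld f z).
Proof.
move=> cf z0 cld.
suff H : h^-1 *: (f (h *: 1 + z) - f z) @[h --> 0^'] --> ld f z.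
  by split; [apply/cvg_ex; exists (ld f z)|exact/cvg_lim].
apply/cvgrPdist_le => e e0.
have /cvgrPdist_le/(_ e e0)[d /= d0 dP] := cld.
near=> h.
have h0 : h != 0 by near: h; exact: nbhs_dnbhs_neq.
have hd : `|h| < d by near: h; apply: dnbhs0_lt.
have hz : `|h| < z by near: h; apply: dnbhs0_lt.
rewrite /GRing.scale/= mulr1 (addrC h z) mulrC.
have zh0 : 0 < z + h by move: hz; rewrite ltr_norml; lra.
have D : `|ld f z - ld f (z + h)| <= e.
  by apply: dP; rewrite /= opprD addrA subrr add0r normrN.
have D2 : `|ld f z - (f (z + h) - f z) / h| <= `|ld f z - ld f (z + h)|.
  case/orP: (lt_total h0) => hs.
    have A := cvx_ld_ge cf zh0 (_ : z + h < z).
    have B := cvx_ld_le cf zh0 (_ : z + h < z).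
    have zz : z + h < z by rewrite gtrDl.
    move: (A zz) (B zz); rewrite opprD addrA subrr add0r => A1 B1.
    have C1 : (f (z + h) - f z) / h <= ld f z by rewrite ler_ndivrMr//; lra.
    have C2 : ld f (z + h) <= (f (z + h) - f z) / h by rewrite ler_ndivlMr//; lra.
    rewrite !ger0_norm; lra.
  have zz : z < z + h by rewrite ltrDl.
  have := cvx_ld_ge cf z0 zz; have := cvx_ld_le cf z0 zz.
  rewrite addrAC subrr add0r => A1 B1.
  have C1 : ld f z <= (f (z + h) - f z) / h by rewrite ler_pdivlMr//.
  have C2 : (f (z + h) - f z) / h <= ld f (z + h) by rewrite ler_pdivrMr//.
  rewrite !ler0_norm; lra.
exact: le_trans D.
Unshelve. all: by end_near. Qed.

Lemma alt_diff_cvg (T : Type) (F : set_system T) {FF : ProperFilter F} (f_ : T -> R -> R) f hs z :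
  all (fun h => 0 <= h) hs -> 0 < z ->
  (forall t, 0 < t -> f_ x t @[x --> F] --> f t) ->
  alt_diff hs (f_ x) z @[x --> F] --> alt_diff hs f z.
Proof.
move=> + + ff; elim: hs z => [|h hs IH] z /=; first by move=> _; exact: ff.
move=> /andP[h0 hs0] z0; apply: cvgB; apply: IH => //.
by rewrite ltr_wpDr.
Qed.

Lemma alt_diff_scale f hs a h z :
  alt_diff hs (fun t => a * (f (t + h) - f t)) z = a * (alt_diff hs f (z + h) - alt_diff hs f z).
Proof.
elim: hs z => [//|k hs IH] z /=; rewrite !IH.
by rewrite (addrAC z k h); lra.
Qed.

(** A difference of order k of the slope with step h < 0 is, up to the factor
    - 1 / h, a difference of order k + 1 of f with the additional step - h;
    the sign survives in the limit. *)
Lemma kmono_ld k f : (0 < k)%N -> kmono k.+1 f -> kmono k (fun z => - ld f z).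
Proof.
move=> k0 kf hs z hsk hs0 z0.
have cf : cvx f by exact: (kmono_cvx _ kf).
have H : alt_diff hs (fun t => - sl f t h) z @[h --> 0^'-] --> alt_diff hs (fun t => - ld f t) z.
  apply: alt_diff_cvg => // t t0; apply: cvgN; exact: cvx_ld_cvg.
rewrite -(cvg_lim _ H)//; apply: limr_ge; first by apply/cvg_ex; eexists; exact: H.
near=> h.
have h0 : h < 0 by near: h; exact: nbhs_left_lt.
rewrite [X in alt_diff _ X _](_ : _ = fun t => (- h^-1) * (f (t + h) - f t)); last first.
  by apply/funext => t; rewrite /sl mulrC mulNr.
rewrite alt_diff_scale mulr_ge0 ?oppr_ge0 ?invr_le0 ?(ltW h0)//.
have := kf (- h :: hs) (z + h); rewrite /= addrK; apply => //.
  by rewrite oppr_ge0 (ltW h0).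
rewrite -ltrBlDl sub0r; near: h.
by apply: nbhs_left_gt; rewrite ltrNl oppr0.
Unshelve. all: by end_near. Qed.

(** Convergence along moving arguments. The tangent inequalities put the left
    derivative of f_n at z_n between secant slopes of f_n over intervals of a
    fixed length r next to z; these converge to the secant slopes of f, which
    are close to the left derivative at z because it is continuous there. *)
Lemma cvg_ld (f_ : nat -> R -> R) f (z_ : nat -> R) z :
  (forall n, cvx (f_ n)) -> cvx f -> (forall t, 0 < t -> f_ n t @[n --> \oo] --> f t) ->
  0 < z -> z_ n @[n --> \oo] --> z -> {for z, continuous (ld f)} ->
  ld (f_ n) (z_ n) @[n --> \oo] --> ld f z.
Proof.
move=> cf_ cf ff z0 zz cld; apply/cvgrPdist_le => e e0.
have e20 : 0 < e / 2 by rewrite divr_gt0.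
have /cvgrPdist_le/(_ _ e20)[d /= d0 dP] := cld.
(* The intervals of length r used below stay in the half-line and at distance
   less than d from z. *)
pose r := Num.min (d / 3) (z / 3).
have r0 : 0 < r by rewrite lt_min !divr_gt0.
have rd : r <= d / 3 by rewrite ge_min lexx.
have rz : r <= z / 3 by rewrite ge_min lexx orbT.
have H t : `|z - t| < d -> `|ld f z - ld f t| <= e / 2 by exact: dP.
have er0 : 0 < e / 2 * r by rewrite mulr_gt0.
have D1 : (f_ n (z + r + r) - f_ n (z + r)) @[n --> \oo] --> f (z + r + r) - f (z + r).
  by apply: cvgB; apply: ff; lra.
have D2 : (f_ n (z - r) - f_ n (z - r - r)) @[n --> \oo] --> f (z - r) - f (z - r - r).
  by apply: cvgB; apply: ff; lra.
near=> n.
have zn1 : z_ n < z + r by near: n; apply: (cvgr_lt z zz); rewrite ltrDl.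
have zn2 : z - r < z_ n by near: n; apply: (cvgr_gt z zz); rewrite ltrBlDr ltrDl.
have B1 : `|f (z + r + r) - f (z + r) - (f_ n (z + r + r) - f_ n (z + r))| <= e / 2 * r.
  by near: n; apply: cvgr_dist_le.
have B2 : `|f (z - r) - f (z - r - r) - (f_ n (z - r) - f_ n (z - r - r))| <= e / 2 * r.
  by near: n; apply: cvgr_dist_le.
have znr : 0 < z_ n by lra.
have U1 := @cvx_ld_nd _ (z_ n) (z + r) (cf_ n) znr (ltW zn1).
have U2 := @cvx_ld_le _ (z + r) (z + r + r) (cf_ n) ltac:(lra) ltac:(lra).
have U3 := @cvx_ld_ge _ (z + r) (z + r + r) cf ltac:(lra) ltac:(lra).
have L1 := @cvx_ld_nd _ (z - r) (z_ n) (cf_ n) ltac:(lra) (ltW zn2).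
have L2 := @cvx_ld_ge _ (z - r - r) (z - r) (cf_ n) ltac:(lra) ltac:(lra).
have L3 := @cvx_ld_le _ (z - r - r) (z - r) cf ltac:(lra) ltac:(lra).
have K1 := H (z + r + r) ltac:(rewrite ltr_norml; apply/andP; split; lra).
have K2 := H (z - r - r) ltac:(rewrite ltr_norml; apply/andP; split; lra).
move: B1 B2 K1 K2; rewrite !ler_norml => /andP[B1 B1'] /andP[B2 B2'] /andP[K1 K1'] /andP[K2 K2'].
have E1 : z + r + r - (z + r) = r by ring.
have E2 : z - r - (z - r - r) = r by ring.
rewrite E1 in U2 U3; rewrite E2 in L2 L3.
have V1 : ld (f_ n) (z + r) <= ld f (z + r + r) + e / 2.
  by rewrite -(ler_pM2r r0) mulrDl; lra.
have V2 : ld f (z - r - r) - e / 2 <= ld (f_ n) (z - r).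
  by rewrite -(ler_pM2r r0) mulrBl; lra.
by apply/andP; split; lra.
Unshelve. all: by end_near. Qed.

End left_derivative.

(** * Generators of Archimedean copulas *)

Section generator.
Context {R : realType}.
Variable psi : R -> R.
Hypothesis gen : is_generator psi.
Implicit Types u v x z : R.

(** The pseudoinverse is finite on (0, 1], where it is a true inverse of psi,
    so nothing is lost in passing to real values; at 0 it may be infinite. *)
Definition phir x : R := fine (pseudoinverse psi x).

Lemma gen_ge0 z : 0 <= z -> 0 <= psi z.
Proof. by move=> /(gen_unit gen)/andP[]. Qed.

Lemma gen_le1 z : 0 <= z -> psi z <= 1.
Proof. by move=> /(gen_unit gen)/andP[]. Qed.

(** If psi v = 0 there is nothing to compare, and otherwise v lies before the
    first zero of psi. *)
Lemma gen_lt u v : 0 <= u -> u < v -> 0 < psi u -> psi v < psi u.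
Proof.
move=> u0 uv pu; have v0 : 0 <= v by rewrite (le_trans u0)// ltW.
have := gen_ge0 v0; rewrite le_eqVlt => /predU1P[<-//|pv].
apply: (gen_decreasing gen) => //.
apply: le_ereal_inf_tmp => -[r|_|[//]]; last exact: leey.
rewrite /= lee_fin => -[r0 pr]; rewrite lee_fin leNgt; apply/negP => rv.
by move: pv; rewrite ltNge -pr (gen_nonincreasing gen)// ltW.
Qed.

Lemma gen_pinvE z : 0 <= z -> 0 < psi z -> pseudoinverse psi (psi z) = z%:E.
Proof.
move=> z0 pz; rewrite /pseudoinverse [X in ereal_inf X](_ : _ = [set z%:E]) ?ereal_inf1//.
apply/seteqP; split => [[r [/= r0 pr]|[_ /= p0]|[]//]|_ ->] /=; last by rewrite lee_fin.
  congr (_%:E); rewrite lee_fin in r0; have [rz|zr|//] := ltgtP r z.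
    have := gen_lt r0 rz; rewrite pr => /(_ pz); by rewrite ltxx.
  by have := gen_lt z0 zr pz; rewrite pr ltxx.
by move: pz; rewrite -p0 ltxx.
Qed.

Lemma phirK z : 0 <= z -> 0 < psi z -> phir (psi z) = z.
Proof. by move=> z0 pz; rewrite /phir gen_pinvE. Qed.

Lemma gen_surj x : 0 < x <= 1 -> exists2 z, 0 <= z & psi z = x.
Proof.
move=> /andP[x0 x1].
have [M [_ MP]] : \forall z \near +oo, psi z < x by exact: (cvgr_lt _ (gen_pinfty gen)).
pose N := Num.max 0 M + 1.
have N0 : 0 <= N by rewrite addr_ge0// le_max lexx.
have pN : psi N < x by apply: MP; rewrite /N ltr_pwDr// le_max lexx orbT.
have cN : {within `[0, N], continuous psi}.
  by apply: continuous_subspaceW (gen_continuous gen) => t /=; rewrite !in_itv/= andbT => /andP[].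
have [|c] := @IVT _ psi 0 N x N0 cN.
  by rewrite (gen_at0 gen) min_r ?max_l ?(ltW pN)//= ?(le_trans (ltW pN)).
by rewrite in_itv/= => /andP[c0 _] <-; exists c.
Qed.

Lemma phir_ge0 x : 0 < x <= 1 -> 0 <= phir x.
Proof. by move=> x01; have [z z0 zx] := gen_surj x01; rewrite -zx phirK// zx; case/andP: x01. Qed.

Lemma psi_phir x : 0 < x <= 1 -> psi (phir x) = x.
Proof. by move=> x01; have [z z0 zx] := gen_surj x01; rewrite -{1}zx phirK// zx; case/andP: x01. Qed.

Lemma pinv_phir x : 0 < x <= 1 -> pseudoinverse psi x = (phir x)%:E.
Proof. by move=> x01; rewrite /phir; have [z z0 zx] := gen_surj x01; rewrite -zx gen_pinvE// zx; case/andP: x01. Qed.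

Lemma phir1 : phir 1 = 0.
Proof. by rewrite -(gen_at0 gen) phirK// (gen_at0 gen). Qed.

Lemma phir_lt x z : 0 < x <= 1 -> 0 <= z -> (phir x < z) = (psi z < x).
Proof.
move=> x01 z0; have x0 : 0 < x by case/andP: x01.
apply/idP/idP => [H|]; first by rewrite -[ltRHS](psi_phir x01) gen_lt ?phir_ge0// psi_phir.
rewrite !ltNge; apply: contra => H.
by rewrite -[leLHS](psi_phir x01) (gen_nonincreasing gen).
Qed.

Lemma lt_phir x z : 0 < x <= 1 -> 0 <= z -> (z < phir x) = (x < psi z).
Proof.
move=> x01 z0; have x0 : 0 < x by case/andP: x01.
apply/idP/idP => [H|].
  rewrite -[ltLHS](psi_phir x01) gen_lt//.
  by rewrite (lt_le_trans x0)// -[leLHS](psi_phir x01) (gen_nonincreasing gen)// ltW.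
rewrite !ltNge; apply: contra => H.
by rewrite -[leRHS](psi_phir x01) (gen_nonincreasing gen)// phir_ge0.
Qed.

Lemma phir_gt0 x : 0 < x < 1 -> 0 < phir x.
Proof. by move=> /andP[x0 x1]; rewrite lt_phir// ?x0 ?ltW// (gen_at0 gen). Qed.

Lemma phir_mono x y : 0 < x -> x < y -> y <= 1 -> phir y < phir x.
Proof.
move=> x0 xy y1; have y0 := lt_trans x0 xy.
have x1 : x <= 1 by rewrite (le_trans _ y1)// ltW.
by rewrite phir_lt ?y0 ?phir_ge0 ?x0// psi_phir// x0.
Qed.

End generator.

Section archimedean_copula.
Context {R : realType} (d : nat) (C : @copula R d) (psi : R -> R).

Lemma measure_box_ge (x : d.-tuple R) (i : 'I_d) (a : R) : 0 <= a <= 1 ->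
  (forall k, k = i -> tnth x k <= a) -> (cop_measure C (box x) <= a%:E)%E.
Proof.
move=> /andP[a0 a1] xa.
apply: (@le_trans _ _ (cop_measure C [set t | `[0, a]%classic (tnth t i)])).
  apply: le_measure; rewrite ?inE.
  - exact: measurable_box.
  - by rewrite -[X in measurable X]setTI; exact: (measurable_tnth i).
  - move=> t /(_ i)/andP[t0 tx]; rewrite /= in_itv/= t0 /=.
    exact: le_trans (xa _ erefl).
rewrite cop_uniform//= /lambda1/= /mrestr setIidl.
  by rewrite lebesgue_measure_itv/= lte_fin; case: ifP => //; rewrite sube0.
by move=> t /=; rewrite !in_itv/= => /andP[-> /le_trans]; apply.
Qed.

Hypotheses (gen : is_generator psi) (arch : archimedean C psi).

(** If some psi (u i) vanishes, the pseudoinverse does not give back u i; in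
    this case both sides are 0, the left one because it is the mass of a box
    with an empty side. *)
Lemma archE (u : nat -> R) : (forall i, (i < d)%N -> 0 <= u i) ->
  C [tuple psi (u i) | i < d] = psi (\sum_(i < d) u i).
Proof.
move=> u0; have ui0 (i : 'I_d) : 0 <= u i by exact: u0.
have cb : cube d [tuple psi (u i) | i < d].
  by move=> i; rewrite tnth_mktuple; exact: (gen_unit gen).
have [/existsP[i /eqP pi0]|/existsPn pn] := boolP [exists i : 'I_d, psi (u i) == 0].
  transitivity (0 : R).
    apply/eqP; rewrite -eqe -(cop_df C cb) eq_le measure_ge0 andbT.
    apply: (@measure_box_ge _ i); first by rewrite lexx ler01.
    by move=> k ->; rewrite tnth_mktuple pi0.
  have ui : u i <= \sum_(j < d) u j by rewrite (bigD1 i)//= lerDl; apply: sumr_ge0 => k _.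
  have su : 0 <= \sum_(j < d) u j by apply: sumr_ge0.
  by apply/eqP; rewrite eq_le -[X in _ && (_ <= X)]pi0 (gen_nonincreasing gen)// gen_ge0.
rewrite arch// (eq_bigr (fun i : 'I_d => (u i)%:E)) ?sumEFin// => i _.
rewrite tnth_mktuple gen_pinvE// lt_neqAle eq_sym pn/=.
exact: gen_ge0.
Qed.

Section volumes.
Variable h : nat -> R.
Hypothesis h0 : forall i, 0 <= h i.

(** The box with sides ]psi (u i + h i), psi (u i)] for i < k and [0, psi (u
    i)] for the other i: increasing k by one cuts off a box of the same kind,
    which is one step of the recursion of alternating differences. *)
Let S k (u : nat -> R) : set (d.-tuple R) := [set t | forall i : 'I_d,
   0 <= tnth t i <= psi (u i) /\ ((i < k)%N -> psi (u i + h i) < tnth t i)].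

Let upd (u : nat -> R) k i := if i == k then u i + h i else u i.

Let SS k u : (k < d)%N -> (forall i, (i < d)%N -> 0 <= u i) ->
  S k.+1 u = S k u `\` S k (upd u k).
Proof.
move=> kd u0; apply/seteqP; split => [t St|t [St nS] i].
  split; first by move=> i; have [? H] := St i; split => // ik; apply: H; exact: ltnW.
  move=> /(_ (Ordinal kd))[/= + _]; rewrite /upd eqxx => /andP[_].
  by have [_ /(_ (ltnSn _))/=] := St (Ordinal kd); rewrite ltNge => /negP.
have [H1 H2] := St i; split => //; rewrite ltnS leq_eqVlt => /predU1P[ik|//].
rewrite ltNge; apply/negP => ti; apply: nS => j; have [J1 J2] := St j.
rewrite /upd; case: ifPn => [/eqP jk|jk]; split => //.
- have ij : j = i by apply: val_inj; rewrite /= jk ik.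
  by rewrite ij; case/andP: H1 => ->.
- by rewrite jk ltnn.
Qed.

Let Ssub k u : (k < d)%N -> (forall i, (i < d)%N -> 0 <= u i) -> S k (upd u k) `<=` S k u.
Proof.
move=> kd u0 t St i; have [/andP[T0 T1] T2] := St i.
split.
  rewrite T0/=; apply: le_trans T1 _; rewrite /upd; case: ifP => // _.
  by rewrite (gen_nonincreasing gen) ?u0// lerDl.
by move=> ik; have := T2 ik; rewrite /upd (ltn_eqF ik).
Qed.

Let S_measure k u : (k <= d)%N -> (forall i, (i < d)%N -> 0 <= u i) ->
  measurable (S k u) /\
  cop_measure C (S k u) = (alt_diff (rev (mkseq h k)) psi (\sum_(i < d) u i))%:E.
Proof.
elim: k u => [|k IH] u kd u0.
  have -> : S 0%N u = box [tuple psi (u i) | i < d].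
    apply/seteqP; split => t H i; first by rewrite tnth_mktuple; case: (H i).
    by have := H i; rewrite tnth_mktuple.
  split; first exact: measurable_box.
  rewrite cop_df/= ?archE//.
  by move=> i; rewrite tnth_mktuple (gen_unit gen)// u0.
have v0 i : (i < d)%N -> 0 <= upd u k i.
  by move=> id; rewrite /upd; case: ifP => _; rewrite ?addr_ge0 ?u0.
have [m1 e1] := IH u (ltnW kd) u0; have [m2 e2] := IH (upd u k) (ltnW kd) v0.
rewrite SS//; split; first exact: measurableD.
rewrite measureD//; last by rewrite -ge0_fin_numE// fin_num_measure.
rewrite [X in (_ - X)%E](_ : _ = cop_measure C (S k (upd u k))); last first.
  by congr (cop_measure C _); apply: setIidr; exact: Ssub.
rewrite mkseqS rev_rcons/=.
transitivity ((alt_diff (rev (mkseq h k)) psi (\sum_(i < d) u i))%:E -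
  (alt_diff (rev (mkseq h k)) psi (\sum_(i < d) upd u k i))%:E)%E; first by rewrite -e1 -e2.
rewrite -EFinB; congr (_ - alt_diff _ _ _)%:E.
rewrite (bigD1 (Ordinal kd))//= [in RHS](bigD1 (Ordinal kd))//= /upd eqxx addrAC.
congr (_ + _ + _); apply: eq_bigr => i; rewrite -val_eqE/= => /negbTE ->.
by [].
Qed.

Lemma alt_diff_generator_ge0 k z : (0 < d)%N -> (k <= d)%N -> 0 <= z ->
  0 <= alt_diff (rev (mkseq h k)) psi z.
Proof.
move=> d0 kd z0; pose u i : R := if i == 0%N then z else 0.
have [_ e] := @S_measure k u kd (fun i _ => ltac:(by rewrite /u; case: ifP)).
have : (0 <= cop_measure C (S k u))%E by exact: measure_ge0.
rewrite e lee_fin.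
rewrite (bigD1 (Ordinal d0))//= [X in _ + X]big1 ?addr0//.
by move=> i; rewrite -val_eqE /u/= => /negbTE ->.
Qed.

End volumes.

(** A copula gives nonnegative mass to every box, and the steps of the
    difference are the lengths of the sides measured by phi. *)
Theorem archimedean_kmono : (0 < d)%N -> kmono d psi.
Proof.
move=> d0 hs z hd hs0 z0.
pose h i := nth 0 (rev hs) i.
have hE : rev (mkseq h (size hs)) = hs.
  by rewrite /h -(size_rev hs) mkseq_nth revK.
rewrite -hE; apply: alt_diff_generator_ge0 => //; last exact: ltW.
move=> i; rewrite /h; have [si|si] := ltnP i (size (rev hs)).
  by apply: (allP hs0); rewrite -(mem_rev hs) mem_nth.
by rewrite nth_default.
Qed.

End archimedean_copula.

(** * Convergence of generators *)

Lemma cvg_uniform_onP {R : realType} (A : set R) (f_ : nat -> R -> R) (f : R -> R) :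
  {uniform A, f_ @ \oo --> f} <->
  (forall e, 0 < e -> \forall n \near \oo, forall z, A z -> `|f z - f_ n z| < e).
Proof.
split=> [H e e0|H P /uniform_nbhs[E [entE EP]]].
  have := H [set h | forall y, A y -> `|f y - h y| < e]; apply.
  apply/uniform_nbhs; exists [set xy | `|xy.1 - xy.2| < e]; split; last by [].
  by rewrite -entourage_ballE; exists e.
move: entE; rewrite -entourage_ballE => -[e /= e0 eE].
have := H e e0; apply: filterS => n Hn; apply: EP => y Ay; apply: eE => /=.
exact: Hn.
Qed.

Section convergence.
Context {R : realType}.
Variables (psi_ : nat -> R -> R) (psi : R -> R).
Hypotheses (gen_ : forall n, is_generator (psi_ n)) (gen : is_generator psi).
Implicit Types u v x z : R.

Let good z := psi_ n z @[n --> \oo] --> psi z.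

Section bivariate.
Variables (B_ : nat -> R -> R -> R) (B : R -> R -> R).
Hypothesis BE_ : forall n u v, 0 <= u -> 0 <= v -> B_ n (psi_ n u) (psi_ n v) = psi_ n (u + v).
Hypothesis BE : forall u v, 0 <= u -> 0 <= v -> B (psi u) (psi v) = psi (u + v).
Hypothesis Blip : forall n x y x' y', 0 <= x <= 1 -> 0 <= y <= 1 ->
  0 <= x' <= 1 -> 0 <= y' <= 1 -> `|B_ n x y - B_ n x' y'| <= `|x - x'| + `|y - y'|.
Hypothesis Bcvg : forall x y, 0 <= x <= 1 -> 0 <= y <= 1 -> B_ n x y @[n --> \oo] --> B x y.

(** The functions B_n have a common Lipschitz constant, so B_n (psi_n u, psi_n
    v) converges to B (psi u, psi v). *)
Let goodD u v : 0 <= u -> 0 <= v -> good u -> good v -> good (u + v).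
Proof.
move=> u0 v0 gu gv; rewrite /good -BE//; apply/cvgrPdist_le => e e0.
have e3 : 0 < e / 3 by rewrite divr_gt0.
near=> n.
have H1 : `|psi u - psi_ n u| <= e / 3 by near: n; exact: cvgr_dist_le.
have H2 : `|psi v - psi_ n v| <= e / 3 by near: n; exact: cvgr_dist_le.
have H3 : `|B (psi u) (psi v) - B_ n (psi u) (psi v)| <= e / 3.
  by near: n; apply: cvgr_dist_le => //; apply: Bcvg; exact: gen_unit.
have H4 := Blip n (gen_unit gen u0) (gen_unit gen v0) (gen_unit (gen_ n) u0) (gen_unit (gen_ n) v0).
rewrite -BE_//.
have -> : B (psi u) (psi v) - B_ n (psi_ n u) (psi_ n v) =
  (B (psi u) (psi v) - B_ n (psi u) (psi v)) + (B_ n (psi u) (psi v) - B_ n (psi_ n u) (psi_ n v)) by ring.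
apply: le_trans (ler_normD _ _) _; lra.
Unshelve. all: by end_near. Qed.

(** Since B (psi (r / 2), psi (r / 2)) = psi r, a level y above psi (r / 2)
    satisfies B (y, y) > psi r. Then B_n (y, y) > psi_n r for large n, which
    means phi_n y + phi_n y < r and so psi_n (r / 2) <= y; levels below psi (r
    / 2) are treated in the same way. *)
Let good_half r : 0 < r -> 0 < psi r -> good r -> good (r / 2).
Proof.
move=> r0 pr gr; have r20 : 0 <= r / 2 by rewrite divr_ge0// ltW.
have rr : r / 2 < r by rewrite ltr_pdivrMr// ltr_pMr// ltr1n.
have prr : psi r < psi (r / 2) by rewrite (gen_lt gen)// (lt_le_trans pr)// (gen_nonincreasing gen)// ltW.
have pr2 : 0 < psi (r / 2) by exact: lt_trans prr.
apply/cvgrPdist_le => e e0.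
have up : \forall n \near \oo, psi_ n (r / 2) <= psi (r / 2) + e.
  (* Levels above 1 are outside the domain of phi, and there the bound is
     trivial. *)
  have [he|he] := leP 1 (psi (r / 2) + e).
    by near=> n; rewrite (le_trans _ he)// (gen_le1 (gen_ n)).
  set y := _ + e in he *.
  have y01 : 0 < y <= 1 by rewrite (ltW he) andbT addr_gt0.
  have [u u0 uy] := gen_surj gen y01.
  have ur : u < r / 2 by rewrite -(phirK gen u0) uy ?phir_lt//; [rewrite ltrDl|case/andP: y01].
  have y01' : 0 <= y <= 1 by case/andP: y01 => /ltW -> ->.
  have c1 := Bcvg y01' y01'.
  have Byr : psi r < B y y.
    rewrite -uy BE// gen_lt//; [by rewrite addr_ge0|lra|].
    by rewrite (lt_le_trans pr)// (gen_nonincreasing gen)//; [rewrite addr_ge0|lra].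
  have c2 : (B_ n y y - psi_ n r) @[n --> \oo] --> B y y - psi r by exact: cvgB.
  near=> n.
  have : 0 < B_ n y y - psi_ n r by near: n; apply: (cvgr_gt _ c2); rewrite subr_gt0.
  have [v v0 vy] := gen_surj (gen_ n) y01.
  rewrite -{1 2}vy BE_// subr_gt0 => K.
  have vr : v + v < r.
    by rewrite ltNge; apply/negP => rv; move: K; rewrite ltNge (gen_nonincreasing (gen_ n))// ltW.
  by rewrite -vy (gen_nonincreasing (gen_ n))//; lra.
have dn : \forall n \near \oo, psi (r / 2) - e <= psi_ n (r / 2).
  have [he|he] := leP (psi (r / 2) - e) 0.
    by near=> n; rewrite (le_trans he)// (gen_ge0 (gen_ n)).
  set y := _ - e in he *.
  have y1 : psi (r / 2) <= 1 by exact: (gen_le1 gen).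
  have y01 : 0 < y <= 1 by rewrite he/= /y; lra.
  have [u u0 uy] := gen_surj gen y01.
  have ur : r / 2 < u.
    by rewrite -(phirK gen u0) uy// lt_phir// /y gtrDl oppr_lt0.
  have y01' : 0 <= y <= 1 by case/andP: y01 => /ltW -> ->.
  have c1 := Bcvg y01' y01'.
  have Byr : B y y < psi r by rewrite -uy BE// gen_lt//; [exact: ltW|lra].
  have c2 : (B_ n y y - psi_ n r) @[n --> \oo] --> B y y - psi r by exact: cvgB.
  near=> n.
  have : B_ n y y - psi_ n r < 0 by near: n; apply: (cvgr_lt _ c2); rewrite subr_lt0.
  have [v v0 vy] := gen_surj (gen_ n) y01.
  rewrite -{1 2}vy BE_// subr_lt0 => K.
  have vr : r < v + v.
    rewrite ltNge; apply/negP => rv; move: K; rewrite ltNge (gen_nonincreasing (gen_ n))//.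
    by rewrite addr_ge0.
  by rewrite -vy (gen_nonincreasing (gen_ n))//; lra.
near=> n; rewrite ler_distlC; apply/andP; split.
  by near: n.
by near: n.
Unshelve. all: by end_near. Qed.

(** The bound by 1/2 keeps psi positive at the points to be halved. *)
Let good_dyadic j : good ((2 ^+ j)^-1) /\ 2^-1 <= psi ((2 ^+ j)^-1).
Proof.
elim: j => [|j [IH1 IH2]].
  rewrite expr0 invr1 (gen_normalized gen); split => //.
  rewrite /good (gen_normalized gen); under eq_fun do rewrite (gen_normalized (gen_ _)).
  exact: cvg_cst.
have j0 : 0 < (2 ^+ j)^-1 :> R by rewrite invr_gt0 exprn_gt0.
rewrite exprS invfM mulrC; split.
  by apply: good_half => //; apply: lt_le_trans IH2.
apply: le_trans IH2 _; apply: (gen_nonincreasing gen); first by rewrite divr_ge0// ltW.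
by rewrite ler_pdivrMr// ler_pMr// ler1n.
Qed.

(** Dyadic points are sums of copies of a single power of 1/2, and they are
    dense. *)
Lemma bivariate_dense a b : 0 <= a -> a < b -> exists2 z, a < z < b & good z.
Proof.
move=> a0 ab.
have ba0 : 0 < b - a by rewrite subr_gt0.
pose j := Num.truncn (b - a)^-1.
have jP : (2 ^+ j.+1)^-1 < b - a.
  rewrite -[ltRHS]invrK ltf_pV2 ?posrE ?exprn_gt0 ?invr_gt0//.
  have bi0 : 0 < (b - a)^-1 by rewrite invr_gt0.
  have /andP[_ h] := truncn_itv (ltW bi0).
  apply: lt_le_trans h _.
  by rewrite -natrX ler_nat ltnW// ltn_expl.
set e := (2 ^+ j.+1)^-1 in jP.
have e0 : 0 < e by rewrite invr_gt0 exprn_gt0.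
have gk k : good (k%:R * e).
  elim: k => [|k IH].
    rewrite mul0r /good (gen_at0 gen); under eq_fun do rewrite (gen_at0 (gen_ _)).
    exact: cvg_cst.
  rewrite -natr1 mulrDl mul1r; apply: goodD => //; first by rewrite mulr_ge0// ltW.
    exact: ltW.
  by have [] := good_dyadic j.+1.
exists ((Num.truncn (a / e)).+1%:R * e) => //.
have /andP[h1 h2] := truncn_itv (divr_ge0 a0 (ltW e0)).
move: h1 h2; rewrite ler_pdivlMr// ltr_pdivrMr// => h1 h2.
rewrite h2/= -natr1 mulrDl mul1r; lra.
Qed.

End bivariate.

(** Everything rests on the equivalence of phi x < z and psi z < x: a good
    point z on either side of phi x confines phi_n x. *)
Lemma dense_phir : (forall a b, 0 <= a -> a < b -> exists2 z, a < z < b & good z) ->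
  forall x, 0 < x <= 1 -> phir (psi_ n) x @[n --> \oo] --> phir psi x.
Proof.
move=> dense x x01; apply/cvgrPdist_le => e e0.
have up : \forall n \near \oo, phir (psi_ n) x <= phir psi x + e.
  have [|z /andP[z1 z2] gz] := dense (phir psi x) (phir psi x + e) (phir_ge0 gen x01).
    by rewrite ltrDl.
  have z0 : 0 <= z by rewrite (le_trans (phir_ge0 gen x01))// ltW.
  rewrite phir_lt// in z1.
  near=> n.
  have : psi_ n z < x by near: n; exact: (cvgr_lt _ gz).
  by rewrite -phir_lt// => /ltW/le_trans; apply; exact: ltW.
have dn : \forall n \near \oo, phir psi x - e <= phir (psi_ n) x.
  have [he|he] := leP (phir psi x - e) 0.
    by near=> n; rewrite (le_trans he)// (phir_ge0 (gen_ n)).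
  have [|z /andP[z1 z2] gz] := dense (phir psi x - e) (phir psi x) (ltW he).
    by rewrite gtrDl oppr_lt0.
  have z0 : 0 <= z by rewrite (le_trans (ltW he))// ltW.
  rewrite lt_phir// in z2.
  near=> n.
  have : x < psi_ n z by near: n; exact: (cvgr_gt _ gz).
  by rewrite -lt_phir// => /ltW; apply: le_trans; exact: ltW.
near=> n; rewrite ler_distlC; apply/andP; split.
  by near: n.
by near: n.
Unshelve. all: by end_near. Qed.

Hypothesis phic : forall x, 0 < x <= 1 -> phir (psi_ n) x @[n --> \oo] --> phir psi x.

(** The equivalence of phi y < z and psi z < y, read for the levels y = psi z
    - e and y = psi z + e, transfers the convergence of phi_n y - z_n to psi_n
    (z_n). *)
Lemma phir_cvg_moving (z_ : nat -> R) z : (forall n, 0 <= z_ n) -> 0 <= z ->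
  z_ n @[n --> \oo] --> z -> psi_ n (z_ n) @[n --> \oo] --> psi z.
Proof.
move=> zn0 z0 zz; apply/cvgrPdist_le => e e0.
have up : \forall n \near \oo, psi_ n (z_ n) <= psi z + e.
  have [he|he] := leP 1 (psi z + e).
    by near=> n; rewrite (le_trans _ he)// (gen_le1 (gen_ n)).
  set y := _ + e in he *.
  have y01 : 0 < y <= 1 by rewrite (ltW he) andbT ltr_wpDl// (gen_ge0 gen).
  have yz : phir psi y < z by rewrite phir_lt// /y ltrDl.
  have c : (z_ n - phir (psi_ n) y) @[n --> \oo] --> z - phir psi y.
    by apply: cvgB => //; exact: phic.
  near=> n.
  have : 0 < z_ n - phir (psi_ n) y by near: n; apply: (cvgr_gt _ c); rewrite subr_gt0.
  by rewrite subr_gt0 phir_lt// => /ltW.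
have dn : \forall n \near \oo, psi z - e <= psi_ n (z_ n).
  have [he|he] := leP (psi z - e) 0.
    by near=> n; rewrite (le_trans he)// (gen_ge0 (gen_ n)).
  set y := _ - e in he *.
  have y1 : psi z <= 1 by exact: (gen_le1 gen).
  have y01 : 0 < y <= 1 by rewrite he/= /y; lra.
  have yz : z < phir psi y by rewrite lt_phir// /y gtrDl oppr_lt0.
  have c : (phir (psi_ n) y - z_ n) @[n --> \oo] --> phir psi y - z.
    by apply: cvgB => //; exact: phic.
  near=> n.
  have : 0 < phir (psi_ n) y - z_ n by near: n; apply: (cvgr_gt _ c); rewrite subr_gt0.
  by rewrite subr_gt0 lt_phir// => /ltW.
near=> n; rewrite ler_distlC; apply/andP; split.
  by near: n.
by near: n.
Unshelve. all: by end_near. Qed.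

(** The functions psi_n are monotone with values in [0, 1]; once they are
    within 1 / N of psi at the points where psi takes the values k / N, they
    are within 3 / N everywhere. *)
Lemma phir_cvg_uniform : {uniform `[0, +oo[, psi_ @ \oo --> psi}.
Proof.
apply/cvg_uniform_onP => e e0.
pose N := (Num.truncn (3 / e)).+1.
have N0 : 0 < N%:R :> R by rewrite ltr0n.
have eN : 3 / N%:R < e.
  rewrite ltr_pdivrMr// mulrC -ltr_pdivrMr//.
  by have /andP[] := truncn_itv (divr_ge0 (ler0n R 3) (ltW e0)).
pose x (k : nat) : R := k%:R / N%:R.
have xS k : x k.+1 = x k + N%:R^-1 by rewrite /x -natr1 mulrDl mul1r.
have x01 k : (0 < k <= N)%N -> 0 < x k <= 1.
  by move=> /andP[k0 kN]; rewrite /x divr_gt0 ?ltr0n//= ler_pdivrMr// mul1r ler_nat.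
have Hnear : \forall n \near \oo, forall i : 'I_N.+1, (0 < i)%N ->
    `|x i - psi_ n (phir psi (x i))| <= N%:R^-1.
  apply: filter_forall => i; have [->|i0] := posnP i; first by near=> n.
  have xi : 0 < x i <= 1 by apply: x01; rewrite i0 -ltnS ltn_ord.
  have c : psi_ n (phir psi (x i)) @[n --> \oo] --> x i.
    rewrite -[X in _ --> X](psi_phir gen xi).
    by apply: phir_cvg_moving; [move=> _| |exact: cvg_cst]; exact: (phir_ge0 gen).
  by near=> n => _; near: n; apply: cvgr_dist_le; rewrite // invr_gt0.
near=> n => z; rewrite /= in_itv/= andbT => z0.
have Hn k : (0 < k <= N)%N -> `|x k - psi_ n (phir psi (x k))| <= N%:R^-1.
  move=> /andP[k0 kN]; rewrite -ltnS in kN.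
  have K : forall i : 'I_N.+1, (0 < i)%N -> `|x i - psi_ n (phir psi (x i))| <= N%:R^-1.
    by near: n.
  exact: (K (Ordinal kN)).
have iN3 : 3 / N%:R = 3 * N%:R^-1 :> R by [].
have Ni0 : 0 < N%:R^-1 :> R by rewrite invr_gt0.
have p0 := gen_ge0 gen z0; have pn0 := gen_ge0 (gen_ n) z0.
have p1 := gen_le1 gen z0; have pn1 := gen_le1 (gen_ n) z0.
pose k := Num.truncn (psi z * N%:R).
have /andP[k1 k2] : x k <= psi z < x k.+1.
  rewrite /x ler_pdivrMr// ltr_pdivlMr//; apply: truncn_itv; by rewrite mulr_ge0.
have kN : (k <= N)%N.
  by rewrite -(ler_nat R) -(@ler_pM2r _ N%:R^-1) ?invr_gt0// divff ?gt_eqF// (le_trans k1).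
rewrite ltr_distlC; apply/andP; split.
  have [k0|k0] := posnP k.
    move: k2; rewrite k0 xS /x mul0r; lra.
  have kk : (0 < k <= N)%N by rewrite k0.
  have : psi_ n (phir psi (x k)) <= psi_ n z.
    apply: (gen_nonincreasing (gen_ n)) => //.
    by rewrite leNgt phir_lt ?x01// -leNgt.
  have := Hn k kk; rewrite ler_norml => /andP[]; move: k2; rewrite xS; lra.
move: kN; rewrite leq_eqVlt => /predU1P[kN|kN].
  by move: k1; rewrite kN /x divff ?gt_eqF//; lra.
have kk : (0 < k.+1 <= N)%N by [].
have : psi_ n z <= psi_ n (phir psi (x k.+1)).
  apply: (gen_nonincreasing (gen_ n)) => //; first by apply: (phir_ge0 gen); exact: x01.
  by apply: ltW; rewrite phir_lt ?x01.
have := Hn k.+1 kk; rewrite ler_norml => /andP[]; move: k1; rewrite xS; lra.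
Unshelve. all: by end_near. Qed.

End convergence.

(** * Integrals of products of monotone functions *)

Lemma bounded_integrable d (T : measurableType d) (R : realType)
    (mu : {measure set T -> \bar R}) (D : set T) (h : T -> R) (M : R) :
  measurable D -> (mu D < +oo)%E -> measurable_fun D h ->
  (forall t, D t -> `|h t| <= M) -> mu.-integrable D (EFin \o h).
Proof.
move=> mD Doo mh hM; apply: measurable_bounded_integrable => //.
exists M; split; [exact: num_real|move=> N MN t Dt; exact: le_trans (hM t Dt) (ltW MN)].
Qed.

Section prelim.
Context {R : realType}.

Lemma nondecreasing_on_measurable (D : set R) (f : R -> R) : is_interval D ->
  (forall x y, D x -> D y -> x <= y -> f x <= f y) -> measurable_fun D f.
Proof.
move=> iD fD.
apply: (measurability (@RGenCInfty.G R)) => [|/= _ [_] [r] -> <-].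
  exact: RGenCInfty.measurableE.
apply: is_interval_measurable => s t/= [Ds fs] [Dt _] u /andP[su ut].
have Du : D u by apply: (iD s t) => //; rewrite su ut.
split => //; move: fs; rewrite /= !in_itv/= !andbT => /le_trans; apply.
exact: fD.
Qed.

Lemma nonincreasing_on_measurable (D : set R) (f : R -> R) : is_interval D ->
  (forall x y, D x -> D y -> x <= y -> f y <= f x) -> measurable_fun D f.
Proof.
move=> iD fD; rewrite -(opprK f); apply/measurable_funN.
by apply: nondecreasing_on_measurable => // x y Dx Dy xy; rewrite lerN2 fD.
Qed.

Lemma lambda1_itv (a b : R) : 0 <= a -> a <= b -> b <= 1 ->
  @lambda1 R `]a, b]%classic = (b - a)%:E.
Proof.
move=> a0 ab b1; rewrite /lambda1 /mrestr setIidl.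
  rewrite lebesgue_measure_itv/= lte_fin; move: ab; rewrite le_eqVlt => /predU1P[->|->//].
  by rewrite ltxx subrr.
move=> t /=; rewrite !in_itv/= => /andP[at_ tb].
by rewrite (le_trans a0 (ltW at_)) (le_trans tb).
Qed.

(** Over N equal pieces the bounds telescope in H and leave a factor (b - a) /
    N. *)
Lemma flat_eq (F H : R -> R) a b : a <= b ->
  (forall x y, a <= x -> x <= y -> y <= b -> `|F y - F x| <= (H y - H x) * (y - x)) ->
  F a = F b.
Proof.
move=> ab FH; have [->//|ab'] := eqVneq a b.
have {ab'}ab' : 0 < b - a by rewrite subr_gt0 lt_neqAle ab' ab.
have key N : (0 < N)%N -> `|F b - F a| <= (H b - H a) * (b - a) / N%:R.
  move=> N0; have N0' : 0 < N%:R :> R by rewrite ltr0n.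
  pose h := (b - a) / N%:R; have h0 : 0 < h by rewrite divr_gt0.
  have hN : N%:R * h = b - a by rewrite /h mulrC divfK ?gt_eqF.
  have st k : (k <= N)%N -> `|F (a + k%:R * h) - F a| <= (H (a + k%:R * h) - H a) * h.
    elim: k => [|k IH] kN; first by rewrite !mul0r !addr0 !subrr normr0 mul0r.
    have e : a + k.+1%:R * h = a + k%:R * h + h by rewrite -natr1 mulrDl mul1r addrA.
    have := FH (a + k%:R * h) (a + k.+1%:R * h).
    have k0 : 0 <= k%:R * h by rewrite mulr_ge0// ltW.
    have kN' : k.+1%:R * h <= b - a by rewrite -hN ler_wpM2r ?ler_nat// ltW.
    rewrite lerDl k0 => /(_ isT); rewrite e lerDl ltW// => /(_ isT).
    rewrite -e -lerBrDl kN' => /(_ isT); rewrite e => A.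
    have {}IH := IH (ltnW kN).
    have -> : F (a + k%:R * h + h) - F a =
      (F (a + k%:R * h + h) - F (a + k%:R * h)) + (F (a + k%:R * h) - F a) by ring.
    apply: le_trans (ler_normD _ _) _; move: A.
    have -> : a + k%:R * h + h - (a + k%:R * h) = h :> R by ring.
    nra.
  have := st N (leqnn N); rewrite hN (addrC a) subrK => /le_trans; apply.
  by rewrite /h mulrA.
apply/eqP; rewrite eq_sym -subr_eq0 -normr_le0; apply/ler_addgt0Pr => e e0; rewrite add0r.
pose K := (H b - H a) * (b - a).
have K0 : 0 <= K by have := key 1%N isT; rewrite divr1; apply: le_trans.
pose N := (Num.truncn (K / e)).+1.
apply: le_trans (key N isT) _; rewrite -/K ler_pdivrMr ?ltr0n// mulrC -ler_pdivrMr//.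
by apply: ltW; have /andP[] := truncn_itv (divr_ge0 K0 (ltW e0)).
Qed.

End prelim.

Section product_integral.
Context {R : realType}.
Variables (mu : {measure set (measurableTypeR R) -> \bar R}) (l r : R) (p q G : R -> R).
Hypothesis muE : forall x y, l < x -> x <= y -> y < r -> mu `]x, y]%classic = (y - x)%:E.
Hypothesis p_ge0 : forall t, l < t -> t < r -> 0 <= p t.
Hypothesis q_ge0 : forall t, l < t -> t < r -> 0 <= q t.
Hypothesis p_nd : forall x y, l < x -> x <= y -> y < r -> p x <= p y.
Hypothesis q_ni : forall x y, l < x -> x <= y -> y < r -> q y <= q x.
Hypothesis Gb : forall x y, l < x -> x < y -> y < r ->
  p x * q y * (y - x) <= G y - G x <= p y * q x * (y - x).

Lemma measurable_on_nondecreasing : measurable_fun (`]l, r[%classic : set R) p.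
Proof.
apply: nondecreasing_on_measurable; first exact: interval_is_interval.
by move=> x y; rewrite /= !in_itv/= => /andP[x0 _] /andP[_ y1] xy; exact: p_nd.
Qed.

Lemma measurable_on_nonincreasing : measurable_fun (`]l, r[%classic : set R) q.
Proof.
apply: nonincreasing_on_measurable; first exact: interval_is_interval.
by move=> x y; rewrite /= !in_itv/= => /andP[x0 _] /andP[_ y1] xy; exact: q_ni.
Qed.

Let w t := p t * q t.

Lemma measurable_product (a b : R) : l < a -> b < r -> measurable_fun `]a, b]%classic w.
Proof.
move=> a0 b1; apply: (@measurable_funS _ _ R R (`]l, r[%classic : set R)) => //.
  move=> t; rewrite /= !in_itv/= => /andP[at_ tb].
  by rewrite (lt_trans a0 at_) (le_lt_trans tb).
apply: measurable_funM; [exact: measurable_on_nondecreasing|].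
exact: measurable_on_nonincreasing.
Qed.

Let wb (a b t : R) : l < a -> b < r -> a < t -> t <= b -> p a * q b <= w t <= p b * q a.
Proof.
move=> a0 b1 at_ tb; have t0 := lt_trans a0 at_; have t1 := le_lt_trans tb b1.
have a1 := lt_trans at_ t1; have b0 := lt_le_trans t0 tb.
apply/andP; split; apply: ler_pM.
- exact: p_ge0.
- exact: q_ge0.
- exact: (p_nd _ (ltW at_)).
- exact: (q_ni _ tb).
- exact: p_ge0.
- exact: q_ge0.
- exact: (p_nd _ tb).
- exact: (q_ni _ (ltW at_)).
Qed.

Lemma product_integrable (a b : R) : l < a -> a <= b -> b < r ->
  mu.-integrable `]a, b]%classic (EFin \o w).
Proof.
move=> a0 ab b1; apply: (@bounded_integrable _ _ _ _ _ _ (p b * q a)) => //.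
- by rewrite [ltLHS]muE// ltry.
- exact: measurable_product.
move=> t /=; rewrite in_itv/= => /andP[at_ tb].
have /andP[w1 w2] := wb a0 b1 at_ tb.
have t0 := lt_trans a0 at_; have t1 := le_lt_trans tb b1.
by rewrite ger0_norm// mulr_ge0 ?p_ge0 ?q_ge0.
Qed.
Let wint := product_integrable.

Let Ib (x y : R) : l < x -> x < y -> y < r ->
  p x * q y * (y - x) <= \int[mu]_(t in `]x, y]) w t <= p y * q x * (y - x).
Proof.
move=> x0 xy y1.
have cint c : mu.-integrable `]x, y]%classic (EFin \o cst c).
  by apply: (@bounded_integrable _ _ _ _ _ _ `|c|) => //; rewrite [ltLHS]muE ?ltry// ltW.
have cE c : \int[mu]_(t in `]x, y]) c = c * (y - x).
  by rewrite Rintegral_cst// muE// ltW.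
apply/andP; split.
  rewrite -cE; apply: le_Rintegral; [by []|exact: cint|by apply: wint => //; exact: ltW|].
  by move=> t /=; rewrite in_itv/= => /andP[xt ty]; have /andP[] := wb x0 y1 xt ty.
rewrite -cE; apply: le_Rintegral; [by []|by apply: wint => //; exact: ltW|exact: cint|].
by move=> t /=; rewrite in_itv/= => /andP[xt ty]; have /andP[] := wb x0 y1 xt ty.
Qed.

(** The function p q may have countably many jumps, so G is a primitive of it
    only in the integrated sense. The integral of p q satisfies the same
    two-sided bounds on increments as G, so that the increments of the
    difference are at most (p y q x - p x q y) (y - x), and [flat_eq] applies. *)
Lemma product_Rintegral a b : l < a -> a <= b -> b < r ->
  \int[mu]_(t in `]a, b]) (p t * q t) = G b - G a.
Proof.
move=> a0 ab b1.
pose F t := \int[mu]_(t in `]a, t]) w t - G t.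
(* With this choice H y - H x dominates p y q x - p x q y on [a, b], because q
   <= q a and p <= p b there. *)
pose H t := p t * q a - p b * q t.
suff : F a = F b.
  rewrite /F [X in X - _ = _](_ : _ = 0); last by rewrite set_itvoc0 Rintegral_set0.
  by rewrite sub0r => e; rewrite -[LHS](subrK (G b)) -e addrC.
apply: (@flat_eq _ F H) => // x y ax + yb.
rewrite le_eqVlt => /predU1P[->|xy]; first by rewrite !subrr normr0 mul0r.
have x0 := lt_le_trans a0 ax; have y1 := le_lt_trans yb b1.
have y0 := lt_trans x0 xy; have x1 := lt_trans xy y1.
have FE : F y - F x = \int[mu]_(t in `]x, y]) w t - (G y - G x).
  have U : `]a, y]%classic = `]a, x]%classic `|` `]x, y]%classic :> set R.
    by rewrite -itv_bndbnd_setU ?bnd_simp// ltW.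
  rewrite /F U Rintegral_setU//; last first.
  - rewrite disj_set2E; apply/eqP/seteqP; split => // t /=; rewrite !in_itv/=.
    by move=> [/andP[_ tx] /andP[xt _]]; move: (lt_le_trans xt tx); rewrite ltxx.
  - by rewrite -U; apply: wint => //; exact: (le_trans ax (ltW xy)).
  by rewrite opprB addrACA -opprD; ring.
rewrite FE.
have /andP[G1 G2] := Gb x0 xy y1; have /andP[I1 D2sq] := Ib x0 xy y1.
have M1 : (p y * q x - p x * q y) <= H y - H x.
  clear FE; have := p_nd x0 (ltW xy) y1; have := q_ni x0 (ltW xy) y1.
  have := p_nd x0 (le_trans (ltW xy) yb) b1; have := q_ni a0 ax x1.
  by rewrite /H; nra.
apply: (@le_trans _ _ ((p y * q x - p x * q y) * (y - x))).
  by rewrite ler_norml; apply/andP; split; lra.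
by rewrite ler_wpM2r// subr_ge0 ltW.
Qed.

End product_integral.

Section kernel_primitive.
Context {R : realType}.
Variables (psi g : R -> R) (s : R).
Hypotheses (gen : is_generator psi) (cpsi : cvx psi).
Hypotheses (s0 : 0 <= s) (cg : cvx g).
Hypothesis gni : forall u v : R, 0 < u -> u <= v -> g v <= g u.
Hypothesis g0 : forall u : R, 0 < u -> 0 <= g u.
Local Notation ld := left_derivative.
Local Notation phi := (phir psi).

(** Minus the derivative of phi, and below minus the factor g' (s + phi t):
    away from countably many points, pf t * qf t is the derivative of t |-> g
    (s + phi t). *)
Definition qf (t : R) := (- left_derivative psi (phir psi t))^-1.
Definition pf (t : R) := - left_derivative g (s + phir psi t).
Let G t := g (s + phi t).

Let phi0 (t : R) : 0 < t -> t < 1 -> 0 < phi t.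
Proof. by move=> t0 t1; apply: phir_gt0; rewrite ?t0. Qed.

Let phis0 (t : R) : 0 < t -> t < 1 -> 0 < s + phi t.
Proof. by move=> t0 t1; rewrite ltr_wpDl// phi0. Qed.

Let P0 (t : R) : 0 < t -> t < 1 -> 0 < - ld psi (phi t).
Proof.
move=> t0 t1; rewrite oppr_gt0.
have u0 := phi0 t0 t1.
have := @cvx_ld_le R psi (phi t) (phi t + 1) cpsi u0 (ltac:(by rewrite ltrDl)).
rewrite addrAC subrr add0r mulr1 => /le_lt_trans; apply.
rewrite subr_lt0; apply: (gen_lt gen); [exact: ltW|by rewrite ltrDl|].
by rewrite psi_phir// t0 ltW.
Qed.

Lemma qf_gt0 (t : R) : 0 < t -> t < 1 -> 0 < qf t.
Proof. by move=> t0 t1; rewrite /qf invr_gt0 P0. Qed.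

Lemma pf_ge0 (t : R) : 0 < t -> t < 1 -> 0 <= pf t.
Proof.
move=> t0 t1; rewrite /pf oppr_ge0.
have u0 := phis0 t0 t1.
have := @cvx_ld_le R g (s + phi t) (s + phi t + 1) cg u0 (ltac:(by rewrite ltrDl)).
rewrite addrAC subrr add0r mulr1 => /le_trans; apply.
by rewrite subr_le0 gni// lerDl.
Qed.

Lemma pf_nd (x y : R) : 0 < x -> x <= y -> y < 1 -> pf x <= pf y.
Proof.
move=> x0; rewrite le_eqVlt => /predU1P[->//|xy] y1.
rewrite lerN2; apply: cvx_ld_nd => //; first by apply: phis0 => //; exact: lt_trans xy.
by rewrite lerD2l ltW//; apply: phir_mono => //; exact: ltW.
Qed.

Lemma qf_ni (x y : R) : 0 < x -> x <= y -> y < 1 -> qf y <= qf x.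
Proof.
move=> x0; rewrite le_eqVlt => /predU1P[->//|xy] y1.
have y0 := lt_trans x0 xy; have x1 := lt_trans xy y1.
rewrite /qf lef_pV2 ?posrE ?P0// lerN2; apply: cvx_ld_nd => //; first exact: phi0.
by rewrite ltW//; apply: phir_mono => //; exact: ltW.
Qed.

Lemma measurable_qf : measurable_fun (`]0, 1[%classic : set R) qf.
Proof.
apply: nonincreasing_on_measurable; first exact: interval_is_interval.
by move=> x y; rewrite /= !in_itv/= => /andP[x0 _] /andP[_ y1] xy; exact: qf_ni.
Qed.

Let w t := pf t * qf t.

Let Gb (x y : R) : 0 < x -> x < y -> y < 1 ->
  pf x * qf y * (y - x) <= G y - G x <= pf y * qf x * (y - x).
Proof.
move=> x0 xy y1; have y0 := lt_trans x0 xy; have x1 := lt_trans xy y1.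
have uv : phi y < phi x by apply: phir_mono => //; exact: ltW.
have u0 : 0 < phi y by exact: phi0.
have suv : s + phi y < s + phi x by rewrite ltrD2l.
have su0 : 0 < s + phi y by exact: phis0.
have A1 := cvx_ld_le cg su0 suv; have A2 := cvx_ld_ge cg su0 suv.
have B1 := cvx_ld_le cpsi u0 uv; have B2 := cvx_ld_ge cpsi u0 uv.
have D1 : s + phi x - (s + phi y) = phi x - phi y by ring.
have xx : 0 < x <= 1 by rewrite x0 ltW.
have yy : 0 < y <= 1 by rewrite y0 ltW.
rewrite D1 in A1 A2; rewrite (psi_phir gen xx) (psi_phir gen yy) in B1 B2.
set dl := phi x - phi y in A1 A2 B1 B2.
have dl0 : 0 <= dl by rewrite subr_ge0 ltW.
have C1 : dl <= qf x * (y - x).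
  by rewrite /qf mulrC ler_pdivlMr ?P0//; lra.
have C2 : qf y * (y - x) <= dl.
  by rewrite /qf mulrC ler_pdivrMr ?P0//; lra.
have p0 := pf_ge0 x0 x1; have p1 := pf_ge0 y0 y1.
apply/andP; split.
  rewrite -mulrA; apply: le_trans (ler_wpM2l p0 C2) _.
  by rewrite /pf /G; lra.
rewrite -mulrA; apply: le_trans (ler_wpM2l p1 C1).
by rewrite /pf /G; lra.
Qed.

Let muE (x y : R) : 0 < x -> x <= y -> y < 1 -> (@lambda1 R) `]x, y]%classic = (y - x)%:E.
Proof. by move=> x0 xy y1; apply: lambda1_itv => //; exact: ltW. Qed.

Let qf_ge0 t : 0 < t -> t < 1 -> 0 <= qf t.
Proof. by move=> t0 t1; exact/ltW/qf_gt0. Qed.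

Hypothesis vanish : forall e, 0 < e -> exists z, [/\ 0 < z, 0 < psi z & g z <= e].

(** [product_Rintegral] is applied on [x / (n + 3), x - x / (n + 3)]. The
    upper boundary term tends to g (s + phi x) by right continuity, as phi
    decreases; the lower one tends to 0 because g becomes small before psi
    reaches 0, hence along phi t for t close to 0. *)
Lemma kernel_integral x : 0 < x <= 1 ->
  (forall e, 0 < e -> exists2 h0, 0 < h0 &
     forall h, 0 <= h -> h <= h0 -> `|g (s + phi x) - g (s + phi x + h)| <= e) ->
  (\int[lambda1]_(t in `]0%R, x[) (pf t * qf t)%:E = (g (s + phi x))%:E)%E.
Proof.
move=> x01 rc; have /andP[x0 x1] := x01.
(* The shift by 3 makes the intervals nondegenerate for all n. *)
pose k (n : nat) : R := x / n.+3%:R.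
have k0 n : 0 < k n by rewrite divr_gt0 ?ltr0n.
have n1 n : n.+3%:R = n%:R + 3 :> R by rewrite -[3]/(3%:R) -natrD addn3.
have n0 n : 0 < n.+3%:R :> R by rewrite ltr0n.
have kx n : k n + k n < x.
  by rewrite /k -mulrDl ltr_pdivrMr// n1; have := ler0n R n; nra.
have kni m n : (m <= n)%N -> k n <= k m.
  by move=> mn; rewrite /k ler_pM2l// lef_pV2 ?posrE// ler_nat !ltnS.
have kc : k n @[n --> \oo] --> (0 : R).
  apply/cvgrPdist_le => e e0; near=> n.
  rewrite sub0r normrN gtr0_norm//= /k ler_pdivrMr// mulrC -ler_pdivrMr// n1.
  apply: (@le_trans _ _ n%:R); last by rewrite lerDl.
  by near: n; exact: nbhs_infty_ger.
have xk n : x - k n < 1 by rewrite (lt_le_trans _ x1)// gtrBl.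
pose F n : set R := `]k n, (x - k n)]%classic.
have FE : \bigcup_n F n = `]0, x[%classic.
  apply/seteqP; split=> [t [n _]|t]; rewrite /F /= !in_itv/= => /andP[t1 t2].
    by rewrite (lt_trans (k0 n) t1) (le_lt_trans t2)// gtrBl.
  have [n nP] : exists n, k n < t /\ k n <= x - t.
    near \oo => n; exists n; split; first by near: n; exact: (cvgr_lt _ kc).
    by near: n; apply: (cvgr_le _ kc); rewrite subr_gt0.
  exists n => //; rewrite /F/= in_itv/= nP.1/= lerBrDr addrC -lerBrDr.
  exact: nP.2.
have sF n : F n `<=` `]0, 1[%classic.
  move=> t; rewrite /F /= !in_itv/= => /andP[t1 t2].
  by rewrite (lt_trans (k0 n) t1) (le_lt_trans t2).
rewrite -FE.
have H1 : (\int[lambda1]_(t in F n) (w t)%:E @[n --> \oo] -->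
  \int[lambda1]_(t in \bigcup_n F n) (w t)%:E)%E.
  apply: ge0_nondecreasing_set_cvg_integral.
  - move=> m n mn; apply/subsetPset => t; rewrite /F/= !in_itv/= => /andP[t1 t2].
    by rewrite (le_lt_trans (kni _ _ mn) t1) (le_trans t2)// lerB// kni.
  - by move=> n; rewrite /F.
  - move=> n; apply/measurable_EFinP; exact: (measurable_product pf_nd qf_ni).
  - move=> n t /sF; rewrite /= in_itv/= => /andP[t1 t2].
    by rewrite lee_fin mulr_ge0 ?pf_ge0// ltW// qf_gt0.
have H2 : (\int[lambda1]_(t in F n) (w t)%:E @[n --> \oo] --> (g (s + phi x))%:E)%E.
  have -> : (fun n => \int[lambda1]_(t in F n) (w t)%:E)%E =
      (fun n => (G (x - k n) - G (k n))%:E).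
    apply/funext => n.
    have ab : k n <= x - k n by rewrite lerBrDr ltW.
    rewrite -(product_Rintegral muE pf_ge0 qf_ge0 pf_nd qf_ni Gb (k0 n) ab (xk n)).
    rewrite /Rintegral fineK//.
    exact: (integrable_fin_num _ (product_integrable muE pf_ge0 qf_ge0 pf_nd qf_ni (k0 n) ab (xk n))).
  apply: cvg_EFin; first by near=> n.
  rewrite -[X in _ --> X]subr0; apply: cvgB; apply/cvgrPdist_le => e e0.
    have [h0 h00 h0P] := rc e e0.
    have px : psi (phi x + h0) < x.
      by rewrite -[ltRHS](psi_phir gen x01) (gen_lt gen) ?(phir_ge0 gen)// ?ltrDl// (psi_phir gen).
    near=> n.
    have A : psi (phi x + h0) < x - k n.
      by rewrite ltrBrDr addrC -ltrBrDr; near: n; apply: (cvgr_lt _ kc); rewrite subr_gt0.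
    have xkn : 0 < x - k n <= 1.
      by rewrite subr_gt0 (lt_trans _ (kx n)) ?ltrDl// ltW.
    have B : phi (x - k n) < phi x + h0 by rewrite phir_lt// addr_ge0 ?(phir_ge0 gen)// ltW.
    have D : phi x <= phi (x - k n).
      by rewrite ltW// phir_mono//; [case/andP: xkn|rewrite gtrBl].
    have := h0P (phi (x - k n) - phi x); rewrite subr_ge0 => /(_ D).
    rewrite lerBlDl => /(_ (ltW B)).
    by rewrite -addrA (addrC (phi x)) subrK.
  have [z [z0 pz gz]] := vanish e0.
  near=> n.
  have A : k n < psi z by near: n; exact: (cvgr_lt _ kc).
  have kn1 : k n < 1 by rewrite (lt_le_trans _ x1)// (lt_trans _ (kx n))// ltrDl.
  have B : z < phi (k n) by rewrite lt_phir// ?k0 ?ltW.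
  rewrite sub0r normrN ger0_norm; last by apply: g0; exact: phis0.
  apply: le_trans gz; apply: gni => //.
  by rewrite (le_trans (ltW B))// lerDr.
exact: cvg_unique H1 H2.
Unshelve. all: by end_near. Qed.

End kernel_primitive.

Lemma cvx_rcont {R : realType} (g : R -> R) z : cvx g -> 0 < z ->
  forall e, 0 < e -> exists2 h0, 0 < h0 &
     forall h, 0 <= h -> h <= h0 -> `|g z - g (z + h)| <= e.
Proof.
move=> cg z0 e e0.
have /cvgrPdist_le/(_ e e0)[d /= d0 dP] := cvx_continuous cg z0.
exists (d / 2); first by rewrite divr_gt0.
move=> h h0 hd; apply: dP => /=.
rewrite opprD addrA subrr add0r normrN ger0_norm// (le_lt_trans hd)//.
by rewrite ltr_pdivrMr// ltr_pMr// ltr1n.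
Qed.

(** * Iterated derivatives of generators *)

Section discontinuities.
Context {R : realType}.

Lemma nonincreasing_discontinuities (h : R -> R) :
  (forall u v, 0 < u -> u <= v -> h v <= h u) ->
  countable [set z | 0 < z /\ ~ {for z, continuous h}].
Proof.
move=> hni; pose F := fun z => - h z.
have Fnd u v : 0 < u -> u <= v -> F u <= F v by move=> u0 uv; rewrite lerN2 hni.
have sub : [set z | 0 < z /\ ~ {for z, continuous h}] `<=`
    \bigcup_n [set z | z \in (`](n.+1%:R^-1), (n.+1%:R)[) /\ discontinuity F z].
  move=> z [z0 nc].
  have [n [n1 n2]] : exists n, n.+1%:R^-1 < z /\ z < n.+1%:R.
    near \oo => n; exists n; split; last first.
      by apply: (@lt_le_trans _ _ n%:R); [near: n; exact: nbhs_infty_gtr|rewrite ler_nat].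
    rewrite invf_plt ?posrE//; apply: (@lt_le_trans _ _ n%:R); last by rewrite ler_nat.
    by near: n; exact: nbhs_infty_gtr.
  exists n => //; split; first by rewrite in_itv/= n1.
  have cl : cvg (F x @[x --> z^'-]).
    apply: nondecreasing_at_left_is_cvgr.
      near=> x => a b; rewrite !in_itv/= => /andP[xa _] _; apply: Fnd.
      by apply: lt_trans xa; near: x; exact: nbhs_left_gt.
    near=> x; exists (F z) => _ /= [a + <-]; rewrite in_itv/= => /andP[xa az].
    apply: Fnd; last exact: ltW.
    by apply: lt_trans xa; near: x; exact: nbhs_left_gt.
  have cr : cvg (F x @[x --> z^'+]).
    apply: nondecreasing_at_right_is_cvgr.
      near=> x => a b; rewrite !in_itv/= => /andP[za _] _; apply: Fnd.
      exact: lt_trans za.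
    near=> x; exists (F z) => _ /= [a + <-]; rewrite in_itv/= => /andP[za _].
    by apply: Fnd => //; exact: ltW.
  split => //; apply/eqP => lr.
  have H1 : lim (F x @[x --> z^'-]) <= F z.
    apply: limr_le => //; near=> x; apply: Fnd; last by near: x; exact: nbhs_left_le.
    by near: x; exact: nbhs_left_gt.
  have H2 : F z <= lim (F x @[x --> z^'+]).
    by apply: limr_ge => //; near=> x; apply: Fnd.
  have Hl : lim (F x @[x --> z^'-]) = F z by apply/eqP; rewrite eq_le H1 lr.
  apply: nc; rewrite -(opprK h); apply: continuousN.
  apply/left_right_continuousP; split; first by rewrite -[X in _ --> X]Hl.
  by rewrite -[X in _ --> X]Hl lr.
apply: sub_countable (subset_card_le sub) _.
apply: bigcup_countable => // n _; apply: discontinuity_countable.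
move=> x y; rewrite !in_itv/= => /andP[x0 _] _; apply: Fnd.
by apply: lt_le_trans x0; rewrite invr_gt0.
Unshelve. all: by end_near. Qed.

End discontinuities.

Section dominated.
Context d (T : measurableType d) {R : realType}.
Variable mu : {measure set T -> \bar R}.

Lemma Rintegral_dominated (D : set T) (f_ : nat -> T -> R) (f g : T -> R) :
  measurable D -> (forall n, measurable_fun D (f_ n)) -> measurable_fun D f ->
  {ae mu, forall x, D x -> f_ n x @[n --> \oo] --> f x} ->
  mu.-integrable D (EFin \o g) -> (forall n x, D x -> `|f_ n x| <= g x) ->
  \int[mu]_(x in D) f_ n x @[n --> \oo] --> \int[mu]_(x in D) f x.
Proof.
move=> mD mf_ mf ff ig fg.
have mf_' n : measurable_fun D (EFin \o f_ n) by apply/measurable_EFinP.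
have mf' : measurable_fun D (EFin \o f) by exact/measurable_EFinP.
have ff' : {ae mu, forall x, D x -> (fun n => (EFin \o f_ n) x) @ \oo --> (EFin \o f) x}.
  by apply: filterS ff => x H Dx; apply: cvg_EFin; [near=> n|exact: H].
have fg' : {ae mu, forall x n, D x -> (`|(EFin \o f_ n) x| <= (EFin \o g) x)%E}.
  by apply: aeW => x n Dx; rewrite lee_fin; exact: fg.
have [intf _ H] := dominated_convergence mD mf_' mf' ff' ig fg'.
apply: fine_cvg; rewrite fineK//.
exact: integrable_fin_num.
Unshelve. all: by end_near. Qed.

Lemma Rintegral_bounded_cvg (D : set T) (f_ : nat -> T -> R) (f : T -> R) M :
  measurable D -> (mu D < +oo)%E -> (forall n, measurable_fun D (f_ n)) -> measurable_fun D f ->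
  {ae mu, forall x, D x -> f_ n x @[n --> \oo] --> f x} ->
  (forall n x, D x -> `|f_ n x| <= M) ->
  \int[mu]_(x in D) f_ n x @[n --> \oo] --> \int[mu]_(x in D) f x.
Proof.
move=> mD muD mf_ mf ff fM; apply: (@Rintegral_dominated _ _ _ (cst M)) => //.
by apply: (@bounded_integrable _ _ _ _ _ _ `|M|).
Qed.

End dominated.

Section mder.
Context {R : realType}.
Implicit Type psi : R -> R.
Local Notation ld := left_derivative.

(** Iterated left derivatives with alternating signs: nonnegative functions
    which make sense up to the order d - 1, where the two-sided derivative may
    fail to exist. *)
Definition mder m psi : R -> R := iter m (fun f z => - ld f z) psi.

Lemma mderS m psi z : mder m.+1 psi z = - ld (mder m psi) z.
Proof. by []. Qed.

Lemma mder_kmono m k psi : (0 < k)%N -> kmono (m + k) psi -> kmono k (mder m psi).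
Proof.
elim: m k => [//|m IH] k k0 kpsi; apply: kmono_ld => //.
by apply: IH => //; rewrite addnS.
Qed.

Lemma mder_cvx m psi : kmono (m + 2) psi -> cvx (mder m psi).
Proof. by move=> kp; apply: (@kmono_cvx _ 2) => //; exact: mder_kmono. Qed.

Lemma mder_continuous m psi z : kmono (m + 2) psi -> 0 < z -> {for z, continuous (mder m psi)}.
Proof. by move=> kp z0; apply: cvx_continuous => //; exact: mder_cvx. Qed.

Lemma mder_ni m psi u v : kmono (m + 1) psi -> 0 < u -> u <= v -> mder m psi v <= mder m psi u.
Proof. by move=> kp; apply: (@kmono_nincr _ 1) => //; exact: mder_kmono. Qed.

Lemma mder_ge0 m psi u : kmono (m + 1) psi -> 0 < u -> 0 <= mder m psi u.
Proof. by move=> kp; apply: (@kmono_ge0 _ 1) => //; exact: mder_kmono. Qed.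

Lemma ldE m psi : ld (mder m psi) = fun z => - mder m.+1 psi z.
Proof. by apply/funext => z; rewrite mderS opprK. Qed.

Lemma ld_continuousP m psi z : {for z, continuous (ld (mder m psi))} <->
  {for z, continuous (mder m.+1 psi)}.
Proof.
split=> H; last by rewrite ldE; apply: continuousN.
have -> : mder m.+1 psi = fun z => - ld (mder m psi) z by [].
exact: continuousN.
Qed.

(** Convexity of [mder m.+1 psi] makes it continuous, so that [mder m psi] is
    differentiable. *)
Lemma derive1n_mder m psi z : kmono (m + 2) psi -> 0 < z ->
  derive1n m psi z = (-1) ^+ m * mder m psi z.
Proof.
elim: m z => [|m IH] z kp z0; first by rewrite expr0 mul1r.
have kp' : kmono (m + 2) psi by apply: kmonoW kp; rewrite addSn.
rewrite derive1nS derive1E.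
have -> : 'D_1 (derive1n m psi) z = 'D_1 (fun t => (-1) ^+ m * mder m psi t) z.
  apply: near_eq_derive; near=> t; apply: IH => //.
  by near: t; exact: lt_nbhsr.
have D : is_derive z 1 (mder m psi) (ld (mder m psi) z).
  apply: cvx_derive => //; first exact: mder_cvx.
  by apply/ld_continuousP; exact: mder_continuous.
have D2 : is_derive z 1 ((-1) ^+ m \*: mder m psi) ((-1) ^+ m *: ld (mder m psi) z).
  exact: is_deriveZ.
have := @derive_val _ _ _ _ _ _ _ D2.
rewrite [X in 'D_1 X z]( _ : _ = (fun t => (-1) ^+ m * mder m psi t)) // => ->.
by rewrite mderS exprS mulN1r mulrNN.
Unshelve. all: by end_near. Qed.

Lemma ld_derive1n m psi z : kmono (m + 2) psi -> 0 < z ->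
  ld (derive1n m psi) z = (-1) ^+ m * ld (mder m psi) z.
Proof.
move=> kp z0; apply: (cvg_lim (@norm_hausdorff _ R)).
have H : (-1) ^+ m * ((mder m psi (z + h) - mder m psi z) / h) @[h --> 0^'-]
    --> (-1) ^+ m * ld (mder m psi) z.
  by apply: cvgMl_tmp; exact: cvx_ld_cvg (mder_cvx kp) z0.
move: H; apply: cvg_trans; apply: near_eq_cvg; near=> h.
have zh : 0 < z + h.
  rewrite -ltrBlDl sub0r; near: h; apply: nbhs_left_gt; by rewrite ltrNl oppr0.
by rewrite /= !derive1n_mder// -mulrBr mulrA.
Unshelve. all: by end_near. Qed.

Section vanish.
Variables (psi : R -> R) (gen : is_generator psi).

(** Beyond the zero the claim follows by induction on m; at the zero itself it
    follows by right continuity. *)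
Let mder_zero m z0 z : kmono (m + 2) psi -> 0 < z0 -> psi z0 = 0 -> z0 <= z ->
  mder m psi z = 0.
Proof.
elim: m z => [|m IH] z kp z00 pz zz.
  apply/eqP; rewrite eq_le (gen_ge0 gen) ?(le_trans (ltW z00))// andbT -pz.
  by apply: (gen_nonincreasing gen) => //; exact: ltW.
have kp' : kmono (m + 2) psi by apply: kmonoW kp; rewrite addSn.
have kp1 : kmono (m.+1 + 1) psi by apply: kmonoW kp; rewrite leq_add2l.
have gt t : z0 < t -> mder m.+1 psi t = 0.
  move=> zt; apply/eqP; rewrite eq_le; apply/andP; split; last first.
    by apply: mder_ge0 => //; exact: lt_trans zt.
  have := cvx_ld_ge (mder_cvx kp') z00 zt.
  rewrite (IH _ kp' z00 pz (ltW zt)) (IH _ kp' z00 pz (lexx _)) subrr mderS oppr_le0.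
  by rewrite pmulr_lge0 ?subr_gt0.
move: zz; rewrite le_eqVlt => /predU1P[<-|]; last exact: gt.
apply/eqP; rewrite -normr_le0; apply/ler_addgt0Pr => e e0; rewrite add0r.
have [h0 h00 h0P] := cvx_rcont (mder_cvx kp) z00 e0.
have := h0P h0 (ltW h00) (lexx _).
by rewrite (gt (z0 + h0)) ?ltrDl// subr0.
Qed.

Let mder_small m e : kmono (m + 2) psi -> 0 < e -> exists2 z, 0 < z & mder m psi z <= e.
Proof.
elim: m => [|m IH] kp e0.
  have [M [_ MP]] : \forall z \near +oo, psi z < e by exact: (cvgr_lt _ (gen_pinfty gen)).
  exists (Num.max 0 M + 1); first by rewrite ltr_wpDl// le_max lexx.
  by apply/ltW/MP; rewrite ltr_pwDr// le_max lexx orbT.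
have kp' : kmono (m + 2) psi by apply: kmonoW kp; rewrite addSn.
have kp1 : kmono (m + 1) psi by apply: kmonoW kp'; rewrite leq_add2l.
have [z z0 zP] := IH kp' e0; exists (z + 1); first by rewrite addr_gt0.
have zz : z < z + 1 by rewrite ltrDl.
have := cvx_ld_ge (mder_cvx kp') z0 zz.
have := mder_ge0 kp1 (lt_trans z0 zz).
rewrite mderS; have -> : z + 1 - z = 1 by ring.
by move: zP; lra.
Qed.

(** A point far to the right will do if psi is positive there. Otherwise z has
    to stay to the left of the first zero a of psi, and is taken close to a,
    where [mder m psi] is continuous and vanishes. *)
Lemma mder_vanish m e : kmono (m + 2) psi -> 0 < e ->
  exists z, [/\ 0 < z, 0 < psi z & mder m psi z <= e].
Proof.
move=> kp e0; have [z z0 zP] := mder_small kp e0.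
have := gen_ge0 gen (ltW z0); rewrite le_eqVlt => /predU1P[pz|pz]; last by exists z.
have cpsi : cvx psi by apply: (kmono_cvx _ kp); rewrite addn2.
pose Z := [set t | 0 < t /\ psi t = 0].
have Zi : has_inf Z by split; [exists z|exists 0 => t [/ltW]].
(* Normalization at 1 keeps the zeros of psi away from 0. *)
pose a := inf Z.
have a1 : 1 <= a.
  apply: lb_le_inf; first by exists z.
  move=> t [t0 pt]; rewrite leNgt; apply/negP => t1.
  have := gen_nonincreasing gen (ltW t0) (ltW t1).
  by rewrite pt (gen_normalized gen) leNgt invr_gt0 ltr0n.
have a0 : 0 < a by exact: lt_le_trans a1.
have pa : psi a = 0.
  apply/eqP; rewrite -normr_le0; apply/ler_addgt0Pr => r r0; rewrite add0r.
  have [h0 h00 h0P] := cvx_rcont cpsi a0 r0.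
  have [t [t0 pt] ta] := inf_adherent h00 Zi.
  have ph : psi (a + h0) = 0.
    apply/eqP; rewrite eq_le; apply/andP; split; last first.
      by apply: (gen_ge0 gen); rewrite addr_ge0// ltW.
    by rewrite -pt; apply: (gen_nonincreasing gen); exact: ltW.
  by have := h0P h0 (ltW h00) (lexx _); rewrite ph subr0.
have ma : mder m psi a = 0 by exact: (@mder_zero _ a).
have /cvgrPdist_le/(_ e e0)[r /= r0 rP] := mder_continuous kp a0.
pose k := Num.min (r / 2) (a / 2).
have k0 : 0 < k by rewrite lt_min !divr_gt0.
have kr : k <= r / 2 by rewrite ge_min lexx.
have ka : k <= a / 2 by rewrite ge_min lexx orbT.
have ak0 : 0 < a - k by lra.
exists (a - k); split => //.
  rewrite lt_neqAle (gen_ge0 gen) ?andbT; last exact: ltW.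
  apply/eqP => pk; have : a <= a - k by apply: ge_inf; [exact: Zi.2|split].
  by lra.
have := rP (a - k); rewrite /= opprB addrCA subrr addr0 (gtr0_norm k0).
have kr' : k < r by lra.
move=> /(_ kr').
by rewrite ma sub0r normrN; apply: le_trans; exact: ler_norm.
Qed.

End vanish.

Section convergence.
Variables (psi_ : nat -> R -> R) (psi : R -> R).

(** Induction on the order: for intermediate orders every point is a
    continuity point, so the derivatives converge pointwise and [cvg_ld] gives
    the next order. *)
Lemma cvg_mder m (z_ : nat -> R) (z : R) :
  (forall n, kmono (m + 2) (psi_ n)) -> kmono (m + 2) psi ->
  (forall t : R, 0 < t -> psi_ n t @[n --> \oo] --> psi t) ->
  0 < z -> z_ n @[n --> \oo] --> z -> {for z, continuous (mder m.+1 psi)} ->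
  mder m.+1 (psi_ n) (z_ n) @[n --> \oo] --> mder m.+1 psi z.
Proof.
elim: m z_ z => [|m IH] z_ z kp_ kp pp z0 zz cz.
  have c_ n : cvx (psi_ n) := mder_cvx (kp_ n).
  have c : cvx psi := mder_cvx kp.
  by apply: cvgN; apply: (cvg_ld c_ c pp z0 zz); apply/(@ld_continuousP 0).
have c_ n : cvx (mder m.+1 (psi_ n)) := mder_cvx (kp_ n).
have c : cvx (mder m.+1 psi) := mder_cvx kp.
have pp' t : 0 < t -> mder m.+1 (psi_ n) t @[n --> \oo] --> mder m.+1 psi t.
  move=> t0; have kp' : kmono (m + 2) psi by apply: kmonoW kp; rewrite addSn.
  apply: (IH (fun=> t)) => //.
  - by move=> n; apply: kmonoW (kp_ n); rewrite addSn.
  - exact: cvg_cst.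
  - exact: mder_continuous.
by apply: cvgN; apply: (cvg_ld c_ c pp' z0 zz); apply/ld_continuousP.
Qed.

End convergence.

End mder.

(** * Recovering generators from their derivatives *)

Section convex_ftc.
Context {R : realType}.
Local Notation ld := left_derivative.
Local Notation mu := (@lebesgue_measure R).
Variable f : R -> R.
Hypotheses (cf : cvx f) (fni : forall u v : R, 0 < u -> u <= v -> f v <= f u).

Let q (t : R) : R := - ld f t.

Let muE (b : R) (x y : R) : 0 < x -> x <= y -> y < b -> mu `]x, y]%classic = (y - x)%:E.
Proof.
move=> x0 xy yb; rewrite lebesgue_measure_itv/= lte_fin.
by move: xy; rewrite le_eqVlt => /predU1P[->|->//]; rewrite ltxx subrr.
Qed.

Let q_ge0 (t : R) : 0 < t -> 0 <= q t.
Proof.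
move=> t0; rewrite oppr_ge0.
have tt : t < t + 1 by rewrite ltrDl.
have := cvx_ld_le cf t0 tt.
rewrite addrAC subrr add0r mulr1 => /le_trans; apply.
by rewrite subr_le0 fni// ltW.
Qed.

Let q_ni (x y : R) : 0 < x -> x <= y -> q y <= q x.
Proof. by move=> x0 xy; rewrite lerN2; exact: cvx_ld_nd. Qed.

Let Gb (x y : R) : 0 < x -> x < y -> 1 * q y * (y - x) <= - f y - - f x <= 1 * q x * (y - x).
Proof.
move=> x0 xy; have := cvx_ld_le cf x0 xy; have := cvx_ld_ge cf x0 xy.
by rewrite /q => *; apply/andP; split; lra.
Qed.

Lemma measurable_ld_on (a b : R) : 0 < a -> measurable_fun `]a, b]%classic (ld f).
Proof.
move=> a0; apply: nondecreasing_on_measurable; first exact: interval_is_interval.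
move=> x y; rewrite /= !in_itv/= => /andP[ax _] _; apply: cvx_ld_nd => //.
exact: lt_trans ax.
Qed.

(** The case p = 1, q = - ld f, G = - f of [product_Rintegral]. *)
Lemma convex_ftc (a b : R) : 0 < a -> a <= b ->
  \int[mu]_(t in `]a, b]) (- ld f t) = f a - f b.
Proof.
move=> a0 ab; have := @product_Rintegral R mu 0 (b + 1) (cst 1) q (- f)
   (@muE (b + 1)) (fun _ _ _ => ler01) (fun t h _ => q_ge0 h)
   (fun _ _ _ _ _ => lexx _) (fun x y h h' _ => q_ni h h') (fun x y h h' _ => Gb h h')
   a b a0 ab.
rewrite ltrDl => /(_ ltr01).
under eq_Rintegral do rewrite mul1r.
by move=> ->; rewrite /= opprK addrC.
Qed.

End convex_ftc.

Section v_equiv.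
Context {R : realType}.
Local Notation ld := left_derivative.
Variables (psi_ : nat -> R -> R) (psi : R -> R).
Hypotheses (gen_ : forall n, is_generator (psi_ n)) (gen : is_generator psi).
Hypotheses (c_ : forall n, cvx (psi_ n)) (c : cvx psi).

Let pni p : is_generator p -> forall u v : R, 0 < u -> u <= v -> p v <= p u.
Proof. by move=> gp u v /ltW u0; exact: gen_nonincreasing. Qed.

(** A generator decreases by at most 1 on [a / 2, t], and its slope on this
    interval is at least as steep as at t. *)
Let ld_bound p (a t : R) : is_generator p -> cvx p -> 0 < a -> a < t -> `|ld p t| <= 2 / a.
Proof.
move=> gp cp a0 at_; have t0 := lt_trans a0 at_.
have a20 : 0 < a / 2 by rewrite divr_gt0.
have at2 : a / 2 < t by apply: lt_trans at_; rewrite ltr_pdivrMr// ltr_pMr// ltr1n.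
have := cvx_ld_ge cp a20 at2; have tt : t < t + 1 by rewrite ltrDl.
have := cvx_ld_le cp t0 tt; rewrite addrAC subrr add0r mulr1.
have := pni gp t0 (ltW tt).
have := gen_le1 gp (ltW a20); have := gen_ge0 gp (ltW t0).
move=> p1 p2 p3 H1 H2.
have l0 : ld p t <= 0 by lra.
rewrite ler0_norm// ler_pdivlMr//.
have K : - ld p t * (t - a / 2) <= 1 by lra.
have : - ld p t * (a / 2) <= - ld p t * (t - a / 2).
  by apply: ler_wpM2l; [rewrite oppr_ge0|lra].
by lra.
Qed.

(** All generators have the value 1/2 at 1, so the increments between 1 and z
    determine psi_n z. They are integrals of left derivatives, which converge
    off a countable set and are bounded by 2 / a on ]a, +oo[. *)
Lemma cvg_of_ld : (forall z : R, 0 < z -> {for z, continuous (ld psi)} ->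
    ld (psi_ n) z @[n --> \oo] --> ld psi z) ->
  forall z : R, 0 < z -> psi_ n z @[n --> \oo] --> psi z.
Proof.
move=> H.
have key (a b : R) : 0 < a -> a <= b -> (psi_ n a - psi_ n b) @[n --> \oo] --> psi a - psi b.
  move=> a0 ab; rewrite -(convex_ftc c (pni gen) a0 ab).
  have -> : (fun n => psi_ n a - psi_ n b) =
      (fun n => \int[lebesgue_measure]_(t in `]a, b]) (- ld (psi_ n) t)).
    by apply/funext => n; rewrite (convex_ftc (c_ n) (pni (gen_ n)) a0 ab).
  apply: (@Rintegral_bounded_cvg _ _ _ _ _ _ _ (2 / a)) => //.
  - rewrite [ltLHS]lebesgue_measure_itv/=; case: ifP => _ //; exact: ltry.
  - by move=> n; apply: measurable_funN; exact: measurable_ld_on.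
  - by apply: measurable_funN; exact: measurable_ld_on.
  - have dc : countable [set z : R | 0 < z /\ ~ {for z, continuous (fun z => - ld psi z)}].
      by apply: nonincreasing_discontinuities => u v u0 uv; rewrite lerN2 cvx_ld_nd.
    exists [set z : R | 0 < z /\ ~ {for z, continuous (fun z => - ld psi z)}]; split.
    + exact: countable_measurable.
    + exact: countable_lebesgue_measure0.
    + move=> t /= /not_implyP[]; rewrite in_itv/= => /andP[at_ _] nc.
      split; first exact: lt_trans at_.
      move=> ct; apply: nc; apply: cvgN; apply: H; first exact: lt_trans at_.
      have -> : ld psi = fun z => - (- ld psi z) by apply/funext => z; rewrite opprK.
      exact: continuousN.
  - move=> n t /=; rewrite in_itv/= normrN => /andP[at_ _].
    exact: ld_bound.
have one n : psi_ n 1 = psi 1 by rewrite !gen_normalized.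
move=> z z0; have [z1|z1] := leP z 1.
  rewrite -(subrK (psi 1) (psi z)).
  have -> : (fun n => psi_ n z) = (fun n => (psi_ n z - psi_ n 1) + psi 1).
    by apply/funext => n; rewrite one subrK.
  by apply: cvgD; [exact: key|exact: cvg_cst].
have -> : psi z = psi 1 - (psi 1 - psi z) by ring.
have -> : (fun n => psi_ n z) = (fun n => psi 1 - (psi_ n 1 - psi_ n z)).
  by apply/funext => n; rewrite one; ring.
by apply: cvgB; [exact: cvg_cst|apply: key => //; exact: ltW].
Qed.

End v_equiv.

Section v_statement.
Context {R : realType}.
Local Notation ld := left_derivative.
Variables (psi_ : nat -> R -> R) (psi : R -> R) (d : nat).
Hypotheses (gen_ : forall n, is_generator (psi_ n)) (gen : is_generator psi).
Hypotheses (k_ : forall n, kmono d.+2 (psi_ n)) (k : kmono d.+2 psi).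

Let v := (forall m, (1 <= m <= d)%N -> forall z : R, 0 < z ->
       derive1n m (psi_ n) z @[n --> \oo] --> derive1n m psi z) /\
    (forall z : R, 0 < z ->
       {for z, continuous (left_derivative (derive1n d psi))} ->
       left_derivative (derive1n d (psi_ n)) z @[n --> \oo]
         --> left_derivative (derive1n d psi) z).

Let c_ n : cvx (psi_ n). Proof. exact: kmono_cvx (k_ n). Qed.
Let c : cvx psi. Proof. exact: kmono_cvx k. Qed.

Let ld_cont (z : R) : 0 < z -> {for z, continuous (ld (derive1n d psi))} <->
  {for z, continuous (mder d.+1 psi)}.
Proof.
move=> z0; rewrite -ld_continuousP; split => H.
  have E : \forall t \near z, (-1) ^+ d * ld (derive1n d psi) t = ld (mder d psi) t.
    near=> t; have t0 : 0 < t by near: t; exact: lt_nbhsr.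
    rewrite ld_derive1n//; last by rewrite addn2.
    by rewrite mulrA -exprD addnn -signr_odd odd_double expr0 mul1r.
  rewrite /prop_for /continuous_at.
  rewrite -(nbhs_singleton E).
  have : (-1) ^+ d * ld (derive1n d psi) t @[t --> z] --> (-1) ^+ d * ld (derive1n d psi) z.
    exact: cvgMl_tmp.
  by apply: cvg_trans; apply: near_eq_cvg.
have E : \forall t \near z, (-1) ^+ d * ld (mder d psi) t = ld (derive1n d psi) t.
  near=> t; have t0 : 0 < t by near: t; exact: lt_nbhsr.
  by rewrite ld_derive1n// addn2.
rewrite /prop_for /continuous_at.
rewrite -(nbhs_singleton E).
have : (-1) ^+ d * ld (mder d psi) t @[t --> z] --> (-1) ^+ d * ld (mder d psi) z.
  exact: cvgMl_tmp.
by apply: cvg_trans; apply: near_eq_cvg.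
Unshelve. all: by end_near. Qed.

Lemma derivatives_of_cvg : (forall z : R, 0 < z -> psi_ n z @[n --> \oo] --> psi z) -> v.
Proof.
move=> pp; split.
  move=> m /andP[m1 md] z z0.
  have km_ n : kmono (m + 2) (psi_ n) by apply: kmonoW (k_ n); rewrite addn2 !ltnS.
  have km : kmono (m + 2) psi by apply: kmonoW k; rewrite addn2 !ltnS.
  rewrite derive1n_mder//; under eq_fun do rewrite derive1n_mder//.
  apply: cvgMl_tmp; case: m m1 md km_ km => // m _ md km_ km.
  apply: (@cvg_mder _ _ _ _ (fun=> z)) => //.
  - by move=> n; apply: kmonoW (km_ n); rewrite addSn.
  - by apply: kmonoW km; rewrite addSn.
  - exact: cvg_cst.
  - exact: mder_continuous.
move=> z z0 /(ld_cont z0) cz.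
have k2_ n : kmono (d + 2) (psi_ n) by rewrite addn2.
have k2 : kmono (d + 2) psi by rewrite addn2.
rewrite ld_derive1n//; under eq_fun do rewrite ld_derive1n//.
apply: cvgMl_tmp; rewrite ldE; under eq_fun do rewrite ldE.
by apply: cvgN; apply: (@cvg_mder _ _ _ _ (fun=> z)) => //; exact: cvg_cst.
Qed.

(** The left derivative of psi is given by the second part of the hypothesis
    if d = 0, and by the first part with m = 1 if d > 0. *)
Lemma cvg_of_derivatives : v -> forall z : R, 0 < z -> psi_ n z @[n --> \oo] --> psi z.
Proof.
move=> [v1 v2]; apply: cvg_of_ld => // z z0 cz.
have [d0|d0] := posnP d.
  by move: v2; rewrite d0; apply.
have := v1 1%N; rewrite d0 => /(_ isT z z0).
have k3_ n : kmono (1 + 2) (psi_ n) by apply: kmonoW (k_ n); rewrite addn2 !ltnS.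
have k3 : kmono (1 + 2) psi by apply: kmonoW k; rewrite addn2 !ltnS.
rewrite derive1n_mder//; under eq_fun do rewrite derive1n_mder//.
rewrite expr1 mulN1r; under eq_fun do rewrite mulN1r.
have E p : ld p z = - mder 1 p z by rewrite mderS opprK.
by rewrite E; under [in X in _ -> X]eq_fun do rewrite E.
Qed.

End v_statement.

(** * Uniform convergence on the cube *)

Section uniform_on_cube.
Context {R : realType}.

Lemma cvg_sup0P (S : nat -> set R) :
  (forall n, has_sup (S n)) -> (forall n s, S n s -> 0 <= s) ->
  sup (S n) @[n --> \oo] --> 0 <->
  (forall e, 0 < e -> \forall n \near \oo, forall s, S n s -> s <= e).
Proof.
move=> hS S0; split=> [/cvgrPdist_le H e e0|H].
  apply: filterS (H e e0) => n; rewrite sub0r normrN => He s Ss.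
  apply: le_trans He; apply: le_trans (ler_norm _).
  by apply: ub_le_sup => //; exact: (hS n).2.
apply/cvgrPdist_le => e e0; apply: filterS (H e e0) => n He.
rewrite sub0r normrN ger0_norm.
  by apply: ge_sup => //; exact: (hS n).1.
have [s Ss] := (hS n).1; apply: le_trans (S0 _ _ Ss) _.
by apply: ub_le_sup => //; exact: (hS n).2.
Qed.

(** The cells ]k / N, (k + 1) / N] are closed on the right, the first one
    including 0, so that comparing x with the grid amounts to comparing
    indices. *)
Lemma cell_index (x : R) N : 0 <= x <= 1 -> exists k : 'I_N.+1,
  (forall j, (x <= j.+1%:R / N.+1%:R) = (k <= j)%N) /\ `|x - k.+1%:R / N.+1%:R| <= N.+1%:R^-1.
Proof.
move=> /andP[x0 x1]; have N0 : 0 < N.+1%:R :> R by [].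
have ex : exists j, x <= j.+1%:R / N.+1%:R by exists N; rewrite divff// gt_eqF.
have [k kP kmin] := ex_minnP ex.
have kN : (k < N.+1)%N by rewrite ltnS; apply: kmin; rewrite divff// gt_eqF.
exists (Ordinal kN); split=> [j|/=].
  apply/idP/idP => [/kmin//|kj]; apply: le_trans kP _.
  by rewrite ler_pM2r ?invr_gt0// ler_nat.
rewrite ler0_norm ?subr_le0// opprB lerBlDl -lerBlDr.
rewrite -[X in _ - X]mul1r -mulrBl -natr1 addrK.
case: k kP kmin {kN} => [|k] _ kmin; first by rewrite mul0r.
by rewrite leNgt; apply/negP => /ltW /kmin; rewrite ltnn.
Qed.

(** A common Lipschitz constant reduces uniformity to a finite grid, whose
    points can be taken off the lower faces of the cube, where phi may be
    infinite. *)
Lemma lipschitz_uniform_cube m (F : nat -> m.-tuple R -> R) (L : R) :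
  (forall n x y, cube m x -> cube m y ->
     `|F n x - F n y| <= L * \sum_(i < m) `|tnth x i - tnth y i|) ->
  (forall x, (forall i, 0 < tnth x i <= 1) -> F n x @[n --> \oo] --> 0) ->
  forall e, 0 < e -> \forall n \near \oo, forall x, cube m x -> `|F n x| <= e.
Proof.
move=> FL Fc e e0.
pose N := (Num.truncn (2 * `|L| * m%:R / e)).+1.
have N0 : 0 < N%:R :> R by rewrite ltr0n.
have NL : `|L| * (m%:R / N%:R) <= e / 2.
  have H : 2 * `|L| * m%:R / e < N%:R.
    have h : 0 <= 2 * `|L| * m%:R / e by apply: divr_ge0; [rewrite !mulr_ge0|exact: ltW].
    by have /andP[] := truncn_itv h.
  rewrite mulrA ler_pdivrMr//; move: H; rewrite ltr_pdivrMr// => H.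
  by lra.
pose g (k : {ffun 'I_m -> 'I_N}) : m.-tuple R := [tuple (k i).+1%:R / N%:R | i < m].
have g01 k i : 0 < tnth (g k) i <= 1.
  by rewrite tnth_mktuple divr_gt0//= ler_pdivrMr// mul1r ler_nat.
have Hn : \forall n \near \oo, forall k, `|F n (g k)| <= e / 2.
  apply: filter_forall => k.
  have /cvgrPdist_le/(_ (e / 2)) := Fc (g k) (g01 k).
  rewrite divr_gt0// => /(_ isT); apply: filterS => n.
  by rewrite sub0r normrN.
apply: filterS Hn => n Hn x cx.
have ex (i : 'I_m) : exists k : 'I_N, `|tnth x i - k.+1%:R / N%:R| <= N%:R^-1.
  by have [k [_ kP]] := cell_index (Num.truncn (2 * `|L| * m%:R / e)) (cx i); exists k.
have [k kP] := choice ex.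
pose kf := [ffun i => k i].
have cg : cube m (g kf) by move=> i; have /andP[a b] := g01 kf i; rewrite (ltW a).
have := FL n x (g kf) cx cg.
have S : \sum_(i < m) `|tnth x i - tnth (g kf) i| <= m%:R / N%:R.
  apply: (@le_trans _ _ (\sum_(i < m) N%:R^-1)).
    by apply: ler_sum => i _; rewrite tnth_mktuple ffunE; exact: kP.
  by rewrite sumr_const card_ord mulr_natl.
move=> A; have {A} : `|F n x - F n (g kf)| <= e / 2.
  apply: le_trans A _; apply: le_trans NL.
  apply: (@le_trans _ _ (`|L| * \sum_(i < m) `|tnth x i - tnth (g kf) i|)).
    by rewrite ler_wpM2r ?ler_norm// sumr_ge0.
  by rewrite ler_wpM2l.
move=> A; rewrite -(subrK (F n (g kf)) (F n x)).
apply: le_trans (ler_normD _ _) _; have := Hn kf; lra.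
Qed.

End uniform_on_cube.

Section box_strips.
Context {R : realType} (m : nat) (mu : {measure set (m.-tuple R) -> \bar R}).
Local Open Scope ereal_scope.

Definition strip (i : 'I_m) (a b : R) : set (m.-tuple R) :=
  [set t | (`](Num.min a b), (Num.max a b)]%classic : set R) (tnth t i)].

Lemma measurable_strip i a b : measurable (strip i a b).
Proof. by rewrite -[X in measurable X]setTI; exact: (measurable_tnth i). Qed.

(** A point of [box y] outside [box z] has a coordinate between the
    corresponding coordinates of z and y. *)
Lemma measure_box_strip y z :
  mu (box y) <= mu (box z) + \sum_(i < m) mu (strip i (tnth y i) (tnth z i)).
Proof.
(* The strips are numbered after the box for use in the union bound. *)
pose A k := if k isn't k'.+1 then box z else
  if insub k' is Some i then strip i (tnth y i) (tnth z i) else set0.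
have AE (i : 'I_m) : A i.+1 = strip i (tnth y i) (tnth z i) by rewrite /A valK.
have mA k : measurable (A k).
  rewrite /A; case: k => [|k]; first exact: measurable_box.
  by case: insub => [i|]; [exact: measurable_strip|exact: measurable0].
apply: (@le_trans _ _ (mu (\big[setU/set0]_(k < m.+1) A k))).
  apply: le_measure; rewrite ?inE.
  - exact: measurable_box.
  - by apply: bigsetU_measurable => i _; exact: mA.
  move=> t ty; rewrite -bigcup_mkord.
  case: (pselect (box z t)) => [|nz]; first by exists 0%N.
  move/existsNP : nz => [i /negP]; have /andP[t0 ti] := ty i.
  rewrite t0/= -ltNge => zi; exists i.+1; first by rewrite /= ltnS ltn_ord.
  by rewrite AE /strip /= in_itv/= gt_min zi orbT /= le_max ti.
apply: le_trans (Boole_inequality _ _) _; first by move=> i _; exact: mA.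
by rewrite big_ord_recl; under eq_bigr do rewrite AE.
Qed.

End box_strips.

(** * Uniform convergence of copulas *)

Section copula_basics.
Context {R : realType} (d : nat).
Implicit Types (C : @copula R d) (x y : d.-tuple R).

Lemma lambda1_le (a b : R) : a <= b -> (@lambda1 R `]a, b]%classic <= (b - a)%:E)%E.
Proof.
move=> ab; rewrite /lambda1 /mrestr.
apply: (@le_trans _ _ (lebesgue_measure (`]a, b]%classic : set R))).
  by apply: le_measure; rewrite ?inE//; exact: measurableI.
rewrite lebesgue_measure_itv/= lte_fin; case: ifPn => // _.
by rewrite lee_fin subr_ge0.
Qed.

Lemma max_minE (a b : R) : Num.max a b - Num.min a b = `|a - b|.
Proof.
have [ab|ab] := leP a b; first by rewrite ler0_norm ?subr_le0// opprB.
by rewrite gtr0_norm ?subr_gt0.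
Qed.

Lemma cop_strip C i (a b : R) : (cop_measure C (strip i a b) <= `|a - b|%:E)%E.
Proof.
rewrite /strip (cop_uniform C i (A := `](Num.min a b), (Num.max a b)]%classic))//.
by rewrite -max_minE; apply: lambda1_le; case: (leP a b) => // /ltW.
Qed.

Lemma cop_lip C x y : cube d x -> cube d y ->
  `|C x - C y| <= \sum_(i < d) `|tnth x i - tnth y i|.
Proof.
move=> cx cy.
have key u v : cube d u -> cube d v -> C u - C v <= \sum_(i < d) `|tnth u i - tnth v i|.
  move=> cu cv; rewrite lerBlDl -lee_fin EFinD -!cop_df//.
  apply: le_trans (measure_box_strip _ u v) _; rewrite leeD2l//.
  by rewrite -sumEFin; apply: lee_sum => i _; exact: cop_strip.
rewrite ler_norml; apply/andP; split; last exact: key.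
rewrite lerNl opprB; apply: le_trans (key y x cy cx) _.
by apply: ler_sum => i _; rewrite distrC.
Qed.

Lemma cop01 C x : cube d x -> 0 <= C x <= 1.
Proof.
move=> cx; rewrite -!lee_fin -(cop_df C cx) measure_ge0/=.
exact: probability_le1 (measurable_box _).
Qed.

End copula_basics.

Section uniform_convergence.
Context {R : realType}.

Lemma d_infty_cvgP m (A_ : nat -> m.-tuple R -> R) (A : m.-tuple R -> R) :
  (forall n x, cube m x -> 0 <= A_ n x <= 1) -> (forall x, cube m x -> 0 <= A x <= 1) ->
  d_infty (A_ n) A @[n --> \oo] --> 0 <->
  (forall e, 0 < e -> \forall n \near \oo, forall x, cube m x -> `|A_ n x - A x| <= e).
Proof.
move=> A_01 A01.
have hs n : has_sup [set `|A_ n x - A x| | x in cube m].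
  split.
    exists `|A_ n [tuple 0 | i < m] - A [tuple 0 | i < m]|.
    by exists [tuple 0 | i < m] => // i; rewrite tnth_mktuple lexx ler01.
  exists 1 => _ [x cx <-]; have /andP[a b] := A_01 n x cx; have /andP[a' b'] := A01 x cx.
  by rewrite ler_norml; apply/andP; split; lra.
have h0 n s : [set `|A_ n x - A x| | x in cube m] s -> 0 <= s by move=> [x _ <-].
apply: iff_trans (cvg_sup0P hs h0) _; split => H e e0; apply: filterS (H e e0) => n.
  by move=> K x cx; apply: K; exists x.
by move=> K _ [x cx <-]; exact: K.
Qed.

Lemma copula_cvg_pointwise d (C_ : nat -> @copula R d) (C : copula d) :
  d_infty (C_ n) C @[n --> \oo] --> 0 <->
  (forall x, (forall i, 0 < tnth x i <= 1) -> C_ n x @[n --> \oo] --> C x).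
Proof.
apply: iff_trans (d_infty_cvgP (fun n => @cop01 _ _ (C_ n)) (@cop01 _ _ C)) _; split => H.
  move=> x x01; apply/cvgrPdist_le => e e0; apply: filterS (H e e0) => n K.
  by rewrite distrC; apply: K => i; have /andP[a b] := x01 i; rewrite ltW.
apply: (@lipschitz_uniform_cube R d (fun n x => C_ n x - C x) 2).
- move=> n x y cx cy.
  have -> : C_ n x - C x - (C_ n y - C y) = (C_ n x - C_ n y) - (C x - C y) by ring.
  apply: le_trans (ler_normB _ _) _.
  by have := cop_lip (C_ n) cx cy; have := cop_lip C cx cy; lra.
- move=> x x01; rewrite -(subrr (C x)); apply: cvgB; last exact: cvg_cst.
  exact: H.
Qed.

Definition put2 d (i j : 'I_d) (x : 2.-tuple R) : d.-tuple R :=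
  [tuple if k == i then tnth x ord0 else if k == j then tnth x ord_max else 1 | k < d].

Lemma put2_cube d (i j : 'I_d) x : cube 2 x -> cube d (put2 i j x).
Proof.
move=> cx k; rewrite tnth_mktuple; case: ifP => // _; case: ifP => // _.
by rewrite ler01 lexx.
Qed.

Lemma d_infty_marginal2 d (C_ : nat -> @copula R d) (C : copula d) (i j : 'I_d) :
  d_infty (C_ n) C @[n --> \oo] --> 0 ->
  d_infty (marginal2 (C_ n) i j) (marginal2 C i j) @[n --> \oo] --> 0.
Proof.
move=> /(d_infty_cvgP (fun n => @cop01 _ _ (C_ n)) (@cop01 _ _ C)) H.
have H1 n x : cube 2 x -> 0 <= marginal2 (C_ n) i j x <= 1.
  by move=> cx; apply: cop01; exact: (put2_cube i j cx).
have H2 x : cube 2 x -> 0 <= marginal2 C i j x <= 1.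
  by move=> cx; apply: cop01; exact: (put2_cube i j cx).
apply/(d_infty_cvgP H1 H2) => e e0; apply: filterS (H e e0) => n K x cx.
by apply: K; exact: (put2_cube i j cx).
Qed.

Section archimedean.
Variables (d : nat) (C_ : nat -> @copula R d) (C : @copula R d).
Variables (psi_ : nat -> R -> R) (psi : R -> R).
Hypotheses (gen_ : forall n, is_generator (psi_ n)) (gen : is_generator psi).
Hypotheses (arch_ : forall n, archimedean (C_ n) (psi_ n)) (arch : archimedean C psi).

Lemma arch_put2 D p (i j : 'I_d) (u v : R) : is_generator p -> @archimedean R d D p ->
  i != j -> 0 <= u -> 0 <= v -> D (put2 i j [tuple p u; p v]) = p (u + v).
Proof.
move=> gp ap ij u0 v0.
pose w (k : nat) : R := if k == i then u else if k == j then v else 0.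
have w0 k : 0 <= w k by rewrite /w; case: ifP => // _; case: ifP.
have -> : put2 i j [tuple p u; p v] = [tuple p (w k) | k < d].
  apply: eq_from_tnth => k; rewrite !tnth_mktuple /w !(tnth_nth 0)/= -!val_eqE.
  by case: ifP => // _; case: ifP => // _; rewrite gen_at0.
rewrite (archE gp ap) => [|k _]; last exact: w0.
congr (p _); rewrite (bigD1 i)//= (bigD1 j) 1?eq_sym//= big1 ?addr0.
  by rewrite /w eqxx eq_sym val_eqE (negbTE ij) eqxx.
by move=> k /andP[ki kj]; rewrite /w !val_eqE (negbTE ki) (negbTE kj).
Qed.

(** In the coordinates psi u and psi v a bivariate marginal is psi (u + v). *)
Lemma phir_of_bivariate (i j : 'I_d) : i != j ->
  (forall x : 2.-tuple R, cube 2 x -> C_ n (put2 i j x) @[n --> \oo] --> C (put2 i j x)) ->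
  forall x, 0 < x <= 1 -> phir (psi_ n) x @[n --> \oo] --> phir psi x.
Proof.
move=> ij Cc; apply: dense_phir => //.
have c2 (x y : R) : 0 <= x <= 1 -> 0 <= y <= 1 -> cube 2 [tuple x; y].
  move=> x01 y01 k; rewrite (tnth_nth 0); case: k => -[|[|//]] /= _ //.
apply: (@bivariate_dense _ _ _ gen_ gen (fun n x y => C_ n (put2 i j [tuple x; y]))
  (fun x y => C (put2 i j [tuple x; y]))).
- by move=> n u v u0 v0; exact: arch_put2.
- by move=> u v u0 v0; exact: arch_put2.
- move=> n x y x' y' x0 y0 x0' y0'.
  apply: le_trans (cop_lip _ _ _) _; [exact/put2_cube/c2|exact/put2_cube/c2|].
  rewrite (bigD1 i)//= (bigD1 j) 1?eq_sym//= big1 ?addr0.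
    by rewrite !tnth_mktuple (eqxx i) (eq_sym j i) (negbTE ij) (eqxx j) !(tnth_nth 0).
  move=> k /andP[ki kj]; rewrite !tnth_mktuple (negbTE ki) (negbTE kj).
  by rewrite subrr normr0.
- by move=> x y x0 y0; apply: Cc; exact: c2.
Qed.

Lemma copula_of_phir :
  (forall x, 0 < x <= 1 -> phir (psi_ n) x @[n --> \oo] --> phir psi x) ->
  forall x, (forall i, 0 < tnth x i <= 1) -> C_ n x @[n --> \oo] --> C x.
Proof.
move=> pc x x01.
have CE D p : is_generator p -> @archimedean R d D p ->
    D x = p (\sum_(i < d) phir p (nth 1 x i)).
  move=> gp ap; rewrite -(archE gp ap (u := fun i => phir p (nth 1 x i))).
    congr (cop_fun D _); apply: eq_from_tnth => i; rewrite tnth_mktuple -tnth_nth psi_phir//.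
  move=> i id; apply: (phir_ge0 gp); have := x01 (Ordinal id); by rewrite (tnth_nth 1).
rewrite (CE _ _ gen arch); under eq_fun do rewrite (CE _ _ (gen_ _) (arch_ _)).
have x1 (i : 'I_d) : 0 < nth 1 x i <= 1 by rewrite -tnth_nth.
apply: (phir_cvg_moving gen_ gen pc).
- by move=> n; apply: sumr_ge0 => i _; exact: (phir_ge0 (gen_ n)).
- by apply: sumr_ge0 => i _; exact: (phir_ge0 gen).
- by apply: cvg_big => [|i _]; [exact: add_continuous|exact: pc].
Qed.

End archimedean.

End uniform_convergence.

(** * Measures determined by boxes *)

Section density_measure.
Context d (T : measurableType d) {R : realType} (mu : {measure set T -> \bar R}).
Variables (f : T -> \bar R) (mf : measurable_fun setT f) (f0 : forall x, (0 <= f x)%E).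
Local Open Scope ereal_scope.

Definition density_measure of measurable_fun setT f & (forall x, 0 <= f x) :=
  fun A : set T => \int[mu]_(x in A) f x.

Local Notation nu := (density_measure mf f0).

Let nu0 : nu set0 = 0. Proof. by rewrite /density_measure integral_set0. Qed.

Let nu_ge0 A : 0 <= nu A. Proof. by apply: integral_ge0. Qed.

Let nu_sigma_additive : semi_sigma_additive nu.
Proof.
move=> /= A mA tA mUA; rewrite /density_measure ge0_integral_bigcup//; last first.
  exact: measurable_funTS.
by apply: is_cvg_ereal_nneg_natsum_cond => n _ _; apply: integral_ge0.
Qed.

HB.instance Definition _ := isMeasure.Build _ _ _ nu nu0 nu_ge0 nu_sigma_additive.

End density_measure.

Section uniqueness.
Context {R : realType}.

(** The cube without its lower faces: it carries the mass of every copula, and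
    phi is finite on it. *)
Definition pcube n : set (n.-tuple R) := [set t | forall i, 0 < tnth t i <= 1].

Definition lower n (y : n.-tuple R) : set (n.-tuple R) := [set t | forall i, tnth t i <= tnth y i].

Lemma measurable_coord n (i : 'I_n) (A : set R) : measurable A ->
  measurable [set t : n.-tuple R | A (tnth t i)].
Proof. by move=> mA; rewrite -[X in measurable X]setTI; exact: (measurable_tnth i). Qed.

Lemma measurable_allcoord n (A : 'I_n -> set R) : (forall i, measurable (A i)) ->
  measurable [set t : n.-tuple R | forall i, A i (tnth t i)].
Proof.
move=> mA; rewrite (_ : mkset _ = \bigcap_(i in [set: 'I_n]) [set t | A i (tnth t i)]).
  apply: fin_bigcap_measurable => [|i _]; first exact: finite_finset.
  exact: measurable_coord.
by apply/seteqP; split => [t H i _|t H i] /=; [exact: H|exact: (H i I)].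
Qed.

Lemma measurable_pcube n : measurable (@pcube n).
Proof.
rewrite (_ : @pcube _ = [set t : n.-tuple R | forall i, (`]0, 1]%classic : set R) (tnth t i)]).
  by apply: (measurable_allcoord (A := fun=> `]0, 1]%classic)) => i.
by apply/seteqP; split => t H i; have := H i; rewrite /= in_itv.
Qed.

Lemma measurable_lower n (y : n.-tuple R) : measurable (lower y).
Proof.
rewrite (_ : lower _ = [set t : n.-tuple R | forall i, (`]-oo, (tnth y i)]%classic : set R) (tnth t i)]).
  by apply: (measurable_allcoord (A := fun i => `]-oo, tnth y i]%classic)) => i.
by apply/seteqP; split => t H i; have := H i; rewrite /= in_itv.
Qed.

Let G n : set (set (n.-tuple R)) := [set lower y | y in setT].

Let measurable_G n (A : set (n.-tuple R)) : measurable A -> <<s @G n >> A.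
Proof.
pose T := g_sigma_algebraType (@G n).
have mid : measurable_fun [set: T] (fun x : T => (x : n.-tuple R)).
  apply/measurable_fun_tnthP => i.
  apply: (measurability (@RGenOInfty.G R)) => [|/= _ [_] [r] -> <-].
    exact: RGenOInfty.measurableE.
  rewrite setTI (_ : _ @^-1` _ = ~` [set t : T | tnth (t : n.-tuple R) i <= r]); last first.
    by apply/seteqP; split=> t /=; rewrite in_itv/= andbT ltNge => /negP.
  apply: measurableC.
  rewrite (_ : mkset _ = \bigcup_k (lower [tuple if j == i then r else k%:R | j < n] : set T)).
    apply: bigcupT_measurable => k; apply: sub_sigma_algebra.
    by exists [tuple if j == i then r else k%:R | j < n].
  apply/seteqP; split => [t /= ti|t [k _ tk]]; last first.
    by have := tk i; rewrite tnth_mktuple eqxx.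
  pose M := \sum_(j < n) `|tnth (t : n.-tuple R) j|.
  exists (Num.truncn M).+1 => // j; rewrite tnth_mktuple; case: eqP => [->//|_].
  have M0 : 0 <= M by apply: sumr_ge0.
  have /andP[_ h] := truncn_itv M0.
  apply: le_trans (ler_norm _) _; apply: le_trans (ltW h).
  by rewrite /M (bigD1 j)//= lerDl sumr_ge0.
move=> mA; have := mid measurableT A mA; rewrite setTI; exact.
Qed.

(** Lower orthants form a pi-system generating the Borel sets, and their
    intersections with [pcube] are boxes up to null sets, or empty. *)
Lemma measure_unique_boxes n (m1 m2 : {measure set (n.-tuple R) -> \bar R}) :
  (m1 setT < +oo)%E -> m1 (~` @pcube n) = 0%E -> m2 (~` @pcube n) = 0%E ->
  (forall y, @pcube n y -> m1 (box y) = m2 (box y)) ->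
  forall A, measurable A -> m1 A = m2 A.
Proof.
move=> m1oo m10 m20 m12 A /measurable_G.
have mp := @measurable_pcube n.
have null (m : {measure set (n.-tuple R) -> \bar R}) B : m (~` @pcube n) = 0%E ->
    measurable B -> m B = m (B `&` @pcube n).
  move=> m0 mB; rewrite -[in LHS](setIT B) -(setUv (@pcube n)) setIUr.
  rewrite measureU//; last 3 first.
  - exact: measurableI.
  - by apply: measurableI => //; exact: measurableC.
  - by rewrite setIACA setICr setI0.
  rewrite [X in (_ + X)%E](_ : _ = 0%E) ?adde0//.
  apply/eqP; rewrite eq_le measure_ge0 andbT -m0; apply: le_measure; rewrite ?inE.
  - by apply: measurableI => //; exact: measurableC.
  - exact: measurableC.
  - exact: subIsetr.
pose g k : set (n.-tuple R) := lower [tuple k%:R | j < n].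
apply: (g_sigma_algebra_measure_unique (@G n) _ g).
- by move=> _ [y _ <-]; exact: measurable_lower.
- by move=> k; exists [tuple k%:R | j < n].
- rewrite -subTset => t _; pose M := \sum_(j < n) `|tnth t j|.
  exists (Num.truncn M).+1 => // j; rewrite tnth_mktuple.
  have M0 : 0 <= M by apply: sumr_ge0.
  have /andP[_ h] := truncn_itv M0.
  apply: le_trans (ler_norm _) _; apply: le_trans (ltW h).
  by rewrite /M (bigD1 j)//= lerDl sumr_ge0.
- move=> _ _ [y _ <-] [z _ <-].
  exists [tuple Num.min (tnth y i) (tnth z i) | i < n] => //.
  apply/seteqP; split => [t H|t [H1 H2] i]; last first.
    by rewrite tnth_mktuple le_min H1 H2.
  by split => i; have := H i; rewrite tnth_mktuple le_min => /andP[].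
- move=> _ [y _ <-].
  rewrite (null m1)//; last exact: measurable_lower.
  rewrite (null m2)//; last exact: measurable_lower.
  case: (pselect (forall i, 0 < tnth y i)) => [y0|]; last first.
    move=> /existsNP[i /negP]; rewrite -leNgt => yi.
    rewrite (_ : _ `&` _ = set0) ?measure0// -subset0 => t [/(_ i) ty /(_ i)/andP[]].
    by rewrite ltNge (le_trans ty yi).
  (* On the cube, truncating the corner of an orthant at 1 changes nothing. *)
pose y' := [tuple Num.min (tnth y i) 1 | i < n].
  have E : lower y `&` @pcube n = box y' `&` @pcube n.
    apply/seteqP; split => t [H1 H2]; split => // i; have /andP[a b] := H2 i.
      by rewrite tnth_mktuple (ltW a)/= le_min H1.
    by have := H1 i; rewrite tnth_mktuple le_min => /andP[_ /andP[]].
  rewrite E -(null m1)//; last exact: measurable_box.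
  rewrite -(null m2)//; last exact: measurable_box.
  apply: m12 => i; rewrite tnth_mktuple lt_min y0 ltr01/=.
  by rewrite ge_min lexx orbT.
- move=> k; apply: le_lt_trans m1oo; apply: le_measure; rewrite ?inE//.
  exact: measurable_lower.
Qed.

Lemma measure_unique_unit (m1 m2 : {measure set (measurableTypeR R) -> \bar R}) :
  (m1 setT < +oo)%E -> m1 (~` `]0, 1]%classic) = 0%E -> m2 (~` `]0, 1]%classic) = 0%E ->
  (forall y, 0 < y <= 1 -> m1 `[0, y]%classic = m2 `[0, y]%classic) ->
  forall A, measurable A -> m1 A = m2 A.
Proof.
move=> m1oo m10 m20 m12 A mA.
pose h (x : measurableTypeR R) : 1.-tuple R := [tuple x].
have mh : measurable_fun setT h.
  apply/measurable_fun_tnthP => i; rewrite [X in measurable_fun _ X](_ : _ = idfun); last first.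
    by apply/funext => x /=; rewrite (tnth_nth x) ord1.
  exact: measurable_id.
pose H : {mfun measurableTypeR R >-> 1.-tuple R} :=
  HB.pack h (isMeasurableFun.Build _ _ _ _ h mh).
have hA : h @^-1` [set t | A (tnth t ord0)] = A by [].
have hp : h @^-1` (@pcube 1) = `]0, 1]%classic.
  apply/seteqP; split => x /=; rewrite in_itv/=; first by move=> /(_ ord0).
  by move=> x01 i; rewrite (tnth_nth x) ord1.
rewrite -hA.
apply: (@measure_unique_boxes 1 (pushforward m1 H) (pushforward m2 H)) => //.
- by rewrite -[RHS]m10 -hp.
- by rewrite -[RHS]m20 -hp.
- move=> y y01.
  have E : h @^-1` (box y) = `[0, (tnth y ord0)]%classic.
    apply/seteqP; split => x /=; rewrite in_itv/=; first by move=> /(_ ord0).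
    by move=> x01 i; rewrite ord1 (tnth_nth x).
  have := m12 (tnth y ord0) (y01 ord0); rewrite -E; exact.
- exact: measurable_coord.
Qed.

End uniqueness.

(** * Densities of Archimedean marginals *)

Section ext0.
Context {R : realType}.

(** Extension by 0 makes functions that are meaningful only on an interval
    globally measurable. *)
Definition ext0 (D : set R) (f : R -> R) (t : R) : R := f t * \1_D t.

Lemma ext0_in (D : set R) f t : D t -> ext0 D f t = f t.
Proof. by move=> Dt; rewrite /ext0 indicE mem_set// mulr1. Qed.

Lemma ext0_out (D : set R) f t : ~ D t -> ext0 D f t = 0.
Proof. by move=> Dt; rewrite /ext0 indicE memNset// mulr0. Qed.

Lemma ext0_ge0 (D : set R) f t : (forall u, D u -> 0 <= f u) -> 0 <= ext0 D f t.
Proof.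
move=> f0; case: (pselect (D t)) => Dt; first by rewrite ext0_in// f0.
by rewrite ext0_out.
Qed.

Lemma measurable_ext0 (D : set R) f : measurable D -> measurable_fun D f ->
  measurable_fun setT (ext0 D f).
Proof.
move=> mD mf.
have -> : ext0 D f = (fun t => (f \_ D) t * \1_D t).
  apply/funext => t; rewrite /ext0 indicE patchE.
  by case: ifPn => // _; rewrite !mulr0.
by apply: measurable_funM => //; exact/(measurable_restrictT _ _).1.
Qed.

Lemma integral_indicM d (T : measurableType d) (mu : {measure set T -> \bar R})
    (D : set T) (f : T -> R) :
  (\int[mu]_(t in D) (f t)%:E = \int[mu]_t (f t * \1_D t)%:E)%E.
Proof.
rewrite integral_mkcond; apply: eq_integral => t _.
by rewrite patchE indicE; case: ifPn => _; rewrite ?mulr1 ?mulr0.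
Qed.

End ext0.

Section density.
Context {R : realType}.
Variables (psi : R -> R).
Hypotheses (gen : is_generator psi) (cpsi : cvx psi).
Local Notation I01 := (`]0%R, 1%R[%classic : set R).
Local Notation Rp := (`]0%R, +oo[%classic : set R).

Definition phi0 := ext0 I01 (phir psi).
Definition qf0 := ext0 I01 (qf psi).

Lemma measurable_phi0 : measurable_fun setT phi0.
Proof.
apply: measurable_ext0 => //; apply: nonincreasing_on_measurable; first exact: interval_is_interval.
move=> x y; rewrite /= !in_itv/= => /andP[x0 x1] /andP[y0 y1].
rewrite le_eqVlt => /predU1P[->//|xy]; apply: ltW.
by apply: phir_mono => //; exact: ltW.
Qed.

Lemma measurable_qf0 : measurable_fun setT qf0.
Proof. by apply: measurable_ext0 => //; exact: measurable_qf. Qed.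

Lemma qf0_ge0 t : 0 <= qf0 t.
Proof.
apply: ext0_ge0 => u; rewrite /= in_itv/= => /andP[u0 u1].
by apply/ltW/qf_gt0.
Qed.

Definition mder0 k := ext0 Rp (mder k psi).

Lemma measurable_mder0 k : kmono (k + 1) psi -> measurable_fun setT (mder0 k).
Proof.
move=> kp; apply: measurable_ext0 => //; apply: nonincreasing_on_measurable.
  exact: interval_is_interval.
move=> x y; rewrite /= !in_itv/= !andbT => x0 _; exact: mder_ni.
Qed.

Lemma mder0_ge0 k t : kmono (k + 1) psi -> 0 <= mder0 k t.
Proof.
move=> kp; apply: ext0_ge0 => u; rewrite /= in_itv/= andbT => u0.
exact: mder_ge0.
Qed.

(** For k = 0 and s = 0, the density of the m-dimensional marginal. The
    general form is, up to a factor, its section after k more coordinates have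
    been fixed, s being the sum of phi over them; this is what an induction on
    m meets. *)
Definition dens k m s (t : m.-tuple R) : R :=
  mder0 (k + m) (s + \sum_(i < m) phi0 (tnth t i)) * \prod_(i < m) qf0 (tnth t i).

Lemma dens_ge0 k m s t : kmono (k + m + 1) psi -> 0 <= @dens k m s t.
Proof.
move=> kp; rewrite /dens mulr_ge0 ?mder0_ge0//.
by apply: prodr_ge0 => i _; exact: qf0_ge0.
Qed.

Lemma measurable_dens k m s : kmono (k + m + 1) psi -> measurable_fun setT (@dens k m s).
Proof.
move=> kp; apply: measurable_funM.
  apply: measurableT_comp; first exact: measurable_mder0.
  apply: measurable_funD => //; apply: measurable_sum => i.
  by apply: measurableT_comp (measurable_tnth i); exact: measurable_phi0.
apply: measurable_prod => i _.
by apply: measurableT_comp (measurable_tnth i); exact: measurable_qf0.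
Qed.

Lemma dens_cons k m s (x : R) (t : m.-tuple R) :
  dens k s [tuple of x :: t] = qf0 x * dens k.+1 (s + phi0 x) t.
Proof.
rewrite /dens !big_ord_recl tnth0 addSnnS addrA.
under eq_bigr do rewrite tnthS.
under [\prod_(i < m) _]eq_bigr do rewrite tnthS.
by rewrite mulrCA mulrA.
Qed.

Lemma lambda1_set1 (x : R) : @lambda1 R [set x] = 0%E.
Proof.
apply/eqP; rewrite eq_le measure_ge0 andbT /lambda1 /mrestr.
rewrite -(lebesgue_measure_set1 x); apply: le_measure; rewrite ?inE//.
exact: measurableI.
Qed.

Lemma gen_rcont0 e : 0 < e -> exists2 h0, 0 < h0 &
  forall h, 0 <= h -> h <= h0 -> `|psi 0 - psi (0 + h)| <= e.
Proof.
move=> e0; pose y := Num.max (1 - e) 2^-1.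
have y1 : y < 1 by rewrite gt_max gtrBl e0 invf_lt1// ltr1n.
have y0 : 0 < y by rewrite lt_max invr_gt0 ltr0n orbT.
have y01 : 0 < y < 1 by rewrite y0.
have y01' : 0 < y <= 1 by rewrite y0 ltW.
exists (phir psi y); first exact: phir_gt0.
move=> h h0 hy; rewrite add0r (gen_at0 gen) ger0_norm ?subr_ge0 ?gen_le1//.
have := gen_nonincreasing gen h0 hy; rewrite psi_phir//.
have : 1 - e <= y by rewrite le_max lexx.
lra.
Qed.

(** [kernel_integral] for the generator derivative of order k. The value s +
    phi x may be 0, namely for s = 0 and x = 1; right continuity at 0 is
    available for psi only, whence the alternative on s and k. *)
Lemma kernel_integral0 k s x1 : kmono (k + 2) psi -> (0 < s) \/ (0 <= s /\ k = 0%N) ->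
  0 < x1 <= 1 ->
  (\int[lambda1]_t (qf0 t * \1_(`[0, x1]%classic : set R) t * mder0 k.+1 (s + phi0 t))%:E =
   (mder k psi (s + phir psi x1))%:E)%E.
Proof.
move=> kp2 hs x1p.
have s0 : 0 <= s by case: hs => [/ltW|[]].
have kp1 : kmono (k + 1) psi by apply: kmonoW kp2; rewrite leq_add2l.
have kpS1 : kmono (k.+1 + 1) psi by rewrite addSnnS.
pose F t1 := qf0 t1 * \1_(`[0, x1]%classic : set R) t1 * mder0 k.+1 (s + phi0 t1).
have F0 t1 : 0 <= F t1.
  by rewrite /F; apply: mulr_ge0; [apply: mulr_ge0; rewrite ?qf0_ge0|exact: mder0_ge0].
have mF : measurable_fun setT F.
  apply: measurable_funM; first by apply: measurable_funM => //; exact: measurable_qf0.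
  apply: measurableT_comp; first exact: measurable_mder0.
  by apply: measurable_funD => //; exact: measurable_phi0.
have -> : (\int[lambda1]_t1 (F t1)%:E = \int[lambda1]_(t1 in setT `\` [set x1]) (F t1)%:E)%E.
  apply: ge0_negligible_integral => //; last exact: lambda1_set1.
  + exact/measurable_EFinP.
  + by move=> t _; rewrite lee_fin.
have K := @kernel_integral R psi (mder k psi) (s) gen cpsi s0 (mder_cvx kp2)
  (fun u v => mder_ni kp1) (fun u => mder_ge0 kp1) (fun e => mder_vanish gen kp2) x1 x1p.
rewrite -K.
  rewrite integral_indicM [RHS]integral_indicM; apply: eq_integral => t _; congr (_%:E).
  have [t1x|t1x] := eqVneq t x1.
    rewrite t1x [X in _ * X](_ : _ = 0) ?[in RHS](_ : \1__ _ = 0) ?mulr0//.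
      by rewrite indicE memNset//= in_itv/= ltxx andbF.
    by rewrite indicE memNset//= => -[_]; exact.
  rewrite [in LHS](_ : \1__ _ = 1) ?mulr1; last first.
    by rewrite indicE mem_set//=; split => // /eqP; rewrite (negbTE t1x).
  case: (pselect (`]0%R, x1[%classic t)) => tI; last first.
    rewrite [X in _ = _ * X](_ : _ = 0) ?mulr0; last by rewrite indicE memNset.
    rewrite /F; case: (pselect (I01 t)) => t1I; last by rewrite /qf0 ext0_out// !mul0r.
    rewrite [X in _ * X * _](_ : _ = 0) ?mulr0 ?mul0r// indicE memNset//.
    move=> /=; rewrite in_itv/= => /andP[t0 tx]; apply: tI; rewrite /= in_itv/=.
    by move: t1I; rewrite /= in_itv/= => /andP[-> _] /=; rewrite lt_neqAle t1x.
  rewrite [X in _ = _ * X](_ : _ = 1) ?mulr1; last by rewrite indicE mem_set.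
  move: tI; rewrite /= in_itv/= => /andP[t0 tx].
  have t1 : t < 1 by apply: lt_le_trans tx _; case/andP: x1p.
  rewrite /F [X in _ * X * _](_ : _ = 1) ?mulr1; last first.
    by rewrite indicE mem_set//= in_itv/= !ltW.
  have tI : I01 t by rewrite /= in_itv/= t0.
  rewrite /qf0 /phi0 /mder0 !ext0_in//; last first.
    rewrite /= in_itv/= andbT ltr_wpDl// phir_gt0// ?t0//.
  by rewrite mulrC.
move=> e e0.
have p0 : 0 <= phir psi x1 by exact: phir_ge0.
have : 0 <= s + phir psi x1 by rewrite addr_ge0.
rewrite le_eqVlt => /predU1P[z0|]; last first.
  by move=> z0; exact: cvx_rcont (mder_cvx kp2) z0 _ e0.
rewrite -z0; case: hs => [s1|[_ ->]]; last exact: gen_rcont0.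
by move: s1; rewrite ltNge => /negP[]; rewrite z0 lerDl.
Qed.

(** The integral over the last coordinates, for a fixed first coordinate x, is
    the induction hypothesis for k + 1 and s + phi x; [kernel_integral0]
    integrates the result over x. *)
Lemma dens_box m k s : kmono (k + m + 1) psi ->
  (0 < s) \/ [/\ 0 <= s, k = 0%N & (0 < m)%N] ->
  forall x : m.-tuple R, pcube x ->
  (\int[lambda m]_(t in box x) (dens k s t)%:E =
   (mder k psi (s + \sum_(i < m) phir psi (tnth x i)))%:E)%E.
Proof.
elim: m k s => [|m IH] k s kp hs x x01.
  have s0 : 0 < s by case: hs => // -[].
  rewrite integral_dirac.
  - rewrite diracE mem_set; last by case.
    rewrite mul1e /dens !big_ord0 !addr0 mulr1 addn0 /mder0 ext0_in//.
    by rewrite /= in_itv/= s0.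
  - exact: measurable_box.
  - by apply/measurable_EFinP/measurable_funTS; exact: measurable_dens.
have s0 : 0 <= s by case: hs => [/ltW//|[]].
have kp2 : kmono (k + 2) psi by apply: kmonoW kp; rewrite -addnA leq_add2l addn1 !ltnS.
have kp1 : kmono (k + 1) psi by apply: kmonoW kp2; rewrite leq_add2l.
have kpS : kmono (k.+1 + m + 1) psi by rewrite addSnnS.
have kpS1 : kmono (k.+1 + 1) psi by rewrite addSnnS.
pose x1 := tnth x ord0; pose x' : m.-tuple R := [tuple of behead x].
have xE : x = [tuple of x1 :: x'] by rewrite {1}(tuple_eta x).
have x1p : 0 < x1 <= 1 by exact: x01.
have x'p : pcube x'.
  by move=> i; have := x01 (lift ord0 i); rewrite {1 2}xE tnthS.
have mD := @measurable_dens k m.+1 s kp.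
rewrite integral_indicM ge0_integral_distribution; last 2 first.
- apply/measurable_EFinP; apply: measurable_funM => //.
  by apply: measurable_indic; exact: measurable_box.
- by move=> y; rewrite lee_fin mulr_ge0// dens_ge0.
rewrite fubini_tonelli1; last 2 first.
- apply: measurableT_comp; last exact: measurable_funPT.
  apply/measurable_EFinP; apply: measurable_funM => //.
  by apply: measurable_indic; exact: measurable_box.
- by move=> y; rewrite lee_fin mulr_ge0// dens_ge0.
pose c := \sum_(i < m) phir psi (tnth x' i).
have c0 : 0 <= c by apply: sumr_ge0 => i _; apply: phir_ge0 => //; exact: x'p.
pose F t1 := qf0 t1 * \1_(`[0, x1]%classic : set R) t1 * mder0 k.+1 (s + c + phi0 t1).
have F0 t1 : 0 <= F t1 by rewrite /F; apply: mulr_ge0; [apply: mulr_ge0; rewrite ?qf0_ge0|exact: mder0_ge0].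
transitivity (\int[lambda1]_t1 (F t1)%:E)%E.
  apply: eq_integral => t1 _; rewrite /fubini_F /=.
  under eq_integral => t' _.
    rewrite /cons_pair/= dens_cons.
    have -> : \1_(box x) [tuple of t1 :: t'] = \1_(`[0, x1]%classic : set R) t1 * \1_(box x') t' :> R.
      rewrite !indicE -natrM mulnb; congr (nat_of_bool _)%:R.
      apply/idP/andP; rewrite !inE.
        move=> H; split; first by rewrite /= in_itv/=; have := H ord0; rewrite tnth0.
        by move=> i; have := H (lift ord0 i); rewrite [in tnth x _]xE !tnthS.
      rewrite /= in_itv/= => -[H1 H2] i; rewrite [in tnth x _]xE.
      case: (unliftP ord0 i) => [j ->|->]; first by rewrite !tnthS; exact: H2.
      by rewrite !tnth0.
    rewrite mulrACA EFinM; over.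
  rewrite ge0_integralZl//; last 3 first.
  - apply/measurable_EFinP; apply: measurable_funM; first exact: measurable_dens.
    by apply: measurable_indic; exact: measurable_box.
  - by move=> t' _; rewrite lee_fin mulr_ge0// dens_ge0.
  - by rewrite lee_fin mulr_ge0// qf0_ge0.
  rewrite -integral_indicM.
  case: (pselect (I01 t1)) => t1I; last first.
    by rewrite /F /qf0 ext0_out// !mul0r mul0e.
  have t1p : 0 < phi0 t1.
    rewrite /phi0 ext0_in//; apply: (phir_gt0 gen).
    by move: t1I; rewrite /= in_itv.
  rewrite IH//; last by left; rewrite ltr_wpDl.
  rewrite -EFinM /F /mder0 ext0_in; last by rewrite /= in_itv/= andbT ltr_wpDl// addr_ge0.
  by rewrite -/c addrAC.
rewrite kernel_integral0//; last first.
  by case: hs => [s1|[_ -> _]]; [left; rewrite ltr_pwDl|right; rewrite addr_ge0].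
rewrite big_ord_recl addrCA -/x1.
have -> : \sum_(i < m) phir psi (tnth x (lift ord0 i)) = c.
  by apply: eq_bigr => i _; rewrite [in tnth x _]xE tnthS.
by rewrite (addrC (phir _ _)).
Qed.

End density.

(** * Radon-Nikodym derivatives of the marginals *)

Section lambda_cube.
Context {R : realType}.

Lemma lambda_prod m (A : 'I_m -> set R) : (forall i, measurable (A i)) ->
  lambda m [set t : m.-tuple R | forall i, A i (tnth t i)] =
  (\prod_(i < m) @lambda1 R (A i))%E.
Proof.
elim: m A => [|m IH] A mA.
  by rewrite big_ord0 /= diracE mem_set//= => -[].
rewrite big_ord_recl -IH; last by move=> i; exact: mA.
pose A' : set (m.-tuple R) := [set t | forall i, A (lift ord0 i) (tnth t i)].
have mA' : measurable A'.
  by apply: (measurable_allcoord (A := fun i => A (lift ord0 i))) => i; exact: mA.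
rewrite -(product_measure1E lambda1 (lambda m) (mA ord0) mA').
transitivity ((lambda1 \x lambda m)%E (@cons_pair R m @^-1`
  [set t : m.+1.-tuple R | forall i, A i (tnth t i)])); first by [].
congr ((lambda1 \x lambda m)%E _); apply/seteqP; split => [[x t] /= H|[x t] /= [H1 H2] i].
  split; first by have := H ord0; rewrite tnth0.
  by move=> i; have := H (lift ord0 i); rewrite tnthS.
case: (unliftP ord0 i) => [j ->|->]; first by rewrite tnthS; exact: H2.
by rewrite tnth0.
Qed.

Lemma lambda1_I01 : @lambda1 R `]0, 1[%classic = 1%E.
Proof.
rewrite /lambda1 /mrestr setIidl; last by move=> t /=; rewrite !in_itv/= => /andP[/ltW -> /ltW ->].
by rewrite lebesgue_measure_itv/= lte_fin ltr01 sube0.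
Qed.

Lemma ae_I01 m : {ae lambda m, forall t : m.-tuple R, forall i, 0 < tnth t i < 1}.
Proof.
pose S := [set t : m.-tuple R | forall i, (`]0, 1[%classic : set R) (tnth t i)].
have mS : measurable S by apply: (measurable_allcoord (A := fun=> `]0, 1[%classic)) => i.
exists (~` S); split; first exact: measurableC.
- rewrite probability_setC// (_ : _ S = 1%E) ?subee//.
  rewrite [LHS](@lambda_prod _ (fun=> `]0, 1[%classic))//.
  by rewrite big1// => i _; exact: lambda1_I01.
- move=> t /= nt St; apply: nt => i; have := St i; by rewrite /= in_itv.
Qed.

Lemma lambda1_countable (S : set R) : countable S -> @lambda1 R S = 0%E.
Proof.
move=> cS; have mS : measurable S by exact: countable_measurable.
apply/eqP; rewrite eq_le measure_ge0 andbT /lambda1 /mrestr.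
rewrite -(countable_lebesgue_measure0 cS); apply: le_measure; rewrite ?inE//.
exact: measurableI.
Qed.

(** Injectivity of phi leaves, for fixed other coordinates, a countable set of
    exceptional first coordinates; Fubini concludes. *)
Lemma ae_sum_notin psi (N : set R) m : is_generator psi -> countable N -> (0 < m)%N ->
  {ae lambda m, forall t : m.-tuple R, (forall i, 0 < tnth t i < 1) ->
     ~ N (\sum_(i < m) phir psi (tnth t i))}.
Proof.
move=> gen cN; case: m => // m _.
pose B := [set t : m.+1.-tuple R | (`]0, 1[%classic : set R) (tnth t ord0) /\
   N (\sum_(i < m.+1) phi0 psi (tnth t i))].
have mN : measurable N by exact: countable_measurable.
have mB : measurable B.
  rewrite (_ : B = [set t : m.+1.-tuple R | (`]0, 1[%classic : set R) (tnth t ord0)] `&`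
     ((fun t : m.+1.-tuple R => \sum_(i < m.+1) phi0 psi (tnth t i)) @^-1` N))//.
  apply: measurableI; first exact: measurable_coord.
  rewrite -[X in measurable X]setTI; apply: (measurable_sum _ _) => // i.
  by apply: measurableT_comp (measurable_tnth i); exact: measurable_phi0.
exists B; split => //.
  rewrite -[B]setIT -integral_indic// ge0_integral_distribution; last 2 first.
  - by apply/measurable_EFinP; exact: measurable_indic.
  - by move=> y; rewrite lee_fin.
  rewrite fubini_tonelli2; last 2 first.
  - apply: measurableT_comp; last exact: measurable_funPT.
    by apply/measurable_EFinP; exact: measurable_indic.
  - by move=> y; rewrite lee_fin.
  apply: integral0_eq => t _; rewrite /fubini_G /=.
  pose c := \sum_(i < m) phi0 psi (tnth t i).
  pose S := [set x : R | (`]0, 1[%classic : set R) x /\ N (phi0 psi x + c)].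
  have cS : countable S.
    apply: (@sub_countable _ _ _ ((fun y => psi (y - c)) @` N)).
      apply: subset_card_le => x [xI Nx]; exists (phi0 psi x + c) => //.
      rewrite addrK /phi0 ext0_in// psi_phir//.
      by move: xI; rewrite /= in_itv/= => /andP[-> /ltW].
    by apply: sub_countable cN; exact: card_image_le.
  have mS : measurable S by exact: countable_measurable.
  transitivity (\int[lambda1]_(x in setT) (\1_S x)%:E)%E.
    apply: eq_integral => x _; congr (_%:E); rewrite !indicE; congr (nat_of_bool _)%:R.
    apply/idP/idP; rewrite !inE /B/S/= /cons_pair/= big_ord_recl tnth0.
      by under eq_bigr do rewrite tnthS.
    by under eq_bigr do rewrite tnthS.
  by rewrite integral_indic// setIT; exact: lambda1_countable.
move=> t /= /not_implyP[tI /contrapT Nt].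
split; first by rewrite /= in_itv/= tI.
rewrite (eq_bigr (fun i => phir psi (tnth t i)))// => i _.
by rewrite /phi0 ext0_in//= in_itv/= tI.
Qed.

End lambda_cube.

Section marginal_density.
Context {R : realType} (d m : nat) (C : @copula R d) (psi : R -> R).
Hypotheses (gen : is_generator psi) (arch : archimedean C psi).
Hypothesis md : (m < d)%N.
Hypothesis m0 : (0 < m)%N.

Lemma cop_pcube n (D : @copula R n) : cop_measure D (~` @pcube R n) = 0%E.
Proof.
pose N (i : 'I_n) := (fun t : n.-tuple R => tnth t i) @^-1` (~` `]0, 1]).
have mN i : measurable (N i).
  by rewrite -[N i]setTI; apply: (measurable_tnth i) => //; exact: measurableC.
have N0 i : cop_measure D (N i) = 0%E.
  rewrite (cop_uniform D i (A := ~` `]0, 1])); last exact: measurableC.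
  have -> : @lambda1 R (~` `]0, 1]%classic) = (1 - lambda1 `]0%R, 1%R]%classic)%E.
    by rewrite -probability_setC.
  by rewrite lambda1_itv ?lexx ?ler01// subr0 subee.
pose F k := if (insub k : option 'I_n) is Some i then N i else set0.
have negF k : (cop_measure D).-negligible (F k).
  rewrite /F; case: insub => [i|]; last exact: negligible_set0.
  by apply/negligibleP; [exact: mN|exact: N0].
apply/negligibleP; first by apply: measurableC; exact: measurable_pcube.
apply: (negligibleS _ (negligible_bigcup negF)) => t /existsNP[i ti].
by exists (val i) => //; rewrite /F valK /N /= in_itv.
Qed.

Lemma arch_pad1 x : @pcube R m x -> C (pad1 d x) = psi (\sum_(i < m) phir psi (tnth x i)).
Proof.
move=> x01.
have nx k : 0 < nth 1 x k <= 1.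
  case: (ltnP k m) => km; last by rewrite nth_default ?size_tuple// ltr01 lexx.
  by have := x01 (Ordinal km); rewrite (tnth_nth 1).
have -> : pad1 d x = [tuple psi (phir psi (nth 1 x k)) | k < d].
  by apply: eq_from_tnth => k; rewrite !tnth_mktuple psi_phir.
rewrite (archE gen arch (u := fun k => phir psi (nth 1 x k))) => [|k _]; last exact: phir_ge0.
congr psi; rewrite -(big_mkord xpredT (fun k => phir psi (nth 1 x k))).
rewrite (big_cat_nat (n := m))//=; last exact: ltnW.
rewrite big_mkord [X in _ + X]big1_seq ?addr0.
  by apply: eq_bigr => i _; rewrite -tnth_nth.
move=> k; rewrite mem_index_iota => /andP[_ /andP[mk _]].
by rewrite nth_default ?size_tuple// phir1.
Qed.

Let kp : kmono (0 + m + 1) psi.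
Proof.
have d0 : (0 < d)%N by exact: leq_trans md.
by apply: (kmonoW (l := 0 + m + 1) _ (archimedean_kmono gen arch d0)); rewrite add0n addn1.
Qed.

Let cpsi : cvx psi.
Proof. by apply: kmono_cvx kp; rewrite add0n addn1 ltnS. Qed.

Let D := @dens R psi 0 m 0.

Let mD : measurable_fun setT (EFin \o D).
Proof. by apply/measurable_EFinP; exact: measurable_dens. Qed.

Let D0 x : (0 <= (EFin \o D) x)%E.
Proof. by rewrite lee_fin dens_ge0. Qed.

(** Both measures are carried by [pcube] and agree on its boxes. *)
Lemma marginal_densityE A : measurable A ->
  marginal_measure C (ltnW md) A = (\int[lambda m]_(t in A) (dens psi 0 0 t)%:E)%E.
Proof.
move=> mA.
apply: (@measure_unique_boxes R m (marginal_measure C (ltnW md))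
  (density_measure (lambda m) mD D0)) => //.
- by rewrite -ge0_fin_numE// fin_num_measure.
- exact: (cop_pcube (marginal1m C (ltnW md))).
- rewrite /density_measure/=; apply: integral0_eq => t /existsNP[i ti].
  rewrite /= /D; congr (_%:E); rewrite /dens [\prod_(_ < m) _](bigD1 i)//= [X in _ * (X * _)](_ : _ = 0) ?mul0r ?mulr0//.
  rewrite /qf0 ext0_out// => /=; rewrite in_itv/= => /andP[a b]; apply: ti.
  by rewrite a ltW.
- move=> y y01; have cy : cube m y by move=> i; have /andP[a b] := y01 i; rewrite ltW.
  have := cop_df (marginal1m C (ltnW md)) cy => /= ->.
  rewrite arch_pad1// /density_measure/= dens_box//; last by right; split.
  by rewrite add0r.
Qed.

Lemma marginal_dominates : marginal_measure C (ltnW md) `<< lambda m.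
Proof.
apply/null_content_dominatesP => A mA A0; rewrite [LHS]marginal_densityE//.
apply: null_set_integral => //.
exact: measurable_funTS.
Qed.

Lemma copula_density_ae : ae_eq (lambda m) setT
  (copula_density (marginal1m C (ltnW md))) (fun t => (dens psi 0 0 t)%:E).
Proof.
rewrite /copula_density; apply: integral_ae_eq => //.
- apply: Radon_Nikodym_integrable; exact: marginal_dominates.
- move=> A _ mA; rewrite -Radon_Nikodym_integral//; last exact: marginal_dominates.
  exact: marginal_densityE.
Qed.

End marginal_density.

(** * Convergence of densities *)

Section scheffe.
Context d (T : measurableType d) {R : realType} (mu : {measure set T -> \bar R}).
Variables (f_ : nat -> T -> R) (f : T -> R).
Hypotheses (mf_ : forall n, measurable_fun setT (f_ n)) (mf : measurable_fun setT f).
Hypotheses (f_0 : forall n x, 0 <= f_ n x) (f0 : forall x, 0 <= f x).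
Hypotheses (f_1 : forall n, (\int[mu]_x (f_ n x)%:E = 1)%E) (f1 : (\int[mu]_x (f x)%:E = 1)%E).
Hypothesis ff : {ae mu, forall x, f_ n x @[n --> \oo] --> f x}.

Let intf_ n : mu.-integrable setT (EFin \o f_ n).
Proof.
apply/integrableP; split; first exact/measurable_EFinP.
rewrite (eq_integral (fun x => (f_ n x)%:E)) ?f_1 ?ltry// => x _.
by rewrite gee0_abs// lee_fin.
Qed.

Let intf : mu.-integrable setT (EFin \o f).
Proof.
apply/integrableP; split; first exact/measurable_EFinP.
rewrite (eq_integral (fun x => (f x)%:E)) ?f1 ?ltry// => x _.
by rewrite gee0_abs// lee_fin.
Qed.

Let intS g A : measurable A -> mu.-integrable setT (EFin \o g) -> mu.-integrable A (EFin \o g).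
Proof. by move=> mA; apply: integrableS. Qed.

Let g n x := Num.min (f_ n x) (f x).

Let mg n : measurable_fun setT (g n). Proof. exact: measurable_minr. Qed.

Let intg n : mu.-integrable setT (EFin \o g n).
Proof.
apply: le_integrable intf => //; first exact/measurable_EFinP.
move=> x _; rewrite /= lee_fin !ger0_norm//; last by rewrite /g le_min f_0 f0.
by rewrite /g ge_min lexx orbT.
Qed.

Let gcvg A : measurable A ->
  \int[mu]_(x in A) g n x @[n --> \oo] --> \int[mu]_(x in A) f x.
Proof.
move=> mA; apply: (Rintegral_dominated (g := f)) => //.
- by move=> n; exact: measurable_funTS.
- exact: measurable_funTS.
- apply: filterS ff => x /cvgrPdist_le fx _; apply/cvgrPdist_le => e e0.
  apply: filterS (fx e e0) => n; rewrite /g; case: (leP (f_ n x) (f x)) => // _ _.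
  by rewrite subrr normr0 ltW.
- exact: intS.
- move=> n x _; rewrite ger0_norm; last by rewrite /g le_min f_0 f0.
  by rewrite /g ge_min lexx orbT.
Qed.

Let split1 h A : mu.-integrable setT (EFin \o h) -> (\int[mu]_x (h x)%:E = 1)%E ->
  measurable A -> \int[mu]_(x in A) h x = 1 - \int[mu]_(x in ~` A) h x.
Proof.
move=> ih h1 mA; apply/eqP; rewrite -subr_eq opprK -Rintegral_setU//.
- by rewrite setUv /Rintegral h1.
- exact: measurableC.
- by rewrite setUv.
- by rewrite disj_set2E setICr.
Qed.

(** The minima of f_n and f are dominated by f, so their integrals over A and
    over its complement converge to those of f. They bound the integrals of
    f_n from below, and since the total masses are 1 the bound on the
    complement is an upper bound on A. *)
Lemma scheffe A : measurable A ->
  \int[mu]_(x in A) f_ n x @[n --> \oo] --> \int[mu]_(x in A) f x.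
Proof.
move=> mA; have mCA := measurableC mA.
have le B n : measurable B -> \int[mu]_(x in B) g n x <= \int[mu]_(x in B) f_ n x.
  move=> mB; apply: le_Rintegral => //; [exact: intS|exact: intS|].
  by move=> x _; rewrite /g ge_min lexx.
apply: (@squeeze_cvgr _ _ _ _ (fun n => \int[mu]_(x in A) g n x) (fun n => 1 - \int[mu]_(x in ~` A) g n x)).
- near=> n; rewrite le//= (split1 (intf_ n))// lerD2l lerN2; exact: le.
- exact: gcvg.
- rewrite (split1 intf)//; apply: cvgB; [exact: cvg_cst|exact: gcvg].
Unshelve. all: by end_near. Qed.

End scheffe.

Section densities.
Context {R : realType} (d : nat).
Variables (C_ : nat -> @copula R d) (C : @copula R d).
Variables (psi_ : nat -> R -> R) (psi : R -> R).
Hypotheses (gen_ : forall n, is_generator (psi_ n)) (gen : is_generator psi).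
Hypotheses (arch_ : forall n, archimedean (C_ n) (psi_ n)) (arch : archimedean C psi).

Lemma densE m (p : R -> R) (t : m.-tuple R) : is_generator p -> (0 < m)%N ->
  (forall i, 0 < tnth t i < 1) ->
  dens p 0 0 t = mder m p (\sum_(i < m) phir p (tnth t i)) * \prod_(i < m) qf p (tnth t i).
Proof.
move=> gp m0 t01.
have tI i : (`]0, 1[%classic : set R) (tnth t i) by rewrite /= in_itv/= t01.
rewrite /dens (eq_bigr (fun i => phir p (tnth t i))); last first.
  by move=> i _; rewrite /phi0 ext0_in.
rewrite [\prod_(i < m) _](eq_bigr (fun i => qf p (tnth t i))); last first.
  by move=> i _; rewrite /qf0 ext0_in.
rewrite add0r add0n /mder0 ext0_in// /= in_itv/= andbT.
case: m m0 t t01 tI => // m _ t t01 tI; rewrite big_ord_recl ltr_pwDl ?phir_gt0//.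
apply: sumr_ge0 => i _; apply: (phir_ge0 gp).
by have /andP[-> /ltW] := t01 (lift ord0 i).
Qed.

(** At almost every point t the sum of the phi (t i) is a continuity point of
    the derivative of order m. *)
Lemma densities_of_phir m (md : (m < d)%N) : (2 <= m)%N ->
  (forall x, 0 < x <= 1 -> phir (psi_ n) x @[n --> \oo] --> phir psi x) ->
  {ae lambda m, forall x,
     copula_density (marginal1m (C_ n) (ltnW md)) x @[n --> \oo]
       --> copula_density (marginal1m C (ltnW md)) x}.
Proof.
move=> m2 pc.
have m0 : (0 < m)%N by exact: ltnW.
have d0 : (0 < d)%N by exact: leq_trans md.
have kd_ n : kmono d (psi_ n) := archimedean_kmono (gen_ n) (arch_ n) d0.
have kd : kmono d psi := archimedean_kmono gen arch d0.
have pp t : 0 < t -> psi_ n t @[n --> \oo] --> psi t.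
  move=> t0; apply: (phir_cvg_moving gen_ gen pc (z_ := fun=> t)).
  - by move=> _; exact: ltW.
  - exact: ltW.
  - exact: cvg_cst.
have cN : countable [set z | 0 < z /\ ~ {for z, continuous (mder m psi)}].
  apply: nonincreasing_discontinuities => u v; apply: mder_ni.
  by apply: kmonoW kd; rewrite addn1.
have mconv (z_ : nat -> R) (z : R) : 0 < z -> z_ n @[n --> \oo] --> z ->
    {for z, continuous (mder m psi)} -> mder m (psi_ n) (z_ n) @[n --> \oo] --> mder m psi z.
  case: m m0 md {m2 cN} => // m _ md z0 zz cz; apply: cvg_mder => //.
    by move=> n; apply: kmonoW (kd_ n); rewrite addn2.
  by apply: kmonoW kd; rewrite addn2.
have A1 := ae_foralln (fun n => copula_density_ae (gen_ n) (arch_ n) md m0).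
have A2 := copula_density_ae gen arch md m0.
have A3 := ae_I01 (R := R) m.
have A4 := ae_sum_notin gen cN m0.
apply: filterS2 A1 (filterI A2 (filterI A3 A4)) => t H1 [H2 [H3 H4]].
rewrite (H2 I); under eq_fun do rewrite (H1 _ I).
apply: cvg_EFin; first by near=> n.
rewrite /comp/= densE//; under eq_fun do rewrite /= (densE (gen_ _))//.
have tle i : 0 < tnth t i <= 1 by have /andP[-> /ltW] := H3 i.
have S0 : 0 < \sum_(i < m) phir psi (tnth t i).
  case: m m0 {m2 md mconv cN A2 A3 A4 H1 H2 H4} t H3 tle => // m _ t H3 tle.
  rewrite big_ord_recl ltr_pwDl ?phir_gt0//.
  by apply: sumr_ge0 => i _; apply: (phir_ge0 gen).
have Sc : \sum_(i < m) phir (psi_ n) (tnth t i) @[n --> \oo] --> \sum_(i < m) phir psi (tnth t i).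
  by apply: cvg_big => [|i _]; [exact: add_continuous|exact: pc].
apply: cvgM.
  have cS : {for \sum_(i < m) phir psi (tnth t i), continuous (mder m psi)}.
    by apply: contrapT => nc; apply: (H4 H3).
  by apply: (mconv (fun n => \sum_(i < m) phir (psi_ n) (tnth t i))).
apply: cvg_big => [|i _]; first exact: mul_continuous.
have d3 : (2 < d)%N := leq_ltn_trans m2 md.
have k3 : kmono 3 psi := kmonoW d3 kd.
have k2 : kmono 2 psi by apply: kmonoW k3.
have p0 : 0 < phir psi (tnth t i) by apply: phir_gt0.
apply: cvgV.
  have /andP[t0 t1] := H3 i.
  have := qf_gt0 gen (kmono_cvx (ltnSn 1) k2) t0 t1.
  by rewrite /qf invr_gt0 => /gt_eqF ->.
apply: (@cvg_mder _ _ _ 0) => //.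
- by move=> n; exact: kmonoW (ltnW d3) (kd_ n).
- exact: pc.
- exact: mder_continuous.
Unshelve. all: by end_near. Qed.

(** Values of the marginal are masses of boxes, to which [scheffe] applies. *)
Lemma bivariate_of_densities (d2 : (2 < d)%N) (i j : 'I_d) : i = 0%N :> nat -> j = 1%N :> nat ->
  {ae lambda 2, forall x,
     copula_density (marginal1m (C_ n) (ltnW d2)) x @[n --> \oo]
       --> copula_density (marginal1m C (ltnW d2)) x} ->
  forall x : 2.-tuple R, cube 2 x -> C_ n (put2 i j x) @[n --> \oo] --> C (put2 i j x).
Proof.
move=> i0 j1 H x cx.
have put2E (D : @copula R d) : D (put2 i j x) = fine (marginal_measure D (ltnW d2) (box x)).
  have := cop_df (marginal1m D (ltnW d2)) cx => /= ->.
  congr (cop_fun D _); apply: eq_from_tnth => k; rewrite !tnth_mktuple !(tnth_nth 1)/=.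
  rewrite -!val_eqE/= i0 j1; case: (k : nat) => [|[|n]]//=.
  by rewrite nth_default// size_tuple.
have mB : measurable (box x) by exact: measurable_box.
have d0 : (0 < d)%N := leq_trans (isT : (0 < 3)%N) d2.
have kd_ n : kmono (0 + 2 + 1) (psi_ n) := kmonoW d2 (archimedean_kmono (gen_ n) (arch_ n) d0).
have kd : kmono (0 + 2 + 1) psi := kmonoW d2 (archimedean_kmono gen arch d0).
have c_ n : cvx (psi_ n) := @kmono_cvx _ 3 (psi_ n) isT (kd_ n).
have c : cvx psi := @kmono_cvx _ 3 psi isT kd.
rewrite put2E (marginal_densityE gen arch d2)//.
under eq_fun do rewrite put2E (marginal_densityE (gen_ _) (arch_ _) d2)//.
apply: (@scheffe _ _ _ (lambda 2) (fun n => dens (psi_ n) 0 0) (dens psi 0 0)) => //.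
- by move=> n; exact: measurable_dens.
- exact: measurable_dens.
- by move=> n t; exact: dens_ge0.
- by move=> t; exact: dens_ge0.
- by move=> n; rewrite -(marginal_densityE (gen_ n) (arch_ n) d2)// probability_setT.
- by rewrite -(marginal_densityE gen arch d2)// probability_setT.
have A1 := ae_foralln (fun n => copula_density_ae (gen_ n) (arch_ n) d2 (isT : (0 < 2)%N)).
have A2 := copula_density_ae gen arch d2 (isT : (0 < 2)%N).
apply: filterS2 A1 (filterI A2 H) => t H1 [H2].
rewrite (H2 I); under eq_fun do rewrite (H1 _ I).
by move=> /fine_cvg.
Qed.

End densities.

(** * Markov kernels of Archimedean copulas *)

Lemma tnth_lift0 (T : Type) n (t : n.+1.-tuple T) (i : 'I_n) :
  tnth t (lift ord0 i) = tnth [tuple of behead t] i.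
Proof. by rewrite [in LHS](tuple_eta t) tnthS. Qed.

Section kernel_basics.
Context {R : realType} (n : nat).
Variable (K : R.-pker (measurableTypeR R) ~> n.-tuple R).

Definition rK (x : R) (A : set (n.-tuple R)) : R := fine (K x A).

Lemma rK_fin x A : K x A \is a fin_num -> (rK x A)%:E = K x A.
Proof. by move=> h; rewrite /rK fineK. Qed.

Lemma kernel_le1 x A : measurable A -> (K x A <= 1)%E.
Proof. by move=> mA; rewrite -[leRHS](prob_kernel (s:=K) x); apply: le_measure; rewrite ?inE. Qed.

Lemma rKE x A : measurable A -> (rK x A)%:E = K x A.
Proof.
move=> mA; apply: rK_fin; rewrite ge0_fin_numE//.
by rewrite (le_lt_trans (kernel_le1 x mA))// ltry.
Qed.

Lemma rK_ge0 x A : 0 <= rK x A.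
Proof. by rewrite fine_ge0. Qed.

Lemma rK_le1 x A : measurable A -> rK x A <= 1.
Proof. by move=> mA; rewrite -lee_fin rKE// kernel_le1. Qed.

Lemma measurable_rK A : measurable A -> measurable_fun setT (rK ^~ A).
Proof.
move=> mA; apply/measurable_EFinP.
rewrite [X in measurable_fun _ X](_ : _ = K ^~ A); last first.
  by apply/funext => x /=; rewrite rKE.
exact: (measurable_kernel K A mA).
Qed.

Lemma rK_box_strip x (y z : n.-tuple R) :
  `|rK x (box y) - rK x (box z)| <= \sum_(i < n) rK x (strip i (tnth y i) (tnth z i)).
Proof.
have key (u v : n.-tuple R) :
    rK x (box u) - rK x (box v) <= \sum_(i < n) rK x (strip i (tnth u i) (tnth v i)).
  rewrite lerBlDl -lee_fin EFinD !rKE; try exact: measurable_box.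
  apply: le_trans (measure_box_strip _ u v) _; rewrite leeD2l// -sumEFin.
  by apply: lee_sum => i _; rewrite rKE//; exact: measurable_strip.
rewrite ler_norml; apply/andP; split; last exact: key.
rewrite lerNl opprB; apply: le_trans (key z y) _.
apply: ler_sum => i _; rewrite le_eqVlt; apply/orP; left; apply/eqP.
by congr (rK x _); rewrite /strip minC maxC.
Qed.

Lemma lambda1_integrable_bounded (f : R -> R) M (D : set R) : measurable D ->
  measurable_fun D f -> (forall x, D x -> `|f x| <= M) ->
  (@lambda1 R).-integrable D (EFin \o f).
Proof.
move=> mD mf fM; apply: (@bounded_integrable _ _ _ _ _ _ M) => //.
by rewrite -ge0_fin_numE// fin_num_measure.
Qed.

Lemma integrable_rK A D : measurable A -> measurable D ->
  (@lambda1 R).-integrable D (EFin \o (rK ^~ A)).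
Proof.
move=> mA mD; apply: (@lambda1_integrable_bounded _ 1) => //.
  by apply: measurable_funTS; exact: measurable_rK.
by move=> x _; rewrite ger0_norm ?rK_ge0// rK_le1.
Qed.

End kernel_basics.

Section markov_kernel.
Context {R : realType} (n : nat) (C : @copula R n.+1).
Variables (K : R.-pker (measurableTypeR R) ~> n.-tuple R) (mk : is_markov_kernel C K).

Lemma markov_strip (i : 'I_n) (a b : R) :
  \int[lambda1]_x rK K x (strip i a b) <= `|a - b|.
Proof.
have mS := @measurable_strip R n i a b.
rewrite -lee_fin /Rintegral fineK; last first.
  by apply: integrable_fin_num => //; exact: integrable_rK.
under eq_integral do rewrite rKE//.
rewrite -(mk.2 setT (strip i a b) measurableT mS).
apply: le_trans (cop_strip C (lift ord0 i) a b).
apply: le_measure; rewrite ?inE.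
- rewrite (_ : mkset _ = strip (lift ord0 i) a b); first exact: measurable_strip.
  apply/seteqP; split => [t [_]|t] /=; rewrite /strip/=.
    by rewrite tnth_lift0.
  by rewrite tnth_lift0.
- exact: measurable_strip.
- by move=> t [_]; rewrite /strip/= tnth_lift0.
Qed.

Lemma markov_box (x : R) (y : n.-tuple R) : 0 < x <= 1 -> cube n y ->
  \int[lambda1]_(t in `[0, x]) rK K t (box y) = C [tuple of x :: y].
Proof.
move=> /andP[x0 x1] cy; have mB := @measurable_box R n y.
rewrite /Rintegral; under eq_integral do rewrite rKE//.
rewrite -(mk.2 `[0, x]%classic (box y))//.
have cxy : cube n.+1 [tuple of x :: y].
  by move=> i; case: (unliftP ord0 i) => [j ->|->]; rewrite ?tnthS ?tnth0// (ltW x0).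
have /= := cop_df C cxy; rewrite (_ : box _ = [set t : n.+1.-tuple R | (`[0, x]%classic : set R) (head 0 t) /\
    box y [tuple of behead t]]); first by move=> ->.
apply/seteqP; split => t /=; rewrite in_itv/=.
  move=> H; split; first by have := H ord0; rewrite tnth0 (tnth_nth 0)/= nth0.
  by move=> i; have := H (lift ord0 i); rewrite tnthS tnth_lift0.
move=> [H1 H2] i; case: (unliftP ord0 i) => [j ->|->].
  by rewrite tnthS tnth_lift0; exact: H2.
by rewrite tnth0 (tnth_nth 0)/= nth0.
Qed.

Lemma lambda1_unit_compl : @lambda1 R (~` `]0, 1]%classic) = 0%E.
Proof.
have -> : @lambda1 R (~` `]0, 1]%classic) = (1 - lambda1 `]0%R, 1%R]%classic)%E.
  by rewrite -probability_setC.
by rewrite lambda1_itv ?lexx ?ler01// subr0 subee.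
Qed.

Variables (psi : R -> R).
Hypotheses (gen : is_generator psi) (arch : archimedean C psi) (n0 : (0 < n)%N).

Let kp : kmono (0 + 2) psi.
Proof. exact: kmonoW (archimedean_kmono gen arch _). Qed.

Let cpsi : cvx psi. Proof. exact: (@kmono_cvx _ 2). Qed.

Variable y : n.-tuple R.
Hypothesis y01 : pcube y.

Let s := \sum_(i < n) phir psi (tnth y i).

Let s0 : 0 <= s.
Proof. by apply: sumr_ge0 => i _; apply: (phir_ge0 gen); exact: y01. Qed.

(** The conditional distribution function psi' (s + phi t) / psi' (phi t),
    with derivatives from the left. *)
Definition kformula (t : R) : R := qf0 psi t * mder0 psi 1 (s + phi0 psi t).

Let measurable_kformula : measurable_fun setT kformula.
Proof.
apply: measurable_funM; first exact: measurable_qf0.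
apply: measurableT_comp; first exact: measurable_mder0.
by apply: measurable_funD => //; exact: measurable_phi0.
Qed.

Let kformula_ge0 t : 0 <= kformula t.
Proof. by rewrite mulr_ge0 ?qf0_ge0 ?mder0_ge0. Qed.

Let mk1 : measurable_fun setT (K ^~ (box y)).
Proof. by apply: measurable_kernel; exact: measurable_box. Qed.

Let mk2 : measurable_fun setT (EFin \o kformula).
Proof. exact/measurable_EFinP. Qed.

(** The kernel and the formula are densities with the same integral over [0,
    x] for all x: it is C (x, y) for the former by definition, and for the
    latter by [kernel_integral0] with k = 0. *)
Lemma markov_kernel_ae : ae_eq lambda1 setT (K ^~ (box y)) (EFin \o kformula).
Proof.
have k10 x : (0 <= K x (box y))%E by [].
have k20 x : (0 <= (EFin \o kformula) x)%E by rewrite lee_fin.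
have mB := @measurable_box R n y.
have cy : cube n y by move=> i; have /andP[a b] := y01 i; rewrite ltW.
apply: integral_ae_eq => //.
  have := integrable_rK K mB measurableT; apply: eq_integrable => // x _ /=.
  by rewrite rKE.
move=> A _ mA.
apply: (@measure_unique_unit R (density_measure lambda1 mk1 k10)
  (density_measure lambda1 mk2 k20)) => //.
- rewrite /= /density_measure.
  apply: (@le_lt_trans _ _ (\int[lambda1]_(x in setT) (cst 1%E) x)%E).
    by apply: ge0_le_integral => // x _; exact: kernel_le1.
  by rewrite integral_cst// mul1e -ge0_fin_numE// fin_num_measure.
- apply: null_set_integral => //; [exact: measurableC|exact: measurable_funTS|].
  exact: lambda1_unit_compl.
- apply: null_set_integral => //; [exact: measurableC|exact: measurable_funTS|].
  exact: lambda1_unit_compl.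
- move=> x x01; rewrite /= /density_measure.
  have := markov_box x01 cy; rewrite /Rintegral.
  under eq_integral do rewrite rKE//.
  move=> H.
  have -> : (\int[lambda1]_(t in `[0%R, x]) K t (box y) = (C [tuple of x :: y])%:E)%E.
    rewrite -H fineK//; apply: integrable_fin_num => //.
    have := integrable_rK K mB (measurable_itv `[0, x]); apply: eq_integrable => // t _ /=.
    by rewrite rKE.
  rewrite [RHS]integral_indicM.
  transitivity (\int[lambda1]_t (qf0 psi t * \1_(`[0, x]%classic : set R) t
     * mder0 psi 1 (s + phi0 psi t))%:E)%E; last first.
    by apply: eq_integral => t _; rewrite /kformula mulrAC.
  rewrite kernel_integral0//; last by right.
  congr (_%:E); rewrite /s addrC.
  pose u (k : nat) : R := nth 0 (phir psi x :: [seq phir psi t | t <- y]) k.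
  have -> : [tuple of x :: y] = [tuple psi (u k) | k < n.+1].
    apply: eq_from_tnth => k; rewrite tnth_mktuple.
    case: (unliftP ord0 k) => [j ->|->]; rewrite ?tnth0 ?tnthS /u /= ?psi_phir//.
    by rewrite add0n (nth_map 0) ?size_tuple// -tnth_nth psi_phir.
  rewrite (archE gen arch); last first.
    case=> [|k] kn; rewrite /u /=; first exact: (phir_ge0 gen).
    rewrite (nth_map 0) ?size_tuple//; apply: (phir_ge0 gen).
    by have := y01 (@Ordinal n k kn); rewrite (tnth_nth 0).
  congr psi; rewrite big_ord_recl /u/=; congr (_ + _).
  by apply: eq_bigr => i _; rewrite add0n (nth_map 0) ?size_tuple// -tnth_nth.
Qed.

End markov_kernel.

(** * Distances between Markov kernels *)

Section kernel_joint.
Context {R : realType} (n : nat).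
Variable (K : R.-pker (measurableTypeR R) ~> n.-tuple R).

(** K seen as a kernel on pairs (x, y): the measure of the section at (x, y)
    of the set of all (x, y, t) with t in [box y] is a jointly measurable
    function. *)
Definition kfst (p : measurableTypeR R * n.-tuple R) := K p.1.

Let measurable_kfst U : measurable U -> measurable_fun setT (kfst ^~ U).
Proof.
move=> mU; apply: (measurableT_comp (f := K ^~ U)) => //.
exact: (measurable_kernel K U mU).
Qed.

HB.instance Definition _ := isKernel.Build _ _ _ _ R kfst measurable_kfst.

Let kfst_prob p : kfst p setT = 1%E. Proof. exact: prob_kernel. Qed.

HB.instance Definition _ := Kernel_isProbability.Build _ _ _ _ R kfst kfst_prob.

Lemma measurable_rK_joint :
  measurable_fun setT (fun p : measurableTypeR R * n.-tuple R => rK K p.1 (box p.2)).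
Proof.
pose A : set ((measurableTypeR R * n.-tuple R) * n.-tuple R) :=
  [set q | box q.1.2 q.2].
have mA : measurable A.
  rewrite (_ : A = \bigcap_(i in [set: 'I_n])
      ([set q | (`[0, +oo[%classic : set R) (tnth q.2 i)] `&`
       [set q | (`[0, +oo[%classic : set R) (tnth q.1.2 i - tnth q.2 i)])); last first.
    apply/seteqP; split => [q Aq i _|q Aq i] /=.
      by rewrite !in_itv/= !andbT subr_ge0; have /andP[] := Aq i.
    by have := Aq i I; rewrite /= !in_itv/= !andbT subr_ge0 => -[-> ->].
  apply: fin_bigcap_measurable => [|i _]; first exact: finite_finset.
  have m2 : measurable_fun setT
      (fun q : (measurableTypeR R * n.-tuple R) * n.-tuple R => tnth q.2 i).
    by apply: measurableT_comp (measurable_tnth i) _; exact: measurable_snd.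
  have m1 : measurable_fun setT
      (fun q : (measurableTypeR R * n.-tuple R) * n.-tuple R => tnth q.1.2 i).
    apply: measurableT_comp (measurable_tnth i) _.
    by apply: measurableT_comp => //; exact: measurable_snd.
  apply: measurableI.
    by rewrite -[X in measurable X]setTI; exact: m2.
  rewrite -[X in measurable X]setTI; apply: measurable_funB => //.
apply/measurable_EFinP.
rewrite [X in measurable_fun _ X](_ : _ = fun p => kfst p (xsection A p)); last first.
  apply/funext => p /=; rewrite rKE; last exact: measurable_box.
  congr (K p.1 _); apply/seteqP; split => t; rewrite /xsection/= inE //.
by apply: measurable_fun_xsection_finite_kernel; rewrite inE.
Qed.

End kernel_joint.

Section kernel_distance.
Context {R : realType} (n : nat) (A B : @copula R n.+1).
Variables (L M : R.-pker (measurableTypeR R) ~> n.-tuple R).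
Hypotheses (mL : is_markov_kernel A L) (mM : is_markov_kernel B M).

Local Notation kd := (kernel_diff L M).
(** The distance between the conditional distribution functions at y, in mean
    over x. *)
Definition kdist (y : n.-tuple R) : R := \int[lambda1]_x `|kernel_diff L M x y|.

Lemma kernel_diff_le1 x y : `|kd x y| <= 1.
Proof.
have mB := @measurable_box R n y.
have := rK_ge0 L x (box y); have := rK_le1 L x mB.
have := rK_ge0 M x (box y); have := rK_le1 M x mB.
rewrite /kernel_diff -!/(rK _ _ _) => *.
by rewrite ler_norml; apply/andP; split; lra.
Qed.

Lemma measurable_kernel_diff y : measurable_fun setT (kd ^~ y).
Proof. by apply: measurable_funB; apply: measurable_rK; exact: measurable_box. Qed.

Lemma integrable_kernel_diff y D : measurable D -> (@lambda1 R).-integrable D (EFin \o (kd ^~ y)).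
Proof.
move=> mD; apply: (@lambda1_integrable_bounded _ _ 1) => //.
  by apply: measurable_funTS; exact: measurable_kernel_diff.
by move=> x _; exact: kernel_diff_le1.
Qed.

Lemma integrable_norm_kernel_diff y D : measurable D ->
  (@lambda1 R).-integrable D (EFin \o (fun x => `|kd x y|)).
Proof.
move=> mD; apply: (@lambda1_integrable_bounded _ _ 1) => //.
  by apply: measurable_funTS; apply: measurableT_comp => //; exact: measurable_kernel_diff.
by move=> x _; rewrite normr_id kernel_diff_le1.
Qed.

Lemma kdist_ge0 y : 0 <= kdist y. Proof. by apply: Rintegral_ge0. Qed.

Lemma kdist_le1 y : kdist y <= 1.
Proof.
apply: (@le_trans _ _ (\int[lambda1]_(x in setT) (1 : R))).
  apply: le_Rintegral => //.
  - exact: integrable_norm_kernel_diff.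
  - by apply: (@lambda1_integrable_bounded _ _ 1) => // x _; rewrite normr1.
  - by move=> x _; exact: kernel_diff_le1.
by rewrite Rintegral_cst// mul1r [X in fine X](_ : _ = 1%E)//; exact: probability_setT.
Qed.

(** Two boxes differ by strips, and the mean over x of the mass of a strip is
    at most its width, for every kernel of a copula. *)
Lemma kdist_lip y z : `|kdist y - kdist z| <= 2 * \sum_(i < n) `|tnth y i - tnth z i|.
Proof.
have key u v : kdist u - kdist v <= 2 * \sum_(i < n) `|tnth u i - tnth v i|.
  have mS i := @measurable_strip R n i (tnth u i) (tnth v i).
  pose S (i : 'I_n) := strip i (tnth u i) (tnth v i).
  have intS (N : R.-pker (measurableTypeR R) ~> n.-tuple R) i :
      (@lambda1 R).-integrable setT (EFin \o (rK N ^~ (S i))).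
    by apply: integrable_rK => //; exact: mS.
  rewrite /kdist -RintegralB//; [|exact: integrable_norm_kernel_diff|exact: integrable_norm_kernel_diff].
  pose T x := \sum_(i < n) (rK L x (S i) + rK M x (S i)).
  have intT : (@lambda1 R).-integrable setT (EFin \o T).
    rewrite (_ : _ \o _ = fun x => \sum_(i < n) ((rK L x (S i))%:E + (rK M x (S i))%:E))%E.
      by apply: integrable_sum => // i _; apply: integrableD => //; exact: intS.
    by apply/funext => x; rewrite /T /= -sumEFin.
  apply: (@le_trans _ _ (\int[lambda1]_x T x)).
    apply: le_Rintegral => //.
      apply: (@lambda1_integrable_bounded _ _ 1) => //.
        by apply: measurable_funB; apply: measurableT_comp => //; exact: measurable_kernel_diff.
      move=> x _; have := kernel_diff_le1 x u; have := kernel_diff_le1 x v.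
      have := normr_ge0 (kd x u); have := normr_ge0 (kd x v) => *.
      by rewrite ler_norml; apply/andP; split; lra.
    move=> x _; apply: le_trans (ler_norm _) _; apply: le_trans (ler_dist_dist _ _) _.
    have -> : kd x u - kd x v = (rK L x (box u) - rK L x (box v)) -
       (rK M x (box u) - rK M x (box v)) by rewrite /kernel_diff -!/(rK _ _ _); ring.
    apply: le_trans (ler_normB _ _) _; rewrite /T big_split/=.
    by apply: lerD; exact: rK_box_strip.
  rewrite mulr_sumr -lee_fin /Rintegral fineK; last exact: integrable_fin_num.
  under eq_integral do rewrite /T -sumEFin.
  rewrite integral_sum//; last first.
    move=> i; apply: (@lambda1_integrable_bounded _ _ 2) => //.
      by apply: measurable_funD; apply: measurable_rK; exact: mS.
    move=> x _; rewrite ger0_norm ?addr_ge0 ?rK_ge0//.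
    have := rK_le1 L x (mS i); have := rK_le1 M x (mS i); rewrite /S; lra.
  rewrite -sumEFin; apply: lee_sum => i _.
  under eq_integral do rewrite EFinD.
  rewrite integralD//; [|exact: intS|exact: intS].
  rewrite mulr_natl mulr2n EFinD; apply: leeD.
    have := markov_strip mL i (tnth u i) (tnth v i).
    by rewrite -lee_fin /Rintegral fineK//; apply: integrable_fin_num => //; exact: intS.
  have := markov_strip mM i (tnth u i) (tnth v i).
  by rewrite -lee_fin /Rintegral fineK//; apply: integrable_fin_num => //; exact: intS.
rewrite ler_norml; apply/andP; split; last exact: key.
rewrite lerNl opprB; apply: le_trans (key z y) _.
by apply: ler_wpM2l => //; apply: ler_sum => i _; rewrite distrC.
Qed.

Lemma copula_le_kdist (x : R) y : 0 < x <= 1 -> cube n y ->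
  `|A [tuple of x :: y] - B [tuple of x :: y]| <= kdist y.
Proof.
move=> x01 cy; rewrite -(markov_box mL x01 cy) -(markov_box mM x01 cy).
have mB := @measurable_box R n y.
rewrite -RintegralB//; [|exact: integrable_rK|exact: integrable_rK].
apply: le_trans (le_normr_Rintegral _ _) _ => //; first exact: integrable_kernel_diff.
rewrite /kdist -lee_fin /Rintegral !fineK; try (apply: integrable_fin_num => //; exact: integrable_norm_kernel_diff).
apply: ge0_subset_integral => //.
by apply/measurable_EFinP; apply: measurableT_comp => //; exact: measurable_kernel_diff.
Qed.

Lemma measurable_kernel_diff_joint : measurable_fun setT
  (fun p : measurableTypeR R * n.-tuple R => kd p.1 p.2).
Proof. by apply: measurable_funB; exact: measurable_rK_joint. Qed.

Let P := (@lambda1 R \x lambda n)%E.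

Let mnorm : measurable_fun setT
  (fun p : measurableTypeR R * n.-tuple R => `|kd p.1 p.2|).
Proof. by apply: measurableT_comp => //; exact: measurable_kernel_diff_joint. Qed.

Let PT : P setT = 1%E.
Proof. exact: probability_setT. Qed.

Let integrable_P (f : measurableTypeR R * n.-tuple R -> R) : measurable_fun setT f ->
  (forall p, `|f p| <= 1) -> P.-integrable setT (EFin \o f).
Proof.
move=> mf f1; apply: (@bounded_integrable _ _ _ _ _ _ 1) => //.
by rewrite [ltLHS]PT ltry.
Qed.

Lemma measurable_kdist : measurable_fun setT kdist.
Proof.
apply/measurable_EFinP.
rewrite [X in measurable_fun _ X](_ : _ =
    fubini_G lambda1 (fun p : measurableTypeR R * n.-tuple R => (`|kd p.1 p.2|)%:E)).
  by apply: measurable_fun_fubini_tonelli_G => //; exact/measurable_EFinP.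
apply/funext => y; rewrite /fubini_G /= /kdist /Rintegral fineK//.
by apply: integrable_fin_num => //; exact: integrable_norm_kernel_diff.
Qed.

Lemma D1E : D1 L M = \int[lambda n]_y kdist y.
Proof.
rewrite /D1 /Rintegral fubini_tonelli2//; last exact/measurable_EFinP.
congr fine; apply: eq_integral => y _; rewrite /fubini_G /= fineK//.
by apply: integrable_fin_num => //; exact: integrable_norm_kernel_diff.
Qed.

Lemma D1_le (e : R) : 0 <= e -> (forall y, cube n y -> kdist y <= e) -> D1 L M <= e.
Proof.
move=> e0 H; rewrite D1E -lee_fin /Rintegral fineK; last first.
  apply: integrable_fin_num => //; apply: (@bounded_integrable _ _ _ _ _ _ 1) => //.
  - by rewrite -ge0_fin_numE// fin_num_measure.
  - exact: measurable_kdist.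
  - by move=> y _; rewrite ger0_norm ?kdist_ge0// kdist_le1.
apply: (@le_trans _ _ (\int[lambda n]_y e%:E)%E); last first.
  by rewrite integral_cst// [X in (_ * X)%E](_ : _ = 1%E) ?mule1//; exact: probability_setT.
apply: ae_ge0_le_integral => //.
- by move=> y _; rewrite lee_fin kdist_ge0.
- by apply/measurable_EFinP; exact: measurable_kdist.
- apply: filterS (ae_I01 n) => y y01 _; rewrite lee_fin; apply: H => i.
  by have /andP[/ltW -> /ltW] := y01 i.
Qed.

Definition D2sq := \int[P]_p (kd p.1 p.2) ^+ 2.

Lemma D2sq_ge0 : 0 <= D2sq. Proof. by apply: Rintegral_ge0 => p _; exact: sqr_ge0. Qed.

Let int1 : P.-integrable setT (EFin \o (fun p => `|kd p.1 p.2|)).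
Proof. by apply: integrable_P => // p; rewrite normr_id kernel_diff_le1. Qed.

Let int2 : P.-integrable setT (EFin \o (fun p => (kd p.1 p.2) ^+ 2)).
Proof.
apply: integrable_P.
  by apply: measurable_funX; exact: measurable_kernel_diff_joint.
move=> p; rewrite normrX; apply: exprn_ile1 => //; exact: kernel_diff_le1.
Qed.

Lemma D2sq_le_D1 : D2sq <= D1 L M.
Proof.
apply: le_Rintegral => // p _; rewrite -real_normK ?num_real// expr2.
by rewrite ler_piMl// kernel_diff_le1.
Qed.

(** The inequality a <= e + a^2 / e for a >= 0, integrated against a
    probability measure, serves as Cauchy-Schwarz. *)
Lemma D1_le_D2sq (e : R) : 0 < e -> D1 L M <= e + D2sq / e.
Proof.
move=> e0.
have ic : P.-integrable setT (EFin \o (cst e : _ -> R)).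
  by apply: (@bounded_integrable _ _ _ _ _ _ `|e|) => //; rewrite [ltLHS]PT ltry.
have i2 : P.-integrable setT (EFin \o (fun p => e^-1 * (kd p.1 p.2) ^+ 2)).
  have := integrableZl measurableT e^-1 int2; apply: eq_integrable => // p _ /=.
have -> : e + D2sq / e = \int[P]_p (e + e^-1 * (kd p.1 p.2) ^+ 2).
  rewrite RintegralD// RintegralZl// Rintegral_cst// [X in fine X](_ : _ = 1%E) ?PT//.
  by rewrite mulr1 [in RHS]mulrC.
apply: le_Rintegral => //; first by have := integrableD measurableT ic i2; apply: eq_integrable.
move=> p _; rewrite -(real_normK (num_real _)).
have : 0 <= `|kd p.1 p.2| by [].
move: (`|kd p.1 p.2|) => a a0; have ei : 0 < e^-1 by rewrite invr_gt0.
have [ae|/ltW ea] := leP a e.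
  by apply: (le_trans ae); rewrite lerDl mulr_ge0 ?exprn_ge0// ltW.
apply: (@le_trans _ _ (e^-1 * a ^+ 2)); last by rewrite lerDr ltW.
by rewrite mulrC ler_pdivlMr// expr2 ler_wpM2l.
Qed.

End kernel_distance.

(** * Convergence of Markov kernels *)

Section kernel_convergence.
Context {R : realType} (n : nat) (n0 : (0 < n)%N).
Variables (C_ : nat -> @copula R n.+1) (C : @copula R n.+1).
Variables (psi_ : nat -> R -> R) (psi : R -> R).
Hypotheses (gen_ : forall k, is_generator (psi_ k)) (gen : is_generator psi).
Hypotheses (arch_ : forall k, archimedean (C_ k) (psi_ k)) (arch : archimedean C psi).
Variables (K_ : nat -> R.-pker (measurableTypeR R) ~> n.-tuple R).
Variables (K : R.-pker (measurableTypeR R) ~> n.-tuple R).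
Hypotheses (mk_ : forall k, is_markov_kernel (C_ k) (K_ k)) (mk : is_markov_kernel C K).

Lemma ae_lambda1_I01 : {ae @lambda1 R, forall x : measurableTypeR R, 0 < x < 1}.
Proof.
exists (~` `]0, 1[%classic); split; first exact: measurableC.
- by rewrite [LHS]probability_setC// [X in (_ - X)%E](_ : _ = 1%E) ?subee//; exact: lambda1_I01.
- by move=> x /= nx; rewrite in_itv.
Qed.

Lemma ae_phir_notin (N : set R) (s : R) : countable N ->
  {ae @lambda1 R, forall x : measurableTypeR R, 0 < x < 1 -> ~ N (s + phir psi x)}.
Proof.
move=> cN; pose S := [set x : R | 0 < x < 1 /\ N (s + phir psi x)].
have cS : countable S.
  apply: (@sub_countable _ _ _ ((fun y => psi (y - s)) @` N)).
    apply: subset_card_le => x [/andP[x0 /ltW x1] Nx]; exists (s + phir psi x) => //.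
    by rewrite addrC addKr psi_phir// x0.
  by apply: sub_countable cN; exact: card_image_le.
exists S; split.
- exact: countable_measurable.
- exact: lambda1_countable.
- by move=> x /= /not_implyP[x01 /contrapT Nx].
Qed.

(** By [kformula], it suffices that phi x and s + phi x be continuity points
    of the left derivative of psi, where s is the sum of phi over y; this
    excludes countably many x. *)
Lemma kernel_box_cvg_ae :
  (forall x, 0 < x <= 1 -> phir (psi_ k) x @[k --> \oo] --> phir psi x) ->
  forall y, pcube y ->
  {ae @lambda1 R, forall x, rK (K_ k) x (box y) @[k --> \oo] --> rK K x (box y)}.
Proof.
move=> phic y y01.
have kp_ k : kmono (0 + 2) (psi_ k) := kmonoW (n0 : (1 < n.+1)%N) (archimedean_kmono (gen_ k) (arch_ k) isT).
have kp : kmono (0 + 2) psi := kmonoW (n0 : (1 < n.+1)%N) (archimedean_kmono gen arch isT).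
pose s := \sum_(i < n) phir psi (tnth y i).
pose s_ k := \sum_(i < n) phir (psi_ k) (tnth y i).
have s0 : 0 <= s by apply: sumr_ge0 => i _; apply: (phir_ge0 gen).
have s_0 k : 0 <= s_ k by apply: sumr_ge0 => i _; apply: (phir_ge0 (gen_ k)).
have ss : s_ k @[k --> \oo] --> s.
  by apply: cvg_big => [|i _]; [exact: add_continuous|exact: phic].
pose N := [set z | 0 < z /\ ~ {for z, continuous (mder 1 psi)}].
have cN : countable N.
  by apply: nonincreasing_discontinuities => u v; exact: mder_ni.
have pp t : 0 < t -> psi_ k t @[k --> \oo] --> psi t.
  move=> t0; apply: (phir_cvg_moving gen_ gen phic (z_ := fun=> t)).
  - by move=> _; exact: ltW.
  - exact: ltW.
  - exact: cvg_cst.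
have A1 := ae_foralln (fun k => markov_kernel_ae (mk_ k) (gen_ k) (arch_ k) n0 y01).
have A2 := markov_kernel_ae mk gen arch n0 y01.
have A3 := ae_lambda1_I01.
have A4 := ae_phir_notin s cN.
have A5 := ae_phir_notin 0 cN.
have FF : Filter (nbhs (almost_everywhere (@lambda1 R))) := ae_filter_ringOfSetsType _.
have A25 := @filterI _ _ FF _ _ A2 (@filterI _ _ FF _ _ A3 (@filterI _ _ FF _ _ A4 A5)).
move: A1 A25; apply: (@filterS2 _ _ FF) => x H1 [H2 [x01 [H4 H5]]].
have xle : 0 < x <= 1 by have /andP[-> /ltW] := x01.
have /andP[xp xl] := x01.
have p0 : 0 < phir psi x by apply: phir_gt0.
have p_0 k : 0 < phir (psi_ k) x by apply: phir_gt0.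
have kfE p t : kformula p y t = qf0 p t * mder0 p 1 (\sum_(i < n) phir p (tnth y i) + phi0 p t) by [].
have xI : (`]0, 1[%classic : set R) x by rewrite /= in_itv.
rewrite [X in _ --> X](_ : _ = qf psi x * mder 1 psi (s + phir psi x)); last first.
  by rewrite /rK (H2 I) /= kfE /qf0 /mder0 /phi0 !ext0_in// /= in_itv/= andbT ltr_wpDl.
rewrite [X in X @ _](_ : _ = fun k => qf (psi_ k) x * mder 1 (psi_ k) (s_ k + phir (psi_ k) x)); last first.
  apply/funext => k; rewrite /rK (H1 k I) /= kfE /qf0 /mder0 /phi0 !ext0_in// /=; rewrite in_itv/= andbT; exact: ltr_wpDl (s_0 k) (p_0 k).
apply: cvgM.
  apply: cvgV.
    have := qf_gt0 gen (kmono_cvx (ltnSn 1) kp) xp xl.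
    by rewrite /qf invr_gt0 => /gt_eqF ->.
  apply: (@cvg_mder _ _ _ 0) => //; first exact: phic.
  by apply: contrapT => nc; apply: (H5 x01); rewrite add0r.
apply: (@cvg_mder _ _ _ 0) => //; first by rewrite ltr_wpDl.
  by apply: cvgD => //; exact: phic.
by apply: contrapT => nc; apply: (H4 x01); split=> //; rewrite ltr_wpDl.
Qed.

Local Notation F k := (kdist (K_ k) K).

Lemma kdist_lip_cube k (x y : n.-tuple R) : cube n x -> cube n y ->
  `|F k x - F k y| <= 2 * \sum_(i < n) `|tnth x i - tnth y i|.
Proof. by move=> _ _; exact: (kdist_lip (mk_ k) mk). Qed.

Lemma kdist_cvg : (forall x, 0 < x <= 1 -> phir (psi_ k) x @[k --> \oo] --> phir psi x) ->
  forall y, pcube y -> F k y @[k --> \oo] --> 0.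
Proof.
move=> phic y y01; rewrite -[X in _ --> X](_ : \int[@lambda1 R]_(x in setT) 0 = 0); last first.
  by rewrite Rintegral_cst// mul0r.
rewrite /kdist; apply: (@Rintegral_bounded_cvg _ _ _ _ _ _ _ 1) => //.
- by apply: (@le_lt_trans _ _ 1%E); [exact: probability_le1|rewrite ltry].
- by move=> k; apply: measurableT_comp => //; exact: measurable_kernel_diff.
- have FF : Filter (nbhs (almost_everywhere (@lambda1 R))) := ae_filter_ringOfSetsType _.
  move: (kernel_box_cvg_ae phic y01); apply: (@filterS _ _ FF) => x H _.
  rewrite -[X in _ --> X](normr0 R); apply: cvg_norm.
  rewrite -[X in _ --> X](subrr (rK K x (box y))); apply: cvgB => //; exact: cvg_cst.
- by move=> k x _; rewrite normr_id kernel_diff_le1.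
Qed.

Lemma D_inftyP : D_infty (K_ k) K @[k --> \oo] --> 0 <->
  (forall e, 0 < e -> \forall k \near \oo, forall y, cube n y -> F k y <= e).
Proof.
rewrite /D_infty.
rewrite (@cvg_sup0P R (fun k => [set F k y | y in cube n])); last 2 first.
- move=> k; split; last by exists 1 => _ [y _ <-]; exact: kdist_le1.
  exists (F k [tuple 0 | i < n]); exists [tuple 0 | i < n] => // i.
  by rewrite tnth_mktuple lexx ler01.
- by move=> k _ [y _ <-]; exact: kdist_ge0.
split=> H e e0; apply: filterS (H e e0) => k He; last by move=> _ [y cy <-]; exact: He.
by move=> y cy; apply: He; exists y.
Qed.

Lemma D_infty_of_pointwise : (forall y, pcube y -> F k y @[k --> \oo] --> 0) ->
  D_infty (K_ k) K @[k --> \oo] --> 0.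
Proof.
move=> H; apply/D_inftyP => e e0.
apply: filterS (lipschitz_uniform_cube kdist_lip_cube H e0) => k Hk y cy.
exact: le_trans (ler_norm _) (Hk y cy).
Qed.

Lemma D1_of_D_infty : D_infty (K_ k) K @[k --> \oo] --> 0 -> D1 (K_ k) K @[k --> \oo] --> 0.
Proof.
move=> /D_inftyP H; apply/cvgrPdist_le => e e0; apply: filterS (H e e0) => k Hk.
rewrite sub0r normrN ger0_norm; first by apply: D1_le; first exact: ltW.
by apply: Rintegral_ge0.
Qed.

Lemma copula_of_D_infty : D_infty (K_ k) K @[k --> \oo] --> 0 ->
  d_infty (C_ k) C @[k --> \oo] --> 0.
Proof.
move=> /D_inftyP H; apply/copula_cvg_pointwise => x x01; apply/cvgrPdist_le => e e0.
apply: filterS (H e e0) => k Hk; rewrite distrC (tuple_eta x).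
have cb : cube n [tuple of behead x].
  by move=> i; rewrite -tnth_lift0; have /andP[/ltW -> ->] := x01 (lift ord0 i).
apply: le_trans (Hk _ cb); apply: (copula_le_kdist (mk_ k) mk) => //.
by have := x01 ord0; rewrite (tuple_eta x) tnth0.
Qed.

Lemma D1_D2 : D1 (K_ k) K @[k --> \oo] --> 0 -> D2 (K_ k) K @[k --> \oo] --> 0.
Proof.
move=> H; rewrite -[X in _ --> X](sqrtr0 R).
have I20 : D2sq (K_ k) K @[k --> \oo] --> 0.
  apply: (@squeeze_cvgr _ _ _ _ (cst 0) (fun k => D1 (K_ k) K)) => //; last exact: cvg_cst.
  by near=> k; rewrite D2sq_ge0 D2sq_le_D1.
exact: (cvg_comp _ _ I20 (@sqrt_continuous R 0)).
Unshelve. all: by end_near. Qed.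

Lemma D2_D1 : D2 (K_ k) K @[k --> \oo] --> 0 -> D1 (K_ k) K @[k --> \oo] --> 0.
Proof.
move=> H.
have I20 : D2sq (K_ k) K @[k --> \oo] --> 0.
  rewrite -[X in _ --> X](mul0r 0).
  rewrite (_ : (fun k => D2sq (K_ k) K) = fun k => D2 (K_ k) K * D2 (K_ k) K); first exact: cvgM.
  by apply/funext => k; rewrite -expr2 /D2 sqr_sqrtr//; exact: D2sq_ge0.
apply/cvgrPdist_le => e e0.
have e2 : 0 < e / 2 by rewrite divr_gt0.
have e4 : 0 < e / 2 * (e / 2) by rewrite mulr_gt0.
move/cvgrPdist_le : I20 => /(_ _ e4); apply: filterS => k.
rewrite !sub0r !normrN ger0_norm ?D2sq_ge0// => Hk.
rewrite ger0_norm; last by apply: Rintegral_ge0.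
apply: le_trans (D1_le_D2sq _ _ e2) _.
rewrite [leRHS]splitr lerD2l ler_pdivrMr//.
Qed.

(** On the box of points whose coordinates are between (1 - r) y i and y i,
    the Lipschitz bound keeps the distance above its value at y minus 2 n r.
    The box has positive measure, so a small mean forces a small value at y. *)
Lemma D_infty_of_D1 : D1 (K_ k) K @[k --> \oo] --> 0 -> D_infty (K_ k) K @[k --> \oo] --> 0.
Proof.
move=> H; apply: D_infty_of_pointwise => y y01.
apply/cvgrPdist_le => e e0.
have nR : 0 < n%:R :> R by rewrite ltr0n.
(* Chosen so that 2 n r <= e / 2 and the box stays in the cube. *)
pose r := Num.min (1/2) (e / (4 * n%:R)).
have r0 : 0 < r by rewrite /r lt_min !divr_gt0// mulr_gt0.
have r1 : r <= 1/2 by rewrite /r ge_min lexx.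
have re : 2 * n%:R * r <= e / 2.
  have : r <= e / (4 * n%:R) by rewrite /r ge_min lexx orbT.
  rewrite ler_pdivlMr ?mulr_gt0// => h; rewrite ler_pdivlMr//.
  by apply: le_trans h; rewrite le_eqVlt; apply/orP; left; apply/eqP; ring.
pose A (i : 'I_n) : set R := `](1 - r) * tnth y i, tnth y i]%classic.
pose Q := [set t : n.-tuple R | forall i, A i (tnth t i)].
have mQ : measurable Q by apply: measurable_allcoord => i; exact: measurable_itv.
pose a : R := \prod_(i < n) (r * tnth y i).
have a0 : 0 < a by apply: prodr_gt0 => i _; have /andP[yp _] := y01 i; exact: mulr_gt0.
have QE : (lambda n Q = a%:E)%E.
  transitivity (\prod_(i < n) @lambda1 R (A i))%E; first by apply: lambda_prod => i; exact: measurable_itv.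
  transitivity (\prod_(i < n) (r * tnth y i)%:E)%E; last exact: prodEFin.
  apply: eq_bigr => i _.
  have /andP[yp yl] := y01 i.
  rewrite /A lambda1_itv//; last 2 first.
  - by rewrite mulr_ge0 ?(ltW yp)//; lra.
  - by rewrite ler_piMl ?(ltW yp)//; lra.
  by congr (_%:E); ring.
have key k : F k y <= e / 2 + D1 (K_ k) K / a.
  have bdd (g : n.-tuple R -> R) (D : set (n.-tuple R)) c : measurable D -> measurable_fun setT g ->
      (forall t, `|g t| <= c) -> (lambda n).-integrable D (EFin \o g).
    move=> mD mg gc; apply: (@bounded_integrable _ _ _ _ _ _ c) => //.
      by rewrite -ge0_fin_numE// fin_num_measure.
    exact: measurable_funTS.
  have intF D : measurable D -> (lambda n).-integrable D (EFin \o F k).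
    move=> mD; apply: (bdd _ _ 1) => //; first exact: measurable_kdist.
    by move=> t; rewrite ger0_norm ?kdist_ge0// kdist_le1.
  have h : a * (F k y - e / 2) <= \int[lambda n]_(t in Q) F k t.
    have -> : a * (F k y - e / 2) = \int[lambda n]_(t in Q) (F k y - e / 2).
      by rewrite Rintegral_cst// [X in fine X](_ : _ = a%:E)// mulrC.
    apply: le_Rintegral => //; [exact: bdd|exact: intF|].
    move=> t Qt; rewrite lerBlDl -lerBlDr; apply: le_trans re.
    apply: le_trans (ler_norm _) _; apply: le_trans (kdist_lip (mk_ k) mk _ _) _.
    rewrite -mulrA ler_wpM2l// mulrC mulr_natr -[X in _ *+ X](card_ord n) -sumr_const.
    apply: ler_sum => i _; have := Qt i; rewrite /A/= in_itv/= => /andP[l1 l2].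
    have /andP[yp yl] := y01 i.
    rewrite ger0_norm ?subr_ge0//; nra.
  have h2 : \int[lambda n]_(t in Q) F k t <= D1 (K_ k) K.
    rewrite D1E -lee_fin /Rintegral !fineK; try (apply: integrable_fin_num => //; exact: intF).
    - apply: ge0_subset_integral => //.
        by apply/measurable_EFinP; exact: measurable_kdist.
      by move=> t _; rewrite lee_fin kdist_ge0.
  rewrite -lerBlDl ler_pdivlMr// mulrC; exact: le_trans h h2.
have aD : D1 (K_ k) K / a @[k --> \oo] --> 0.
  by rewrite -[X in _ --> X](mul0r a^-1); apply: cvgM => //; exact: cvg_cst.
move/cvgrPdist_le : aD => /(_ (e / 2)); rewrite divr_gt0// => /(_ isT); apply: filterS => k Hk.
rewrite sub0r normrN ger0_norm ?kdist_ge0//; apply: le_trans (key k) _.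
rewrite [leRHS]splitr lerD2l; apply: le_trans Hk; rewrite sub0r normrN; exact: ler_norm.
Qed.

End kernel_convergence.

(** * Weak convergence from boxes *)

Section cube_functions.
Context {R : realType} (n : nat).

Definition vcube : set 'rV[R]_n := [set v | forall i, 0 <= v 0 i <= 1].

Definition uniformly_continuous_on_cube (g : n.-tuple R -> R) := forall e : R, 0 < e ->
  exists2 r : R, 0 < r & forall s t, cube n s -> cube n t ->
    (forall i, `|tnth s i - tnth t i| < r) -> `|g s - g t| <= e.

(** Near-covering compactness, applied to the radius of uniform continuity. *)
Lemma heine_cube (f : 'rV[R]_n -> R) : {within vcube, continuous f} ->
  uniformly_continuous_on_cube (fun t => f (\row_i tnth t i)).
Proof.
move=> /subspace_continuousP cf e e0.
have cpt : compact vcube.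
  rewrite (_ : vcube = [set v : 'rV[R]_n | forall i, `[0, 1]%classic (v ord0 i)]).
    have := @rV_compact R n (fun=> `[0, 1]%classic) (fun _ => @segment_compact R 0 1).
    exact.
  by apply/seteqP; split => v H i; have := H i; rewrite /= in_itv.
pose P (r : R) (u : 'rV[R]_n) := forall v, vcube u -> vcube v ->
  (forall i, `|u 0 i - v 0 i| < r) -> `|f u - f v| <= e.
have : \forall r \near (0 : R)^'+, vcube `<=` P r.
  apply: (compact_near_coveringP _).1 => // x xc.
  have e2 : 0 < e / 2 by rewrite divr_gt0.
  have [/= r r0 Hr] : exists2 r : R, 0 < r & forall v, vcube v ->
      (forall i, `|x 0 i - v 0 i| < r) -> `|f x - f v| <= e / 2.
    have /cvgrPdist_le/(_ _ e2) := cf x xc.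
    rewrite /within/= => /nbhs_ballP[r /= r0 Hr]; exists r => // v vc xv.
    by apply: Hr => //; split => // i j; rewrite !ord1; exact: xv.
  have r2 : 0 < r / 2 by rewrite divr_gt0.
  exists ([set u | ball x (r / 2) u], [set s : R | s < r / 2]) => /=.
    split; first by apply/nbhs_ballP; exists (r / 2).
    exact: nbhs_right_lt.
  move=> [u s] /= [[_ xu] s2] v uc vc uv.
  have xu' i : `|x 0 i - u 0 i| < r / 2 by exact: xu.
  have H1 : `|f x - f u| <= e / 2.
    by apply: Hr => // i; apply: lt_trans (xu' i) _; rewrite gtr_pMr// invf_lt1// ltr1n.
  have H2 : `|f x - f v| <= e / 2.
    apply: Hr => // i; rewrite (_ : x 0 i - v 0 i = (x 0 i - u 0 i) + (u 0 i - v 0 i)); last by ring.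
    apply: le_lt_trans (ler_normD _ _) _; rewrite [ltRHS]splitr; apply: ltrD => //.
    exact: lt_trans (uv i) s2.
  rewrite (_ : f u - f v = (f x - f v) - (f x - f u)); last by ring.
  by apply: le_trans (ler_normB _ _) _; rewrite [leRHS]splitr; exact: lerD.
move=> H; have [r [r0 Hr]] : exists r : R, 0 < r /\ vcube `<=` P r.
  near (0 : R)^'+ => r; exists r; split => //; near: r; exact: H.
exists r => // s t cs ct st.
have sc : vcube (\row_i tnth s i) by move=> i; rewrite mxE.
apply: (Hr _ sc) => // i; by rewrite !mxE.
Unshelve. all: by end_near. Qed.

(** Capping the index at N keeps all grid points in the cube. *)
Definition gridpt N (s : 'I_n -> nat) : n.-tuple R :=
  [tuple (minn (s i) N).+1%:R / N.+1%:R | i < n].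

Lemma gridpt_pcube N s : pcube (gridpt N s).
Proof.
move=> i; rewrite tnth_mktuple divr_gt0//= ler_pdivrMr// mul1r ler_nat ltnS.
exact: geq_minr.
Qed.

Lemma pcube_cube (t : n.-tuple R) : pcube t -> cube n t.
Proof. by move=> h i; have /andP[/ltW -> ->] := h i. Qed.

Section step.
Variable (g : n.-tuple R -> R).

(** By inclusion and exclusion the indicator of the cell with upper corner
    [gridpt N k] is the sum over b of [coefb k b] times the indicator of the
    box with corner [gridpt N (shiftb k b)]: in the coordinate i the cell is a
    difference of two intervals, selected by b i. The second one is empty when
    the cell touches a lower face, whence the factor [0 < k i]. *)
Definition shiftb N (k : {ffun 'I_n -> 'I_N.+1}) (b : {ffun 'I_n -> bool}) (i : 'I_n) : nat :=
  if b i then k i : nat else (k i).-1.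

Definition coefb N (k : {ffun 'I_n -> 'I_N.+1}) (b : {ffun 'I_n -> bool}) : R :=
  \prod_(i < n) (if b i then 1 else - ((0 < k i)%N)%:R).

Definition step N (t : n.-tuple R) : R :=
  \sum_(k : {ffun 'I_n -> 'I_N.+1}) \sum_(b : {ffun 'I_n -> bool})
    (g (gridpt N (fun i => k i)) * coefb k b) * \1_(box (gridpt N (shiftb k b))) t.

Lemma indic_box (t y : n.-tuple R) : cube n t ->
  \1_(box y) t = \prod_(i < n) (tnth t i <= tnth y i)%R%:R :> R.
Proof.
move=> ct; rewrite indicE; case: (pselect (box y t)) => H.
  by rewrite mem_set// big1// => i _; have /andP[_ ->] := H i.
rewrite memNset//; move/existsNP : H => [i].
have /andP[-> _] := ct i; rewrite andTb => /negP/negbTE H.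
by rewrite (bigD1 i)//= H mul0r.
Qed.

(** The sum over b of products is the product over i of two-term sums, each of
    which decides whether the i-th index of the cell containing t is k i. *)
Lemma stepE N t : cube n t -> exists k : {ffun 'I_n -> 'I_N.+1},
  step N t = g (gridpt N (fun i => k i)) /\ forall i, `|tnth t i - tnth (gridpt N (fun i => k i)) i| <= N.+1%:R^-1.
Proof.
move=> ct.
have [kap H] := choice (fun i => cell_index N (ct i)).
have tg (i : 'I_n) s : (s i < N.+1)%N -> (tnth t i <= tnth (gridpt N s) i) = (kap i <= s i)%N.
  by move=> si; rewrite tnth_mktuple (minn_idPl _)//; exact: (H i).1.
exists (finfun kap); split; last first.
  move=> i; rewrite tnth_mktuple ffunE (minn_idPl _); first exact: (H i).2.
  by rewrite -ltnS.
have cell (k : {ffun 'I_n -> 'I_N.+1}) :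
    \sum_(b : {ffun 'I_n -> bool}) coefb k b * \1_(box (gridpt N (shiftb k b))) t =
    (k == finfun kap)%:R :> R.
  pose E (i : 'I_n) (b : bool) : R := if b then (kap i <= k i)%N%:R
    else - ((0 < k i)%N && (kap i <= (k i).-1)%N)%:R.
  transitivity (\sum_(b : {ffun 'I_n -> bool}) \prod_(i < n) E i (b i)).
    apply: eq_bigr => b _; rewrite (indic_box _ ct) /coefb -big_split/=.
    apply: eq_bigr => i _; rewrite tg /E /shiftb; last first.
      by case: (b i) => //; rewrite (leq_ltn_trans (leq_pred _)).
    case: (b i); first by rewrite mul1r.
    by case: (0 < k i)%N; rewrite ?mulN1r// oppr0 mul0r.
  rewrite -(bigA_distr_bigA E).
  transitivity (\prod_(i < n) ((k i == kap i)%:R : R)).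
    apply: eq_bigr => i _; rewrite big_bool /E -val_eqE/=.
    case: (val (k i)) => [|m] /=; first by rewrite oppr0 addr0 leqn0 eq_sym.
    rewrite leq_eqVlt ltnS [m.+1 == _]eq_sym; case: eqVneq => [->|_] /=; first by rewrite ltnn subr0.
    by rewrite subrr.
  case: eqVneq => [->|/eqP kk].
    by rewrite big1// => i _; rewrite ffunE eqxx.
  have /existsNP[i ki] : ~ (forall i, k i = kap i).
    by move=> h; apply: kk; apply/ffunP => i; rewrite ffunE.
  by rewrite (bigD1 i)//=; move/eqP/negbTE : ki => ->; rewrite mul0r.
rewrite /step.
under eq_bigr do under eq_bigr do rewrite -mulrA.
under eq_bigr do rewrite -mulr_sumr cell.
rewrite (bigD1 (finfun kap))//= eqxx mulr1 big1 ?addr0// => k /negbTE ->.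
by rewrite mulr0.
Qed.

End step.
End cube_functions.

Section weak.
Context {R : realType} (n : nat).
Variables (mu_ : nat -> {measure set (n.-tuple R) -> \bar R}).
Variable mu : {measure set (n.-tuple R) -> \bar R}.
Hypotheses (mu_1 : forall k, mu_ k (cube n) = 1%E) (mu1 : mu (cube n) = 1%E).

Lemma measurable_cube : measurable (cube n : set (n.-tuple R)).
Proof.
rewrite (_ : cube n = box [tuple 1 | i < n]); first exact: measurable_box.
by apply/seteqP; split => t H i; have := H i; rewrite tnth_mktuple.
Qed.
Hint Resolve measurable_cube : core.

Lemma integrable_on_cube (m : {measure set (n.-tuple R) -> \bar R}) (h : n.-tuple R -> R) M :
  m (cube n) = 1%E -> measurable_fun (cube n) h -> (forall t, cube n t -> `|h t| <= M) ->
  m.-integrable (cube n) (EFin \o h).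
Proof.
by move=> m1 mh hM; apply: (@bounded_integrable _ _ _ _ _ _ M) => //; rewrite m1 ltry.
Qed.

(** The functions with convergent integrals form a linear space containing the
    indicators of grid boxes, hence the step functions, which are uniformly
    dense among continuous functions. *)
Let good (h : n.-tuple R -> R) := [/\ measurable_fun (cube n) h,
  exists M, forall t, cube n t -> `|h t| <= M &
  \int[mu_ k]_(t in cube n) h t @[k --> \oo] --> \int[mu]_(t in cube n) h t].

Let good0 : good (fun=> 0).
Proof.
split => //; first by exists 0 => t _; rewrite normr0.
rewrite Rintegral_cst// mul0r; under eq_fun do rewrite Rintegral_cst// mul0r.
exact: cvg_cst.
Qed.

Let goodD f h : good f -> good h -> good (f \+ h).
Proof.
move=> [mf [M fM] cf] [mh [M' hM] ch].
have if_ k := integrable_on_cube (mu_1 k) mf fM.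
have ih_ k := integrable_on_cube (mu_1 k) mh hM.
have i_f := integrable_on_cube mu1 mf fM.
have i_h := integrable_on_cube mu1 mh hM.
split; first exact: measurable_funD.
  by exists (M + M') => t ct; apply: le_trans (ler_normD _ _) _; apply: lerD; [exact: fM|exact: hM].
by rewrite RintegralD//; under eq_fun do rewrite RintegralD//; exact: cvgD.
Qed.

Let goodZ c f : good f -> good (fun t => c * f t).
Proof.
move=> [mf [M fM] cf].
have if_ k := integrable_on_cube (mu_1 k) mf fM.
have i_f := integrable_on_cube mu1 mf fM.
split; first exact: measurable_funM.
  by exists (`|c| * M) => t ct; rewrite normrM ler_wpM2l// fM.
rewrite RintegralZl//; under eq_fun do rewrite RintegralZl//.
by apply: cvgM => //; exact: cvg_cst.
Qed.

Let good_sum (I : finType) (f : I -> n.-tuple R -> R) : (forall i, good (f i)) ->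
  good (fun t => \sum_i f i t).
Proof.
move=> gf; rewrite (_ : (fun _ => _) = \sum_(i : I) f i); last first.
  by apply/funext => t; rewrite fct_sumE.
by elim/big_ind : _ => // f1 f2; exact: goodD.
Qed.

Hypothesis grid_cvg : forall N s,
  fine (mu_ k (box (gridpt N s))) @[k --> \oo] --> fine (mu (box (@gridpt R n N s))).

Let good_box N s : good (\1_(box (@gridpt R n N s))).
Proof.
have mB := measurable_box (@gridpt R n N s).
have E (m : {measure set (n.-tuple R) -> \bar R}) :
    \int[m]_(t in cube n) \1_(box (gridpt N s)) t = fine (m (box (@gridpt R n N s))).
  rewrite /Rintegral integral_indic// setIidl// => t H i.
  have /andP[-> /le_trans] := H i; apply.
  by have /andP[] := @gridpt_pcube R n N s i.
split; first exact: measurable_funTS.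
  by exists 1 => t _; rewrite indicE; case: (_ \in _); rewrite ?normr1 ?normr0.
by rewrite E; under eq_fun do rewrite E; exact: grid_cvg.
Qed.

Lemma cvg_of_grid_boxes g : uniformly_continuous_on_cube g ->
  \int[mu_ k]_(t in cube n) g t @[k --> \oo] --> \int[mu]_(t in cube n) g t.
Proof.
move=> ug.
have gstep N : good (step g N) by do 2 apply: good_sum => ?; exact: goodZ.
have gdist e : 0 < e -> \forall N \near \oo, forall t, cube n t -> `|step g N t - g t| <= e.
  move=> e0; have [r r0 Hr] := ug e e0.
  near=> N => t ct; have [k [-> Hk]] := stepE g N ct.
  apply: Hr => // [|i]; first by apply: pcube_cube; exact: gridpt_pcube.
  rewrite distrC; apply: le_lt_trans (Hk i) _.
  rewrite invf_plt ?posrE//; apply: (@lt_le_trans _ _ N%:R); last by rewrite ler_nat.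
  by near: N; exact: nbhs_infty_gtr.
have mg : measurable_fun (cube n) g.
  apply: (measurable_fun_cvg (h := step g)) => [N|t ct]; first by have [] := gstep N.
  apply/cvgrPdist_le => e e0; apply: filterS (gdist e e0) => N H.
  by rewrite distrC; exact: H.
have [M gM] : exists M, forall t, cube n t -> `|g t| <= M.
  have [N HN] : exists N, forall t, cube n t -> `|step g N t - g t| <= 1.
    by near \oo => N; exists N; near: N; exact: gdist.
  have [_ [M sM] _] := gstep N; exists (M + 1) => t ct.
  rewrite (_ : g t = step g N t - (step g N t - g t)); last by ring.
  by apply: le_trans (ler_normB _ _) _; apply: lerD; [exact: sM|exact: HN].
have dist (m : {measure set (n.-tuple R) -> \bar R}) e N : m (cube n) = 1%E ->
    (forall t, cube n t -> `|step g N t - g t| <= e) ->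
    `|\int[m]_(t in cube n) step g N t - \int[m]_(t in cube n) g t| <= e.
  move=> m1 H; have [ms [M' sM] _] := gstep N.
  have is_ := integrable_on_cube m1 ms sM.
  have ig := integrable_on_cube m1 mg gM.
  rewrite -RintegralB//.
  have iB : m.-integrable (cube n) (EFin \o (fun t => step g N t - g t)).
    by apply: (@integrable_on_cube _ _ e) => //; exact: measurable_funB.
  apply: le_trans (le_normr_Rintegral _ _) _ => //.
  rewrite -[leRHS]mulr1 -[X in _ * X](_ : fine (m (cube n)) = 1); last by rewrite m1.
  rewrite -Rintegral_cst//; apply: le_Rintegral => //.
  - apply: (@integrable_on_cube _ _ e) => //; last by move=> t ct; rewrite normr_id H.
    by apply: measurableT_comp => //; exact: measurable_funB.
  - by apply: (@integrable_on_cube _ _ `|e|).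
apply/cvgrPdist_le => e e0; have e3 : 0 < e / 3 by rewrite divr_gt0.
have [N HN] : exists N, forall t, cube n t -> `|step g N t - g t| <= e / 3.
  by near \oo => N; exists N; near: N; exact: gdist.
have [_ _ /cvgrPdist_le/(_ _ e3)] := gstep N; apply: filterS => k Hk.
have := dist _ _ _ mu1 HN; have := dist _ _ _ (mu_1 k) HN; move: Hk.
set a := \int[mu]_(t in _) step g N t; set a_ := \int[mu_ k]_(t in _) step g N t.
set b := \int[mu]_(t in _) g t; set b_ := \int[mu_ k]_(t in _) g t.
clearbody a a_ b b_; rewrite !ler_norml.
by move=> /andP[? ?] /andP[? ?] /andP[? ?]; apply/andP; split; lra.
Unshelve. all: by end_near. Qed.

Lemma weak_cvg_of_grid_boxes : weak_cvg mu_ mu.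
Proof. by move=> f cf; apply: cvg_of_grid_boxes; exact: heine_cube. Qed.

End weak.

(** * Weak conditional convergence *)

Section weakly_conditional.
Context {R : realType} (n : nat) (n0 : (0 < n)%N).
Variables (C_ : nat -> @copula R n.+1) (C : @copula R n.+1).
Variables (K_ : nat -> R.-pker (measurableTypeR R) ~> n.-tuple R).
Variables (K : R.-pker (measurableTypeR R) ~> n.-tuple R).
Hypotheses (mk_ : forall k, is_markov_kernel (C_ k) (K_ k)) (mk : is_markov_kernel C K).

Lemma ae_forall_countable (I : countType) d (T : measurableType d)
    (mu : {measure set T -> \bar R}) (P : I -> T -> Prop) :
  (forall i, {ae mu, forall x, P i x}) -> {ae mu, forall x, forall i, P i x}.
Proof.
move=> H; pose Q (j : nat) x := if unpickle j is Some i then P i x else True.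
have : {ae mu, forall x, forall j, Q j x}.
  apply: ae_foralln => j; rewrite /Q; case: unpickle => [i|]; first exact: H.
  by apply: filterE.
have FF : Filter (nbhs (almost_everywhere mu)) := ae_filter_ringOfSetsType _.
by apply: (@filterS _ _ FF) => x Hx i; have := Hx (pickle i); rewrite /Q pickleK.
Qed.

(** There are countably many grid points, so a single null set of x serves all
    of them. *)
Lemma weakly_conditional_of_boxes :
  (forall y, pcube y ->
    {ae @lambda1 R, forall x, rK (K_ k) x (box y) @[k --> \oo] --> rK K x (box y)}) ->
  cvg_weakly_conditional K_ K.
Proof.
move=> H.
have : {ae @lambda1 R, forall x, forall p : nat * {ffun 'I_n -> nat},
    rK (K_ k) x (box (gridpt p.1 p.2)) @[k --> \oo] --> rK K x (box (@gridpt R n p.1 p.2))}.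
  by apply: ae_forall_countable => -[N s]; apply: H; exact: gridpt_pcube.
move=> [N [mN N0 HN]].
have mI : measurable (`[0, 1]%classic : set R) by exact: measurable_itv.
have I1 : @lambda1 R `[0, 1]%classic = 1%E.
  transitivity (@lambda1 R setT); last exact: probability_setT.
  by rewrite /lambda1 /mrestr setIid setTI.
exists (`[0, 1]%classic `\` N); split.
- exact: measurableD.
- by move=> x [].
- rewrite -I1; apply/eqP; rewrite eq_le; apply/andP; split.
    by apply: le_measure; rewrite ?inE//; exact: measurableD.
  have mD : measurable (`[0, 1]%classic `\` N : set R) by exact: measurableD.
  have := @measureU0 _ _ _ (@lambda1 R) _ _ mD mN N0 => <-.
  apply: le_measure; rewrite ?inE//; first exact: measurableU.
  by move=> x xI; case: (pselect (N x)) => Nx; [right|left].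
- move=> x [xI Nx]; apply: weak_cvg_of_grid_boxes.
  + by move=> k; apply: (mk_ k).1; move: xI; rewrite /= in_itv.
  + by apply: mk.1; move: xI; rewrite /= in_itv.
  + move=> M s.
    have Hx : forall p : nat * {ffun 'I_n -> nat}, rK (K_ k) x (box (gridpt p.1 p.2)) @[k --> \oo] -->
        rK K x (box (@gridpt R n p.1 p.2)).
      by apply: contrapT => nx; apply: Nx; exact: HN.
    have := Hx (M, finfun s).
    rewrite (_ : gridpt _ _ = gridpt M s)//.
    by apply: eq_from_tnth => i; rewrite !tnth_mktuple/= ffunE.
Qed.

Section ramp.
Variables (z : n.-tuple R) (e : R) (e0 : 0 < e).

(** A continuous function which is 1 on [box z] and, on the cube, 0 outside
    the box with corner [shift1]. *)
Definition ramp (v : 'rV[R]_n) : R :=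
  Num.max 0 (1 - (\sum_(i < n) Num.max 0 (v 0 i - tnth z i)) / e).

Definition shift1 : n.-tuple R := [tuple Num.min (tnth z i + e) 1 | i < n].

Lemma ramp_continuous : continuous ramp.
Proof.
have maxc (f : 'rV[R]_n -> R) v : {for v, continuous f} ->
    {for v, continuous (fun u => Num.max 0 (f u))}.
  by move=> cf; apply: (@continuous_max _ _ (cst 0) f v) => //; exact: cst_continuous.
have term i : continuous (fun v : 'rV[R]_n => Num.max 0 (v 0 i - tnth z i)).
  move=> v; apply: maxc; apply: (@continuousB _ _ _ (fun v : 'rV[R]_n => v 0 i) (cst (tnth z i))).
    exact: coord_continuous.
  exact: cst_continuous.
have sumc : continuous (fun v : 'rV[R]_n => \sum_(i < n) Num.max 0 (v 0 i - tnth z i)).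
  rewrite (_ : (fun _ => _) = \sum_(i < n) (fun v : 'rV[R]_n => Num.max 0 (v 0 i - tnth z i))); last first.
    by apply/funext => v; rewrite fct_sumE.
  elim/big_ind : _ => // [|f g cf cg v]; first exact: cst_continuous.
  by apply: continuousD; [exact: cf|exact: cg].
have divc : continuous (fun v : 'rV[R]_n => (\sum_(i < n) Num.max 0 (v 0 i - tnth z i)) / e).
  by move=> v; have := continuousM (sumc v) (@cst_continuous _ _ e^-1 v).
have subc : continuous (fun v : 'rV[R]_n => 1 - (\sum_(i < n) Num.max 0 (v 0 i - tnth z i)) / e).
  by move=> v; have := continuousB (@cst_continuous _ _ (1 : R) v) (divc v).
by move=> v; have := maxc _ v (subc v).
Qed.

Let h (t : n.-tuple R) := ramp (\row_i tnth t i).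

Lemma measurable_ramp : measurable_fun setT h.
Proof.
rewrite (_ : h = fun t => Num.max 0 (1 - (\sum_(i < n) Num.max 0 (tnth t i - tnth z i)) / e)).
  apply: measurable_maxr => //; apply: measurable_funB => //.
  apply: measurable_funM => //; apply: measurable_sum => i.
  apply: measurable_maxr => //; apply: measurable_funB => //; exact: measurable_tnth.
apply/funext => t; rewrite /h /ramp.
by under eq_bigr do rewrite mxE.
Qed.

Let sum_ge0 t : 0 <= \sum_(i < n) Num.max 0 (tnth t i - tnth z i) :> R.
Proof. by apply: sumr_ge0 => i _; rewrite le_max lexx. Qed.

Let hE t : h t = Num.max 0 (1 - (\sum_(i < n) Num.max 0 (tnth t i - tnth z i)) / e).
Proof. by rewrite /h /ramp; under eq_bigr do rewrite mxE. Qed.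

Lemma ramp01 t : 0 <= h t <= 1.
Proof.
rewrite hE le_max lexx/= ge_max ler01/= lerBlDr lerDl divr_ge0//; exact: ltW.
Qed.

Lemma ramp_ge t : \1_(box z) t <= h t.
Proof.
rewrite indicE; case: (pselect (box z t)) => H; last first.
  by rewrite memNset//; have /andP[] := ramp01 t.
rewrite mem_set// hE big1 ?mul0r ?subr0 ?le_max ?lexx ?orbT// => i _.
by apply/max_idPl; rewrite subr_le0; have /andP[] := H i.
Qed.

Lemma ramp_le t : cube n t -> h t <= \1_(box shift1) t.
Proof.
move=> ct; rewrite indicE; case: (pselect (box shift1 t)) => H.
  by rewrite mem_set//; have /andP[] := ramp01 t.
rewrite memNset// hE ge_max lexx/= subr_le0 ler_pdivlMr// mul1r.
have [i Hi] : exists i, tnth z i + e < tnth t i.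
  move: H => /existsNP[i]; rewrite tnth_mktuple; have /andP[-> t1] := ct i.
  rewrite andTb => /negP; rewrite -ltNge gt_min => /orP[h1|h1]; first by exists i.
  by move: t1; rewrite leNgt h1.
rewrite (bigD1 i)//=; apply: (@le_trans _ _ (tnth t i - tnth z i)).
  by rewrite lerBrDl ltW.
apply: le_trans (_ : Num.max 0 (tnth t i - tnth z i) <= _); first by rewrite le_max lexx orbT.
by rewrite lerDl; apply: sumr_ge0 => j _; rewrite le_max lexx.
Qed.

Section bounds.
Variables (D : @copula R n.+1) (L : R.-pker (measurableTypeR R) ~> n.-tuple R).
Hypothesis mL : is_markov_kernel D L.

Definition ramp_mean (x : R) := \int[L x]_(t in cube n) ramp (\row_i tnth t i).

Let iL x (f : n.-tuple R -> R) : 0 <= x <= 1 -> measurable_fun setT f -> (forall t, 0 <= f t <= 1) ->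
  (L x).-integrable (cube n) (EFin \o f).
Proof.
move=> x01 mf f01; apply: (@integrable_on_cube _ _ _ _ 1); first exact: (mL.1 x x01).
  exact: measurable_funTS.
by move=> t _; have /andP[f0 f1] := f01 t; rewrite ger0_norm.
Qed.

Let indic01 A (t : n.-tuple R) : 0 <= (\1_A t : R) <= 1.
Proof. by rewrite indicE; case: (_ \in _); rewrite ?lexx ?ler01. Qed.

Let int_box x y : 0 <= x <= 1 -> cube n y -> \int[L x]_(t in cube n) \1_(box y) t = rK L x (box y).
Proof.
move=> x01 cy; rewrite /Rintegral integral_indic//; [|exact: measurable_cube|exact: measurable_box].
rewrite setIidl// => t H i.
have /andP[-> /le_trans] := H i; apply.
by have /andP[] := cy i.
Qed.

Hypothesis cz : cube n z.

Lemma shift1_cube : cube n shift1.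
Proof.
move=> i; rewrite tnth_mktuple ge_min lexx orbT andbT le_min ler01 andbT.
by have /andP[z0 _] := cz i; rewrite addr_ge0// ltW.
Qed.

Let mean_bounds x : 0 <= x <= 1 ->
  rK L x (box z) <= ramp_mean x <= rK L x (box shift1).
Proof.
move=> x01; rewrite -!int_box//; last exact: shift1_cube.
have mc := @measurable_cube R n.
have mB y : measurable_fun setT (\1_(box y) : n.-tuple R -> R).
  by apply: measurable_indic; exact: measurable_box.
have mh := measurable_ramp; have h01 := ramp01.
apply/andP; split; apply: le_Rintegral => //; try exact: iL.
- by move=> t _; exact: ramp_ge.
- by move=> t ct; exact: ramp_le.
Qed.

Lemma measurable_ramp_mean : measurable_fun (`[0, 1]%classic : set R) ramp_mean.
Proof.
have mc := @measurable_cube R n.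
apply: (@measurableT_comp _ _ _ _ _ _ fine) => //.
apply: measurable_funTS.
rewrite (_ : (fun x => _) = fun x => (\int[L x]_t (h t * \1_(cube n) t)%:E)%E); last first.
  by apply/funext => x; rewrite -integral_indicM.
apply: (measurable_fun_integral_kernel (l := L)).
- by move=> U mU; exact: measurable_kernel.
- by move=> t; rewrite lee_fin mulr_ge0//; have /andP[] := ramp01 t.
- by apply/measurable_EFinP; apply: measurable_funM; [exact: measurable_ramp|exact: measurable_indic].
Qed.

Lemma ramp_mean01 x : 0 <= x <= 1 -> 0 <= ramp_mean x <= 1.
Proof.
move=> x01; have /andP[h1 h2] := mean_bounds x01.
rewrite (le_trans _ h1) ?rK_ge0//= (le_trans h2)// rK_le1//; exact: measurable_box.
Qed.

(** The integral over [0, x] of the mass of a box is a value of the copula. *)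
Lemma ramp_mean_bounds x : 0 < x <= 1 ->
  D [tuple of x :: z] <= \int[lambda1]_(t in `[0, x]) ramp_mean t <= D [tuple of x :: shift1].
Proof.
move=> x01; have sub t : (`[0, x]%classic : set R) t -> 0 <= t <= 1.
  by have /andP[_ x1] := x01; rewrite /= in_itv/= => /andP[-> /le_trans]; apply.
have ir : (@lambda1 R).-integrable `[0, x] (EFin \o ramp_mean).
  apply: (@lambda1_integrable_bounded _ _ 1) => //.
    apply: (measurable_funS _ _ measurable_ramp_mean) => //.
  by move=> t /sub/ramp_mean01 /andP[r0 r1]; rewrite ger0_norm.
have iK y : (@lambda1 R).-integrable `[0, x] (EFin \o (rK L ^~ (box y))).
  by apply: integrable_rK => //; exact: measurable_box.
rewrite -(markov_box mL x01 cz) -(markov_box mL x01 shift1_cube).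
by apply/andP; split; apply: le_Rintegral => // t /sub/mean_bounds/andP[].
Qed.

End bounds.
End ramp.

Lemma ramp_mean_cvg z (e x : R) : 0 < e -> cube n z -> 0 < x <= 1 -> cvg_weakly_conditional K_ K ->
  \int[lambda1]_(t in `[0, x]) ramp_mean z e (K_ k) t @[k --> \oo]
    --> \int[lambda1]_(t in `[0, x]) ramp_mean z e K t.
Proof.
move=> e0 cz x01 [Lam [mLam LI L1 HL]].
have sub : (`[0, x]%classic : set R) `<=` `[0, 1]%classic.
  move=> t; have /andP[_ x1] := x01; rewrite /= !in_itv/= => /andP[-> tx].
  exact: le_trans tx x1.
have mr (L : R.-pker (measurableTypeR R) ~> n.-tuple R) :
    measurable_fun (`[0, x]%classic : set R) (ramp_mean z e L).
  by apply: (measurable_funS _ sub) => //; exact: (measurable_ramp_mean z e0 L).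
apply: (@Rintegral_bounded_cvg _ _ _ _ _ _ _ 1) => //.
- by apply: (@le_lt_trans _ _ 1%E); [exact: probability_le1|rewrite ltry].
- by move=> k; exact: mr.
- exact: mr.
- exists (~` Lam); split; first exact: measurableC.
    transitivity (1 - @lambda1 R Lam)%E; first exact: probability_setC.
    by rewrite L1 subee.
  move=> t /= nt Lt; apply: nt => _; apply: (HL t Lt).
  by apply: continuous_subspaceT; exact: ramp_continuous.
- move=> k t /sub; rewrite /= in_itv => /(ramp_mean01 e0 (mk_ k) cz)/andP[r0 r1].
  by rewrite ger0_norm.
Qed.

(** For d small enough, the ramps starting at y - d and at y confine C_n (x,
    y), for large n, between C (x, y - d) and C (x, y + d) up to e / 2, while
    the Lipschitz property of C controls these two values. *)
Lemma copula_of_weakly_conditional : cvg_weakly_conditional K_ K ->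
  d_infty (C_ k) C @[k --> \oo] --> 0.
Proof.
move=> H; apply/copula_cvg_pointwise => x x01; apply/cvgrPdist_le => e e0.
pose x0 := tnth x ord0; pose y := [tuple of behead x].
have xE : x = [tuple of x0 :: y] by rewrite [LHS]tuple_eta.
have hx0 : 0 < x0 <= 1 by exact: x01.
have hy i : 0 < tnth y i <= 1 by rewrite -tnth_lift0; exact: x01.
have nR : 0 < n%:R :> R by rewrite ltr0n.
have [d [d0 dn dy]] : exists d, [/\ 0 < d, n%:R * d <= e / 2 & forall i, d <= tnth y i].
  near (0 : R)^'+ => d; exists d; split => //.
    rewrite mulrC -ler_pdivlMr//; near: d; apply: nbhs_right_le.
    by rewrite !divr_gt0.
  near: d; apply: filter_forall => i; apply: nbhs_right_le.
  by have /andP[] := hy i.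
have cy : cube n y by move=> i; have /andP[/ltW -> ->] := hy i.
(* The ramp starting at z = y - d vanishes outside the box with corner y. *)
pose z : n.-tuple R := [tuple tnth y i - d | i < n].
have cz : cube n z.
  move=> i; rewrite tnth_mktuple subr_ge0 dy/= lerBlDr.
  by have /andP[_ h1] := hy i; rewrite (le_trans h1)// lerDl ltW.
have sz : shift1 z d = y.
  apply: eq_from_tnth => i; rewrite !tnth_mktuple subrK; apply/min_idPl.
  by have /andP[] := hy i.
have cs : cube n (shift1 y d) by exact: shift1_cube.
have lip u v : cube n u -> cube n v -> (forall i, `|tnth u i - tnth v i| <= d) ->
    `|C [tuple of x0 :: u] - C [tuple of x0 :: v]| <= e / 2.
  move=> cu cv uv.
  have cc w : cube n w -> cube n.+1 [tuple of x0 :: w].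
    move=> cw i; case: (unliftP ord0 i) => [j ->|->]; rewrite ?tnthS ?tnth0//.
    by have /andP[/ltW -> ->] := hx0.
  apply: le_trans (cop_lip C (cc _ cu) (cc _ cv)) _.
  rewrite big_ord_recl !tnth0 subrr normr0 add0r; apply: le_trans dn.
  rewrite mulr_natl -[X in _ *+ X](card_ord n) -sumr_const.
  by apply: ler_sum => i _; rewrite !tnthS.
have L1 : `|C [tuple of x0 :: z] - C [tuple of x0 :: y]| <= e / 2.
  apply: lip => // i; rewrite tnth_mktuple (_ : _ - _ = - d); last by ring.
  by rewrite normrN gtr0_norm.
have L2 : `|C [tuple of x0 :: shift1 y d] - C [tuple of x0 :: y]| <= e / 2.
  apply: lip => // i; rewrite tnth_mktuple; have /andP[y0 y1] := hy i.
  by case: (leP (tnth y i + d) 1) => h; rewrite ler_norml; apply/andP; split; lra.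
have e2 : 0 < e / 2 by rewrite divr_gt0.
have /cvgrPdist_le/(_ _ e2) R1 := ramp_mean_cvg d0 cz hx0 H.
have /cvgrPdist_le/(_ _ e2) R2 := ramp_mean_cvg d0 cy hx0 H.
apply: filterS2 R1 R2 => k.
have /andP[_ B1] := ramp_mean_bounds d0 (mk_ k) cz hx0.
have /andP[B2 _] := ramp_mean_bounds d0 mk cz hx0.
have /andP[B3 _] := ramp_mean_bounds d0 (mk_ k) cy hx0.
have /andP[_ B4] := ramp_mean_bounds d0 mk cy hx0.
rewrite sz in B1.
move: L1 L2 B1 B2 B3 B4; rewrite xE.
set a1 := \int[lambda1]_(t in _) _; set a2 := \int[lambda1]_(t in _) _.
set a3 := \int[lambda1]_(t in _) _; set a4 := \int[lambda1]_(t in _) _.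
clearbody a1 a2 a3 a4.
rewrite !ler_norml => /andP[? ?] /andP[? ?] ? ? ? ? /andP[? ?] /andP[? ?].
by apply/andP; split; lra.
Unshelve. all: by end_near. Qed.

End weakly_conditional.

(** * Equivalence of the modes of convergence *)

Section main.
Context {R : realType} (d : nat).
Variables (C_ : nat -> @copula R d.+2) (C : @copula R d.+2).
Variables (psi_ : nat -> R -> R) (psi : R -> R).
Hypotheses (gen_ : forall k, is_generator (psi_ k)) (gen : is_generator psi).
Hypotheses (arch_ : forall k, archimedean (C_ k) (psi_ k)) (arch : archimedean C psi).

Definition phir_cvg := forall x : R, 0 < x <= 1 -> phir (psi_ n) x @[n --> \oo] --> phir psi x.

Let i0 : 'I_d.+2 := ord0.
Let i1 : 'I_d.+2 := @Ordinal d.+2 1 isT.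

Lemma phir_cvg_of_marginal :
  d_infty (marginal2 (C_ n) i0 i1) (marginal2 C i0 i1) @[n --> \oo] --> 0 -> phir_cvg.
Proof.
have c01 (D : @copula R d.+2) (x : 2.-tuple R) : cube 2 x -> 0 <= marginal2 D i0 i1 x <= 1.
  by move=> cx; apply: cop01; exact: put2_cube.
move=> /(d_infty_cvgP (fun n => c01 (C_ n)) (c01 C)) H.
apply: (phir_of_bivariate gen_ gen arch_ arch (i := i0) (j := i1)) => // x cx.
apply/cvgrPdist_le => e e0; apply: filterS (H e e0) => n Hn.
by rewrite distrC; exact: Hn.
Qed.

Lemma phir_cvg_of_copula : d_infty (C_ n) C @[n --> \oo] --> 0 -> phir_cvg.
Proof. by move=> H; apply: phir_cvg_of_marginal; exact: d_infty_marginal2. Qed.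

Lemma copula_cvg_of_phir : phir_cvg -> d_infty (C_ n) C @[n --> \oo] --> 0.
Proof.
by move=> H; apply/copula_cvg_pointwise => x x01; exact: (copula_of_phir gen_ gen arch_ arch H x01).
Qed.

Lemma phir_cvgP : phir_cvg <->
  (forall x : R, 0 < x <= 1 -> pseudoinverse (psi_ n) x @[n --> \oo] --> pseudoinverse psi x).
Proof.
split=> H x x01; have := H x x01.
  rewrite (pinv_phir gen x01) (_ : (fun n => pseudoinverse (psi_ n) x) = fun n => (phir (psi_ n) x)%:E); last first.
    by apply/funext => n; rewrite (pinv_phir (gen_ n) x01).
  by move=> h; apply: cvg_EFin => //; near=> n.
rewrite (pinv_phir gen x01) (_ : (fun n => pseudoinverse (psi_ n) x) = fun n => (phir (psi_ n) x)%:E); last first.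
  by apply/funext => n; rewrite (pinv_phir (gen_ n) x01).
by move/fine_cvg.
Unshelve. all: by end_near. Qed.

Lemma generator_cvg_of_uniform : {uniform `[0, +oo[, psi_ @ \oo --> psi} ->
  forall z : R, 0 < z -> psi_ n z @[n --> \oo] --> psi z.
Proof.
move=> /cvg_uniform_onP H z z0; apply/cvgrPdist_le => e e0.
by apply: filterS (H e e0) => n /(_ z) Hn; apply/ltW/Hn; rewrite /= in_itv/= andbT ltW.
Qed.

Lemma phir_cvg_of_generators :
  (forall z : R, 0 < z -> psi_ n z @[n --> \oo] --> psi z) -> phir_cvg.
Proof.
move=> H x; apply: (dense_phir gen_ gen) => a b a0 ab; exists ((a + b) / 2).
  by rewrite !midf_lt.
by apply: H; rewrite divr_gt0// ltr_pwDr// (le_lt_trans a0).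
Qed.

End main.
Theorem theorem4p3 (R : realType) (d : nat) (d_ge2 : (2 <= d)%N)
    (C : copula d) (C_ : nat -> copula d)
    (psi : R -> R) (psi_ : nat -> R -> R)
    (gen_psi : is_generator psi) (gen_psi_ : forall n, is_generator (psi_ n))
    (arch_C : archimedean C psi)
    (arch_C_ : forall n, archimedean (C_ n) (psi_ n)) :
  let phi := pseudoinverse psi in
  let phi_ n := pseudoinverse (psi_ n) in
  let i := d_infty (C_ n) C @[n --> \oo] --> 0 in
  let ii := forall i j : 'I_d, (i < j)%N ->
    d_infty (marginal2 (C_ n) i j) (marginal2 C i j) @[n --> \oo] --> 0 in
  let iii := forall x : R, 0 < x <= 1 -> phi_ n x @[n --> \oo] --> phi x in
  let iv := {uniform `[0, +oo[, psi_ @ \oo --> psi} in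
  let v :=
    (forall m, (1 <= m <= d - 2)%N -> forall z : R, 0 < z ->
       derive1n m (psi_ n) z @[n --> \oo] --> derive1n m psi z) /\
    (forall z : R, 0 < z ->
       {for z, continuous (left_derivative (derive1n (d - 2)%N psi))} ->
       left_derivative (derive1n (d - 2)%N (psi_ n)) z @[n --> \oo]
         --> left_derivative (derive1n (d - 2)%N psi) z) in
  let vi := forall m (m_lt_d : (m < d)%N), (2 <= m)%N ->
    {ae lambda m, forall x,
       copula_density (marginal1m (C_ n) (ltnW m_lt_d)) x @[n --> \oo]
         --> copula_density (marginal1m C (ltnW m_lt_d)) x} in
  [/\ [<-> i; ii; iii; iv; v],
      (* for d = 2 there is no m with 2 <= m < d, so vi holds trivially *)
      (3 <= d)%N -> (i <-> vi) &
      forall (K : R.-pker (measurableTypeR R) ~> d.-1.-tuple R)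
             (K_ : nat -> R.-pker (measurableTypeR R) ~> d.-1.-tuple R),
        is_markov_kernel C K -> (forall n, is_markov_kernel (C_ n) (K_ n)) ->
        let vii1 := D1 (K_ n) K @[n --> \oo] --> 0 in
        let vii2 := D2 (K_ n) K @[n --> \oo] --> 0 in
        let viii := D_infty (K_ n) K @[n --> \oo] --> 0 in
        let ix := cvg_weakly_conditional K_ K in
        [<-> i; vii1; vii2; viii; ix]].
Proof.
case: d d_ge2 C C_ arch_C arch_C_ => [//|[//|m]] _ C C_ arch_C arch_C_.
move=> phi phi_ i ii iii iv v vi.
have k_ n : kmono m.+2 (psi_ n) := archimedean_kmono (gen_psi_ n) (arch_C_ n) isT.
have k : kmono m.+2 psi := archimedean_kmono gen_psi arch_C isT.
have phir_i : i -> phir_cvg psi_ psi := phir_cvg_of_copula gen_psi_ gen_psi arch_C_ arch_C.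
have i_phir : phir_cvg psi_ psi -> i := copula_cvg_of_phir gen_psi_ gen_psi arch_C_ arch_C.
split.
- tfae.
  + by move=> H a b _; exact: d_infty_marginal2.
  + move=> H; apply/(phir_cvgP gen_psi_ gen_psi).
    by apply: (phir_cvg_of_marginal gen_psi_ gen_psi arch_C_ arch_C); exact: H.
  + by move=> /(phir_cvgP gen_psi_ gen_psi) H; exact: phir_cvg_uniform.
  + move=> /generator_cvg_of_uniform H; rewrite /v (_ : (m.+2 - 2)%N = m); last by rewrite !subSS subn0.
    exact: (derivatives_of_cvg k_ k H).
  + rewrite /v (_ : (m.+2 - 2)%N = m); last by rewrite !subSS subn0.
    move=> H; apply: i_phir; apply: (phir_cvg_of_generators gen_psi_ gen_psi).
    exact: (cvg_of_derivatives gen_psi_ gen_psi k_ k H).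
- move=> d3; split=> [/phir_i H p pd p2|H].
    exact: (densities_of_phir gen_psi_ gen_psi arch_C_ arch_C pd p2 H).
  apply: i_phir.
  apply: (phir_of_bivariate gen_psi_ gen_psi arch_C_ arch_C
    (i := ord0) (j := @Ordinal m.+2 1 isT)) => // x.
  by apply: (bivariate_of_densities gen_psi_ gen_psi arch_C_ arch_C _ _ (H _ d3 _)).
- move=> K K_ mk mk_ vii1 vii2 viii ix.
  have viii_phir : phir_cvg psi_ psi -> viii.
    move=> H; apply: (D_infty_of_pointwise mk_ mk) => y.
    exact: (kdist_cvg _ gen_psi_ gen_psi arch_C_ arch_C mk_ mk H).
  tfae.
  + by move=> /phir_i/viii_phir; exact: D1_of_D_infty.
  + exact: D1_D2.
  + by move=> /D2_D1; exact: (D_infty_of_D1 _ mk_ mk).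
  + move=> /(copula_of_D_infty mk_ mk)/phir_i H.
    apply: (weakly_conditional_of_boxes mk_ mk) => y.
    exact: (kernel_box_cvg_ae _ gen_psi_ gen_psi arch_C_ arch_C mk_ mk H).
  + exact: (copula_of_weakly_conditional _ mk_ mk).
Qed.
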